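(* Let $u=u_{\rm cusp}$ be the cusped soliton, and let $$\mathcal{L}:=-(1-u^2)\partial_x^2+\frac{1+u^2}{1-u^2}.$$ Then the spectrum of $\mathcal{L}$ in $L^2(\mathbb{R})$ is $\sigma(\mathcal{L})=[1,\infty)$.
   Context: Cusped soliton $u_{\rm cusp}$: $u_{\rm cusp}(0)=1$ and for $x\ne0$, $u=u_{\rm cusp}(x)\in(0,1)$ is defined by $|x|=\int_u^1\frac{d\xi}{\sqrt{-\log(1-\xi^2)}}$. It satisfies $u''=u/(1-u^2)$ for $x\neq0$, and $1-u^2$ vanishes only at $x=0$. The operator $\mathcal{L}$ is the linearization at $u$ of $F(u)=-(1-u^2)u''+u$. It is considered as an operator $\mathcal{L}:{\rm Dom}(\mathcal{L})\subset L^2(\mathbb{R})\to L^2(\mathbb{R})$ with ${\rm Dom}(\mathcal{L})=\{v\in L^2(\mathbb{R}):\ (1-u^2)v''\in L^2(\mathbb{R})\}$, where $\mathcal{L}v\in L^2(\mathbb{R})$ is required as well (so that both terms of $\mathcal{L}v$ are in $L^2(\mathbb{R})$). *)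

(* Defs.v *)
From HB Require Import structures.
From mathcomp Require Import all_boot all_order all_algebra.
From mathcomp Require Import all_classical all_reals all_analysis.
From mathcomp.real_closed Require Import complex.

Set Implicit Arguments.
Unset Strict Implicit.
Unset Printing Implicit Defensive.

Import Order.TTheory GRing.Theory Num.Theory.
Import numFieldNormedType.Exports.

Local Open Scope classical_set_scope.
Local Open Scope ring_scope.
Local Open Scope complex_scope.

(* The value of the integrand at xi = 1 is immaterial: a single point is
   negligible. *)
Definition cusp_integral (R : realType) (s : R) : \bar R :=
  \int[lebesgue_measure]_(xi in `[s, 1%R]) ((Num.sqrt (- ln (1 - xi ^+ 2)))^-1)%:E.

(* s |-> cusp_integral s is a decreasing bijection from ]0, 1[ onto ]0, +oo[,
   so for x != 0 the set below is a singleton and the default 0 of xget is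
   never used. *)
Definition ucusp (R : realType) (x : R) : R :=
  if x == 0 then 1
  else xget 0 [set s : R | 0 < s < 1 /\ (`|x|%:E = cusp_integral s)%E].

(* L^2(R) = L^2(R; C). Its elements are handled through representatives
   f : R -> R[i], equality in L^2(R) being equality almost everywhere. *)
Definition L2 (R : realType) : set (R -> R[i]) :=
  [set f | ((fun x => complex.Re (f x)) \in Lfun lebesgue_measure 2%:E) /\
           ((fun x => complex.Im (f x)) \in Lfun lebesgue_measure 2%:E)].

Definition L2norm (R : realType) (f : R -> R[i]) : \bar R :=
  Lnorm lebesgue_measure 2%:E (fun x => (complex.Re `|f x|)%:E).

Definition test_function (R : realType) (D : set R) (phi : R -> R) : Prop :=
  (forall (n : nat) (x : R), derivable (derive1n n phi) x 1) /\
  (exists K : set R, [/\ compact K, K `<=` D & forall x, ~ K x -> phi x = 0]).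

Definition weak_derive2_real (R : realType) (D : set R) (v w : R -> R) : Prop :=
  [/\ locally_integrable D v, locally_integrable D w &
      forall phi, test_function D phi ->
        Rintegral lebesgue_measure D (fun x => v x * derive1n 2 phi x) =
        Rintegral lebesgue_measure D (fun x => w x * phi x)].

Definition weak_derive2 (R : realType) (D : set R) (v w : R -> R[i]) : Prop :=
  weak_derive2_real D (fun x => complex.Re (v x)) (fun x => complex.Re (w x)) /\
  weak_derive2_real D (fun x => complex.Im (v x)) (fun x => complex.Im (w x)).

(* Unbounded operators in L^2(R) are given by their graphs: T v g means that
   v lies in Dom(T) and that g represents T v. *)
Definition L2operator (R : realType) := (R -> R[i]) -> (R -> R[i]) -> Prop.

(* z is in the resolvent set when T - z : Dom(T) -> L^2(R) is injective,
   surjective, and has a bounded inverse. *)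
Definition resolvent_set (R : realType) (T : L2operator R) : set R[i] :=
  [set z | [/\
    forall v g, T v g -> g = (fun x => z * v x) %[ae lebesgue_measure] ->
      v = (fun=> 0) %[ae lebesgue_measure],
    forall f, L2 f -> exists v g,
      T v g /\ (fun x => g x - z * v x) = f %[ae lebesgue_measure] &
    exists C : R, forall v g, T v g ->
      (L2norm v <= C%:E * L2norm (fun x => (g x - z * v x)%R))%E]].

Definition spectrum (R : realType) (T : L2operator R) : set R[i] :=
  ~` resolvent_set T.

(* L v = - (1 - u^2) v'' + (1 + u^2) / (1 - u^2) v with u = ucusp, on the
   domain of those v in L^2(R) for which both terms are in L^2(R).
   Here v'' is the distributional second derivative on R \ {0}, where the
   coefficients are regular: since 1 - u^2 vanishes at 0 only, requiring
   (1 - u^2) v'' to be in L^2(R) determines v'' as a locally integrable function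
   on R \ {0}, but v'' need not be integrable near 0. The value w 0 and the
   quotient by 0 at x = 0 only matter on a negligible set. *)
Definition cuspL (R : realType) : L2operator R := fun v g =>
  L2 v /\ L2 g /\
  exists w : R -> R[i],
    let lead := fun x => (1 - ucusp x ^+ 2)%:C * w x in
    let pot := fun x => ((1 + ucusp x ^+ 2) / (1 - ucusp x ^+ 2))%:C * v x in
    [/\ weak_derive2 [set~ 0] v w, L2 lead, L2 pot &
        g = (fun x => - lead x + pot x) %[ae lebesgue_measure]].

(* Main.v *)
Require Import Defs.
From HB Require Import structures.
From mathcomp Require Import all_boot all_order all_algebra.
From mathcomp Require Import all_classical all_reals all_analysis.
From mathcomp.real_closed Require Import complex.
From mathcomp Require Import measurable_realfun ring lra.

(** Put [a = 1 - u^2], so that on each half-line [L v = - a v'' + (2 - a) / a v]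
    with [0 < a < 1]. For [z] outside [[1, +oo[] there is a real [beta] with
    [1 - Re z + beta Im z > 0]. Testing [(L - z) v = f] on [x > 0] against
    [(1 - i beta) v / a] bounds the L^2 norm of [v / a], hence that of [v], by the
    one of [f]; the boundary terms disappear thanks to cut-offs built from
    [p = - u' = sqrt (- ln a)], which tends to [+oo] at [0] and satisfies
    [|p'| <= 1 / a]. For existence, [p] solves [p'' = (2 - a) / a^2 p] and so does
    [q = p * int_0^x p^-2]; they provide a Green operator for [L], bounded by
    Schur's test, and since the estimate above is uniform for [t z], [t] in
    [[0, 1]], the method of continuity solves [(L - z) v = f]. The half-lines
    decouple because weak derivatives are taken on [R \ {0}], where the lemma of
    du Bois-Reymond (at Lebesgue points, with the second primitive of a bump as
    test function) makes them classical ones. Finally, for [r = 1 + k^2] with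
    [k] real, the packets [bump ((x - c) / L) e^(i k x)], with [c] so large that
    [u <= 1 / L] on their support, have [|(L - r) v| / |v| = O(1 / L)], so
    [L - r] has no bounded inverse. *)

Set Implicit Arguments.
Unset Strict Implicit.
Unset Printing Implicit Defensive.

Import Order.TTheory GRing.Theory Num.Theory.
Import numFieldNormedType.Exports.

Local Open Scope classical_set_scope.
Local Open Scope ring_scope.

(** * Real integrals *)

(** The soliton equation - (1 - u^2) u'' + u = 0 is invariant under translations; differentiating it
    in x gives L u' = 0, whence the explicit solution p = - u'. It decays at +oo, while q, its
    companion by reduction of order, vanishes at 0. The threshold 1 is the common limit at infinity
    of the two coefficients 1 - u^2 and (1 + u^2) / (1 - u^2), as u tends to 0. The difficulty is
    the cusp: the leading coefficient vanishes there and the domain prescribes no boundary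
    condition, so that nothing is known of v and v' near 0. What is known is that v / a is in L^2,
    because 1 / a <= (2 - a) / a; the estimates are therefore made in that norm. The multiplier 1 -
    i beta tilts the half-plane Re z < 1 around the point 1, and the tilted half-planes cover
    exactly the complement of [1, +oo[. The Green operator has norm at most 1, so a Neumann series
    would only reach |z| < 1; the continuity method asks instead for a bound along the whole segment
    from 0 to z, which one and the same beta provides. *)

Notation RI D f := (Rintegral (@lebesgue_measure _) D f).

Section RealIntegrals.
Context {R : realType}.
Implicit Types (D E : set R) (f g h : R -> R).

Definition intR D f : Prop := (@lebesgue_measure R).-integrable D (EFin \o f).

Lemma intR_meas D f : intR D f -> measurable_fun D f.
Proof. by move=> /measurable_int/measurable_EFinP. Qed.

Lemma intRS D E f : measurable D -> measurable E -> E `<=` D ->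
  intR D f -> intR E f.
Proof. by move=> mD mE ED; exact: integrableS. Qed.

Lemma eq_intR D f g : measurable D -> (forall x, D x -> f x = g x) ->
  intR D f -> intR D g.
Proof.
move=> mD fg; apply: eq_integrable => // x /set_mem Dx /=.
by rewrite fg.
Qed.

Lemma intRD D f g : measurable D -> intR D f -> intR D g ->
  intR D (fun x => f x + g x).
Proof. by move=> mD fi gi; exact: (@integrableD _ _ _ (@lebesgue_measure R) D mD _ _ fi gi). Qed.

Lemma intRN D f : measurable D -> intR D f -> intR D (fun x => - f x).
Proof. by move=> mD fi; exact: (@integrableN _ _ _ (@lebesgue_measure R) D _ fi). Qed.

Lemma intRB D f g : measurable D -> intR D f -> intR D g ->
  intR D (fun x => f x - g x).
Proof. by move=> mD fi gi; exact: intRD fi (intRN mD gi). Qed.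

Lemma intRZ D k f : measurable D -> intR D f -> intR D (fun x => k * f x).
Proof. by move=> mD fi; exact: (@integrableZl _ _ _ (@lebesgue_measure R) D mD k _ fi). Qed.

Lemma le_intR D f g : measurable D -> measurable_fun D f ->
  (forall x, D x -> `|f x| <= g x) -> intR D g -> intR D f.
Proof.
move=> mD mf fg; apply: le_integrable => //; first exact/measurable_EFinP.
move=> x Dx /=; rewrite lee_fin; apply: le_trans (fg x Dx) _.
exact: ler_norm.
Qed.

Lemma intR_norm D f : intR D f -> intR D (fun x => `|f x|).
Proof. by move=> fi; have := integrable_norm fi. Qed.

Lemma intRM_bounded D M h f : measurable D -> measurable_fun D h ->
  (forall x, D x -> `|h x| <= M) -> intR D f -> intR D (fun x => h x * f x).
Proof.
move=> mD mh hM fi; apply: (@le_intR _ _ (fun x => M * `|f x|)) => //.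
- by apply: measurable_funM => //; exact: intR_meas fi.
- by move=> x Dx; rewrite normrM ler_wpM2r// hM.
- by apply: intRZ => //; exact: intR_norm.
Qed.

Lemma intR_cst a b k : intR `[a, b] (fun=> k).
Proof.
apply/integrableP; split; first exact: measurable_cst.
under eq_integral do rewrite /=.
rewrite integral_cst//= lebesgue_measure_itv/= lte_fin.
by case: ifP => _; rewrite ?mule0 ?ltry// -EFinD -EFinM ltry.
Qed.

Lemma intR_bounded_itv (a b : R) M f : measurable_fun `[a, b] f ->
  (forall x, a <= x <= b -> `|f x| <= M) -> intR `[a, b] f.
Proof.
move=> mf fM; apply: (@le_intR _ _ (fun=> M)) => //; last exact: intR_cst.
Qed.

Lemma eq_RI D f g : (forall x, D x -> f x = g x) -> RI D f = RI D g.
Proof. by move=> fg; apply: eq_Rintegral => x /set_mem; exact: fg. Qed.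

Lemma RI_fin D f : intR D f -> measurable D ->
  (\int[@lebesgue_measure R]_(x in D) (f x)%:E = (RI D f)%:E)%E.
Proof. by move=> fi mD; rewrite /Rintegral fineK//; exact: integrable_fin_num. Qed.

Lemma RIZ D k f : measurable D -> intR D f ->
  RI D (fun x => k * f x) = k * RI D f.
Proof. by move=> mD fi; exact: (@RintegralZl _ _ _ (@lebesgue_measure R) D f k mD fi). Qed.

Lemma RID D f g : measurable D -> intR D f -> intR D g ->
  RI D (fun x => f x + g x) = RI D f + RI D g.
Proof. by move=> mD fi gi; exact: (@RintegralD _ _ _ (@lebesgue_measure R) D f g mD fi gi). Qed.

Lemma RIB D f g : measurable D -> intR D f -> intR D g ->
  RI D (fun x => f x - g x) = RI D f - RI D g.
Proof. by move=> mD fi gi; exact: (@RintegralB _ _ _ (@lebesgue_measure R) D f g mD fi gi). Qed.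

Lemma le_RI D f g : measurable D -> intR D f -> intR D g ->
  (forall x, D x -> f x <= g x) -> RI D f <= RI D g.
Proof. by move=> mD fi gi; exact: (@le_Rintegral _ _ _ (@lebesgue_measure R) D f g mD fi gi). Qed.

Lemma le_norm_RI D f : measurable D -> intR D f ->
  `|RI D f| <= RI D (fun x => `|f x|).
Proof. by move=> mD fi; exact: (@le_normr_Rintegral _ _ _ (@lebesgue_measure R) D f mD fi). Qed.

Lemma intR_patch D f : measurable D -> intR D f <-> intR setT (f \_ D).
Proof.
move=> mD; rewrite /intR -restrict_EFin.
exact: (@integrable_mkcond _ _ _ (@lebesgue_measure R) D (EFin \o f) mD).
Qed.

Lemma ae_impl (P Q : R -> Prop) : (forall x, P x -> Q x) ->
  {ae @lebesgue_measure R, forall x, P x} -> {ae @lebesgue_measure R, forall x, Q x}.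
Proof. by move=> PQ; exact: (@filterS _ _ (ae_filter_ringOfSetsType _)). Qed.

Lemma ae_and (P Q : R -> Prop) : {ae @lebesgue_measure R, forall x, P x} ->
  {ae @lebesgue_measure R, forall x, Q x} ->
  {ae @lebesgue_measure R, forall x, P x /\ Q x}.
Proof. exact: (@filterI _ _ (ae_filter_ringOfSetsType _)). Qed.

Lemma RI_split (a b c : R) f : a <= b -> b <= c -> intR `[a, c] f ->
  RI `[a, c] f = RI `[a, b] f + RI `[b, c] f.
Proof.
move=> ab bc fi.
have ibc : intR `[b, c] f by apply: intRS fi => //; exact: subset_itvr.
rewrite -(@Rintegral_itv_obnd_cbnd _ b (BRight c)); last first.
  by apply: intRS ibc => //; exact: subset_itv_oc_cc.
rewrite -(@Rintegral_itvB _ f (BLeft a) (BRight c) b)//.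
by rewrite addrC subrK.
Qed.

End RealIntegrals.

(** * Fubini's theorem for real-valued integrals *)

Section Fubini.
Context {R : realType}.
Implicit Types (f g : R -> R) (h : R -> R -> R).

Lemma RI_fubini h f g :
  measurable_fun setT (fun z : measurableTypeR R * measurableTypeR R => h z.1 z.2) ->
  intR setT f -> intR setT g ->
  (forall s t, `|h s t| <= `|f s| * `|g t|) ->
  RI setT (fun s => RI setT (h s)) = RI setT (fun t => RI setT (h^~ t)).
Proof.
move=> mh fi gi hfg.
have mhs s : measurable_fun setT (h s).
  exact: (measurableT_comp mh (pair1_measurable s)).
have mht t : measurable_fun setT (h^~ t).
  exact: (measurableT_comp mh (pair2_measurable t)).
have hsi s : intR setT (h s).
  apply: (le_intR measurableT (mhs s) (g := fun t => `|f s| * `|g t|)) => //.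
  by apply: intRZ => //; exact: intR_norm.
have hti t : intR setT (h^~ t).
  apply: (le_intR measurableT (mht t) (g := fun s => `|g t| * `|f s|)) => //.
    by move=> s _; rewrite mulrC.
  by apply: intRZ => //; exact: intR_norm.
pose H (z : measurableTypeR R * measurableTypeR R) := (h z.1 z.2)%:E.
have mH : measurable_fun setT H by exact/measurable_EFinP.
have iH : ((@lebesgue_measure R) \x (@lebesgue_measure R))%E.-integrable setT H.
  apply/integrable12ltyP => //.
  apply: (@le_lt_trans _ _ (\int[@lebesgue_measure R]_s
     (`|f s| * RI setT (fun t => `|g t|))%:E)%E); last first.
    have /integrableP[_] : intR setT (fun s => RI setT (fun t => `|g t|) * `|f s|).
      by apply: intRZ => //; exact: intR_norm.
    apply: le_lt_trans; apply: ge0_le_integral => //=.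
    - move=> s _; rewrite lee_fin mulr_ge0//.
      by apply: Rintegral_ge0.
    - apply/measurable_EFinP; apply: measurable_funM => //.
      exact: intR_meas (intR_norm fi).
    - apply/measurable_EFinP; apply: measurableT_comp => //.
      apply: measurable_funM => //.
      exact: intR_meas (intR_norm fi).
    - by move=> s _; rewrite lee_fin mulrC ler_norm.
  apply: ge0_le_integral => //=.
  - by move=> s _; apply: integral_ge0.
  - have := @measurable_fun_fubini_tonelli_F _ _ _ _ _ (@lebesgue_measure R) (abse \o H).
    apply => //; first by apply: measurableT_comp => //; exact: abse_measurable.
    by move=> z /=.
  - apply/measurable_EFinP; apply: measurable_funM => //.
    exact: intR_meas (intR_norm fi).
  - move=> s _.
    rewrite -(RIZ _ measurableT (intR_norm gi)).
    rewrite -RI_fin//; last by apply: intRZ => //; exact: intR_norm.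
    apply: ge0_le_integral => //=.
    + by apply/measurable_EFinP; apply: measurableT_comp => //; exact: mhs.
    + apply/measurable_EFinP; apply: measurable_funM => //.
      exact: intR_meas (intR_norm gi).
    + by move=> t _; rewrite lee_fin hfg.
have := Fubini iH.
rewrite /H /= => E.
rewrite [in LHS]/Rintegral [in RHS]/Rintegral.
congr fine.
rewrite [LHS](_ : _ = (\int[@lebesgue_measure R]_x \int[@lebesgue_measure R]_y (h x y)%:E)%E); last first.
  by apply: eq_integral => s _; rewrite RI_fin//; exact: hsi.
rewrite E.
by apply: eq_integral => t _; rewrite RI_fin//; exact: hti.
Qed.

Definition cut f (x y : R) := fun s => if (x <= s) && (s <= y) then f s else 0.

Lemma cutE f x y : f \_ `[x, y] = cut f x y.
Proof.
apply/funext => s; rewrite patchE /cut.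
by rewrite -[x <= s <= y](in_itv _ `[x, y]) mem_setE.
Qed.

Lemma RI_cut f x y : RI `[x, y] f = RI setT (cut f x y).
Proof. by rewrite Rintegral_mkcond cutE. Qed.

Lemma intR_cut f x y : intR `[x, y] f -> intR setT (cut f x y).
Proof.
by move/intR_patch; rewrite cutE; apply; exact: measurable_itv.
Qed.

(** Both sides integrate f(s) g(t) over the triangle x <= s <= t <= y. This is the core of
    integration by parts for functions that are only absolutely continuous. *)
Lemma RI_triangle f g (x y : R) : intR `[x, y] f -> intR `[x, y] g ->
  RI `[x, y] (fun s => f s * RI `[s, y] g) =
  RI `[x, y] (fun t => g t * RI `[x, t] f).
Proof.
move=> fi gi.
pose h s t := if s <= t then cut f x y s * cut g x y t else 0.
have E : RI setT (fun s => RI setT (h s)) = RI setT (fun t => RI setT (h^~ t)).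
  apply: (RI_fubini _ (intR_cut fi) (intR_cut gi)).
  - apply: measurable_fun_if => //; first exact: measurable_fun_ler.
    apply: measurable_funTS; apply: measurable_funM.
      exact: (measurableT_comp (intR_meas (intR_cut fi)) measurable_fst).
    exact: (measurableT_comp (intR_meas (intR_cut gi)) measurable_snd).
  - move=> s t; rewrite /h; case: ifP => _; rewrite ?normrM// normr0.
    exact: mulr_ge0.
have Ls s : cut (fun s => f s * RI `[s, y] g) x y s = RI setT (h s).
  rewrite {1}/cut; case: ifPn => [/andP[xs sy]|sxy]; last first.
    rewrite (@eq_RI R _ _ (fun=> 0)) ?Rintegral_cst ?mul0r// => t _.
    by rewrite /h /cut (negbTE sxy) mul0r; case: ifP.
  have gis : intR `[s, y] g.
    by apply: (intRS _ _ _ gi); [exact: measurable_itv..|exact: subset_itvr].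
  rewrite RI_cut -(RIZ (f s) measurableT (intR_cut gis)).
  apply: eq_RI => t _; rewrite /h /cut xs sy /=.
  case: (leP s t) => st /=; last by rewrite mulr0.
  by rewrite (le_trans xs st).
have Lt t : cut (fun t => g t * RI `[x, t] f) x y t = RI setT (h^~ t).
  rewrite {1}/cut; case: ifPn => [/andP[xt ty]|txy]; last first.
    rewrite (@eq_RI R _ _ (fun=> 0)) ?Rintegral_cst ?mul0r// => s _.
    by rewrite /h /cut (negbTE txy) mulr0; case: ifP.
  have fit : intR `[x, t] f.
    by apply: (intRS _ _ _ fi); [exact: measurable_itv..|exact: subset_itvl].
  rewrite RI_cut -(RIZ (g t) measurableT (intR_cut fit)).
  apply: eq_RI => s _; rewrite /h /cut xt ty /=.
  case: (leP s t) => st /=; last by rewrite andbF mulr0.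
  by rewrite (le_trans st ty) andbT mulrC.
rewrite RI_cut [RHS]RI_cut (eq_RI (fun s _ => Ls s)) E.
by rewrite -(eq_RI (fun s _ => Lt s)).
Qed.

End Fubini.

(** * Local absolute continuity on the half-line *)

Section Primitive.
Context {R : realType}.
Implicit Types (F G f g : R -> R).

(* F is locally absolutely continuous on ]0, +oo[ with almost everywhere
   derivative f *)
Definition prim F f := forall x y : R, 0 < x -> x <= y ->
  intR `[x, y] f /\ F y - F x = RI `[x, y] f.

Lemma itv_pos_sub (x y : R) : 0 < x -> `[x, y]%classic `<=` `]0, +oo[%classic.
Proof.
by move=> x0 z /=; rewrite !in_itv/= => /andP[xz _]; rewrite (lt_le_trans x0).
Qed.

Lemma cont_meas F : {in `](0:R), +oo[, continuous F} -> measurable_fun `](0:R), +oo[ F.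
Proof.
move=> cF; apply: open_continuous_measurable_fun => //.
by move=> x /set_mem/= x0; apply: cF.
Qed.

Lemma cont_meas_itv F (x y : R) : {in `](0:R), +oo[, continuous F} -> 0 < x ->
  measurable_fun `[x, y] F.
Proof.
move=> cF x0; apply: (measurable_funS _ (itv_pos_sub (y := y) x0)) => //.
exact: cont_meas.
Qed.

Lemma cont_within F (x y : R) : {in `](0:R), +oo[, continuous F} -> 0 < x ->
  {within `[x, y], continuous F}.
Proof.
move=> cF x0; apply: continuous_subspace_itv => z zxy; apply: cF.
by rewrite in_itv/= andbT (lt_le_trans x0)//; move: zxy; rewrite in_itv/= => /andP[].
Qed.

Lemma cont_bounded F (x y : R) : {in `](0:R), +oo[, continuous F} -> 0 < x ->
  exists M, forall t, x <= t <= y -> `|F t| <= M.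
Proof.
move=> cF x0; have [xy|yx] := leP x y; last first.
  by exists 0 => t /andP[xt ty]; move: (le_trans xt ty); rewrite leNgt yx.
have cN : {within `[x, y], continuous (fun t => `|F t|)}.
  apply: (@cont_within (fun t => `|F t|)) => // z z0.
  by apply: continuous_comp; [exact: cF|exact: norm_continuous].
have [c _ cM] := EVT_max xy cN.
by exists `|F c| => t txy; apply: cM; rewrite in_itv.
Qed.

Lemma cont_intR F (x y : R) : {in `](0:R), +oo[, continuous F} -> 0 < x ->
  intR `[x, y] F.
Proof.
move=> cF x0; have [M FM] := @cont_bounded F x y cF x0.
apply: (@intR_bounded_itv R x y M) => //.
exact: cont_meas_itv.
Qed.

Lemma prim_cont F f : prim F f -> {in `](0:R), +oo[, continuous F}.
Proof.
move=> Ff x; rewrite in_itv/= andbT => x0.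
have h0 : 0 < x / 2 by rewrite divr_gt0.
have hx : x / 2 < x by rewrite ltr_pdivrMr// ltr_pMr// ltr1n.
have hx1 : x / 2 < x + 1 by rewrite (lt_trans hx)// ltrDl.
have [fi _] := Ff (x / 2) (x + 1) h0 (ltW hx1).
have := parameterized_integral_continuous (ltW hx1) fi.
move=> /(continuous_within_itvP _ hx1)[/(_ x) + _ _].
rewrite in_itv/= hx ltrDl ltr01 => /(_ isT) cx.
have E : {near x, F =1 (fun y => F (x / 2) + RI `[x / 2, y] f)}.
  near=> y.
  have xy : x / 2 <= y by apply: ltW; near: y; exact: lt_nbhsr.
  by rewrite -(Ff _ _ h0 xy).2 addrC subrK.
rewrite /continuous_at (_ : F x = F (x / 2) + RI `[x / 2, x] f); last first.
  by rewrite -(Ff _ _ h0 (ltW hx)).2 addrC subrK.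
have c2 : {for x, continuous (fun y => F (x / 2) + RI `[x / 2, y] f)}.
  by apply: continuousD; [exact: cst_continuous|exact: cx].
apply: cvg_trans c2; apply: near_eq_cvg.
by near=> y; rewrite /= (near E y).
Unshelve. all: by end_near. Qed.

(** Write F t = F x + int_x^t f and G t = G y - int_t^y g: the two double integrals that remain are
    exchanged by [RI_triangle]. *)
Lemma primM F f G g : prim F f -> prim G g ->
  prim (fun x => F x * G x) (fun x => f x * G x + F x * g x).
Proof.
move=> Ff Gg x y x0 xy.
have [fi Fxy] := Ff x y x0 xy.
have [gi Gxy] := Gg x y x0 xy.
have [MF FM] := @cont_bounded F x y (prim_cont Ff) x0.
have [MG GM] := @cont_bounded G x y (prim_cont Gg) x0.
have mF : measurable_fun `[x, y] F := cont_meas_itv (prim_cont Ff) x0.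
have mG : measurable_fun `[x, y] G := cont_meas_itv (prim_cont Gg) x0.
have i1 : intR `[x, y] (fun t => f t * G t).
  apply: (@eq_intR R _ (fun t => G t * f t)) => // [t _|]; first by rewrite mulrC.
  apply: (@intRM_bounded R _ MG) => // t /=; rewrite in_itv; exact: GM.
have i2 : intR `[x, y] (fun t => F t * g t).
  by apply: (@intRM_bounded R _ MF) => // t /=; rewrite in_itv; exact: FM.
split; first exact: intRD.
have ix s : x <= s -> s <= y -> intR `[x, s] f.
  by move=> xs sy; apply: intRS fi => //; exact: subset_itvl.
have iy s : x <= s -> s <= y -> intR `[s, y] g.
  by move=> xs sy; apply: intRS gi => //; exact: subset_itvr.
rewrite [RHS](RID _ i1 i2)//.
have -> : RI `[x, y] (fun t => F t * g t) =
    F x * (G y - G x) + RI `[x, y] (fun t => g t * RI `[x, t] f).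
  have i3 : intR `[x, y] (fun t => F x * g t) by exact: intRZ.
  have i4 : intR `[x, y] (fun t => g t * RI `[x, t] f).
    apply: (@eq_intR R _ (fun t => F t * g t - F x * g t)) => //; last exact: intRB.
    move=> t /=; rewrite in_itv/= => /andP[xt ty].
    by rewrite -(Ff x t x0 xt).2 mulrBr mulrC [g t * F x]mulrC.
  rewrite Gxy -(RIZ (F x) _ gi)// -(RID _ i3 i4)//.
  apply: eq_RI => t /=; rewrite in_itv/= => /andP[xt ty].
  by rewrite -(Ff x t x0 xt).2; ring.
rewrite -RI_triangle//.
have i5 : intR `[x, y] (fun s => f s * RI `[s, y] g).
  apply: (@eq_intR R _ (fun t => G y * f t - f t * G t)) => //; last first.
    by apply: intRB => //; exact: intRZ.
  move=> t /=; rewrite in_itv/= => /andP[xt ty].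
  by rewrite -(Gg t y (lt_le_trans x0 xt) ty).2 mulrBr mulrC.
rewrite addrCA -(RID _ i1 i5)//.
rewrite (@eq_RI R _ _ (fun t => G y * f t)); last first.
  move=> t /=; rewrite in_itv/= => /andP[xt ty].
  by rewrite -(Gg t y (lt_le_trans x0 xt) ty).2; ring.
by rewrite (RIZ (G y) _ fi)// -Fxy; ring.
Qed.

Lemma primD F f G g : prim F f -> prim G g ->
  prim (fun x => F x + G x) (fun x => f x + g x).
Proof.
move=> Ff Gg x y x0 xy.
have [fi Fxy] := Ff x y x0 xy.
have [gi Gxy] := Gg x y x0 xy.
split; first exact: intRD.
by rewrite (RID _ fi gi)// -Fxy -Gxy; ring.
Qed.

Lemma primZ k F f : prim F f -> prim (fun x => k * F x) (fun x => k * f x).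
Proof.
move=> Ff x y x0 xy.
have [fi Fxy] := Ff x y x0 xy.
split; first exact: intRZ.
by rewrite (RIZ k _ fi)// -Fxy; ring.
Qed.

Lemma eq_prim F G f g : (forall x, 0 < x -> F x = G x) ->
  (forall x, 0 < x -> f x = g x) -> prim F f -> prim G g.
Proof.
move=> FG fg Ff x y x0 xy.
have [fi Fxy] := Ff x y x0 xy.
have xyfg z : `[x, y]%classic z -> f z = g z by move=> /(itv_pos_sub x0)/=; rewrite in_itv/= andbT; exact: fg.
split; first exact: eq_intR fi.
by rewrite -!FG ?(lt_le_trans x0 xy)// Fxy; exact: eq_RI.
Qed.

Lemma prim_derive F f : {in `](0:R), +oo[, continuous f} ->
  (forall x : R, 0 < x -> is_derive x 1 F (f x)) -> prim F f.
Proof.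
move=> cf Ff x y x0 xy; have fi := @cont_intR f x y cf x0.
split => //.
move: xy; rewrite le_eqVlt => /predU1P[->|xy].
  by rewrite subrr set_itv1 Rintegral_set1.
have cF z : 0 < z -> {for z, continuous F}.
  move=> z0; apply: differentiable_continuous; apply/derivable1_diffP.
  by have [] := Ff z z0.
rewrite /Rintegral (@continuous_FTC2 _ _ F)//.
- exact: cont_within.
- split.
  + move=> z; rewrite in_itv/= => /andP[xz _].
    by have [] := Ff z (lt_trans x0 xz).
  + by apply: cvg_at_right_filter; exact: cF.
  + by apply: cvg_at_left_filter; apply: cF; exact: lt_trans xy.
- move=> z; rewrite in_itv/= => /andP[xz _].
  by rewrite derive1E; have [_ ->] := Ff z (lt_trans x0 xz).
Qed.

End Primitive.

(** * The cusped soliton *)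

Section Calculus.
Context {R : realType}.
Implicit Types (f g h : R -> R) (x a b : R).

Lemma isd_cst x a : is_derive x 1 (fun _ : R => a) 0.
Proof. exact: is_derive_cst. Qed.

Lemma isdD f g x a b : is_derive x 1 f a -> is_derive x 1 g b ->
  is_derive x 1 (fun t => f t + g t) (a + b).
Proof. by move=> ? ?; exact: is_deriveD. Qed.

Lemma isdN f x a : is_derive x 1 f a -> is_derive x 1 (fun t => - f t) (- a).
Proof. by move=> ?; exact: is_deriveN. Qed.

Lemma isdB f g x a b : is_derive x 1 f a -> is_derive x 1 g b ->
  is_derive x 1 (fun t => f t - g t) (a - b).
Proof. by move=> ? ?; exact: is_deriveB. Qed.

Lemma isdM f g x a b : is_derive x 1 f a -> is_derive x 1 g b ->
  is_derive x 1 (fun t => f t * g t) (a * g x + f x * b).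
Proof.
move=> fa gb; have := is_deriveM fa gb.
by rewrite addrC /GRing.scale/= [g x * a]mulrC.
Qed.

Lemma isdZ k f x a : is_derive x 1 f a -> is_derive x 1 (fun t => k * f t) (k * a).
Proof. by move=> ?; exact: (is_deriveZ k). Qed.

Lemma isdV f x a : f x != 0 -> is_derive x 1 f a ->
  is_derive x 1 (fun t => (f t)^-1) (- a / (f x) ^+ 2).
Proof.
by move=> fx fa; apply: is_derive_eq (is_deriveV fx fa) _; rewrite /GRing.scale/= mulrC mulrN mulNr.
Qed.

Lemma isd_comp h f x a b : is_derive (f x) 1 h b -> is_derive x 1 f a ->
  is_derive x 1 (fun t => h (f t)) (b * a).
Proof. by move=> hb fa; exact: is_derive1_comp. Qed.

Lemma isd_near f g x a : {near x, f =1 g} -> is_derive x 1 f a -> is_derive x 1 g a.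
Proof. by move=> fg; apply: near_eq_is_derive. Qed.

Lemma isd_cont f x a : is_derive x 1 f a -> {for x, continuous f}.
Proof.
by move=> [df _]; apply: differentiable_continuous; apply/derivable1_diffP.
Qed.

Lemma isd_eq f x a b : is_derive x 1 f a -> a = b -> is_derive x 1 f b.
Proof. by move=> fa <-. Qed.

End Calculus.

(** * The profile as the inverse function of an integral *)

Section Cusp.
Context {R : realType}.

Definition cusp_kernel (t : R) : R := (Num.sqrt (- ln (1 - t ^+ 2)))^-1.
(** The position x > 0 at which the soliton has height s; [ucusp] is its inverse on ]0, +oo[. *)
Definition cusp_J (s : R) : R := RI `[s, 1%R] cusp_kernel.

Lemma oneBsqr_itv (t : R) : 0 < t < 1 -> 0 < 1 - t ^+ 2 < 1.
Proof.
move=> /andP[t0 t1]; rewrite subr_gt0 expr_lt1 ?(ltW t0)// t1/=.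
by rewrite ltrBlDr ltrDl exprn_gt0.
Qed.

Lemma lnN_gt0 (t : R) : 0 < t < 1 -> 0 < - ln (1 - t ^+ 2).
Proof. by move=> t01; rewrite oppr_gt0 ln_lt0// oneBsqr_itv. Qed.

Lemma cusp_kernel_gt0 (t : R) : 0 < t < 1 -> 0 < cusp_kernel t.
Proof. by move=> t01; rewrite invr_gt0 sqrtr_gt0 lnN_gt0. Qed.

Lemma cusp_kernel_ge0 (t : R) : 0 <= cusp_kernel t.
Proof. by rewrite invr_ge0 sqrtr_ge0. Qed.

Lemma cusp_kernel_le (s t : R) : 0 < s -> s <= t <= 1 ->
  cusp_kernel t <= cusp_kernel s.
Proof.
move=> s0 /andP[st]; rewrite le_eqVlt => /predU1P[->|t1].
  (* At t = 1 the conventions ln 0 = 0 and 0^-1 = 0 give the kernel the value 0, so monotonicity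
     extends to the endpoint. *)
  by rewrite /cusp_kernel expr1n subrr ln0// oppr0 sqrtr0 invr0 cusp_kernel_ge0.
have t0 : 0 < t by exact: lt_le_trans st.
have s1 : s < 1 by exact: le_lt_trans t1.
have hs : 0 < s < 1 by rewrite s0.
have ht : 0 < t < 1 by rewrite t0.
rewrite lef_pV2 ?posrE ?sqrtr_gt0 ?lnN_gt0//.
apply: ler_wsqrtr; rewrite lerN2 ler_ln ?posrE.
- by rewrite lerB// lerXn2r// nnegrE ltW.
- by case/andP: (oneBsqr_itv ht).
- by case/andP: (oneBsqr_itv hs).
Qed.

Lemma cusp_kernel_cont (t : R) : 0 < t < 1 -> {for t, continuous cusp_kernel}.
Proof.
move=> t01; have [h0 _] := andP (oneBsqr_itv t01).
have sq : is_derive t 1 (fun x : R => x * x) (1 * t + t * 1).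
  by apply: isdM; exact: is_derive_id.
have d1 := isdB (isd_cst t 1) sq.
have h0' : 0 < 1 - t * t by rewrite -expr2.
have d2 := isdN (isd_comp (f := fun x => 1 - x * x) (is_derive1_ln h0') d1).
have p0 : 0 < - ln (1 - t * t) by rewrite -expr2 lnN_gt0.
have d3 := isd_comp (f := fun x => - ln (1 - x * x)) (is_derive1_sqrt p0) d2.
have nz : Num.sqrt (- ln (1 - t * t)) != 0 by rewrite gt_eqF// sqrtr_gt0.
have d4 := isdV (f := fun x => Num.sqrt (- ln (1 - x * x))) nz d3.
have -> : cusp_kernel = fun x => (Num.sqrt (- ln (1 - x * x)))^-1 by [].
exact: isd_cont d4.
Qed.

Lemma cusp_kernel_int (s t : R) : 0 < s -> t <= 1 -> intR `[s, t] cusp_kernel.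
Proof.
move=> s0 t1.
have i1 : intR `[s, 1%R] cusp_kernel.
  apply: (@intR_bounded_itv R s 1 (cusp_kernel s)); last first.
    by move=> x hx; rewrite ger0_norm ?cusp_kernel_ge0// cusp_kernel_le.
  apply: (@measurable_fun_itv_cc R s 1 false true).
  apply: open_continuous_measurable_fun => //.
  move=> x /set_mem/=; rewrite in_itv/= => /andP[sx x1].
  by apply: cusp_kernel_cont; rewrite x1 (lt_trans s0).
apply: intRS i1 => //; exact: subset_itvl.
Qed.

Lemma cusp_integralE (s : R) : 0 < s -> cusp_integral s = (cusp_J s)%:E.
Proof. by move=> s0; apply: RI_fin => //; exact: cusp_kernel_int. Qed.

Lemma cusp_J_split (s t : R) : 0 < s -> s <= t -> t <= 1 ->
  cusp_J s = RI `[s, t] cusp_kernel + cusp_J t.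
Proof. by move=> s0 st t1; apply: RI_split => //; exact: cusp_kernel_int. Qed.

Lemma cusp_J1 : cusp_J 1 = 0.
Proof. by rewrite /cusp_J set_itv1 Rintegral_set1. Qed.

Lemma cusp_J_diff_ge (s t : R) : 0 < s -> s <= t -> t <= 1 ->
  (t - s) * cusp_kernel t <= cusp_J s - cusp_J t.
Proof.
move=> s0 st t1; rewrite (cusp_J_split s0 st t1) addrK.
have -> : (t - s) * cusp_kernel t = RI `[s, t] (fun=> cusp_kernel t).
  rewrite Rintegral_cst//= lebesgue_measure_itv/= lte_fin.
  by move: st; rewrite le_eqVlt => /predU1P[->|->]; rewrite ?ltxx ?subrr ?mul0r ?mulr0// mulrC.
apply: le_RI => //; [exact: intR_cst|exact: cusp_kernel_int|].
move=> x /=; rewrite in_itv/= => /andP[sx xt].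
by apply: cusp_kernel_le; rewrite ?(lt_le_trans s0 sx)// xt.
Qed.

Lemma cusp_J_lt (s t : R) : 0 < s -> s < t -> t <= 1 -> cusp_J t < cusp_J s.
Proof.
move=> s0 st t1.
(* The lower bound of [cusp_J_diff_ge] is void at t = 1, where the kernel is 0; the left half of the
   interval gives a strictly positive contribution. *)
have hm : s < (s + t) / 2 < t by rewrite !(midf_lt st).
have [sm mt] := andP hm.
have m0 := lt_trans s0 sm.
have m1 := lt_le_trans mt t1.
rewrite -subr_gt0 (_ : _ - _ = (cusp_J s - cusp_J ((s + t) / 2)) +
  (cusp_J ((s + t) / 2) - cusp_J t)); last by ring.
apply: ltr_pwDl.
  apply: lt_le_trans (cusp_J_diff_ge s0 (ltW sm) (ltW m1)).
  by rewrite mulr_gt0 ?subr_gt0// cusp_kernel_gt0// m0.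
apply: le_trans (cusp_J_diff_ge m0 (ltW mt) t1).
by rewrite mulr_ge0 ?cusp_kernel_ge0// subr_ge0 ltW.
Qed.

Lemma cusp_J_gt0 (s : R) : 0 < s < 1 -> 0 < cusp_J s.
Proof. by move=> /andP[s0 s1]; rewrite -cusp_J1 cusp_J_lt. Qed.

Lemma cusp_J_inj (s t : R) : 0 < s < 1 -> 0 < t < 1 -> cusp_J s = cusp_J t -> s = t.
Proof.
move=> /andP[s0 s1] /andP[t0 t1] E.
by case: (ltgtP s t) => // h; [have := cusp_J_lt s0 h (ltW t1)|have := cusp_J_lt t0 h (ltW s1)];
  rewrite E ltxx.
Qed.

Lemma cusp_J_derive (s : R) : 0 < s < 1 -> is_derive s 1 cusp_J (- cusp_kernel s).
Proof.
move=> /[dup] s01 /andP[s0 s1].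
have h0 : 0 < s / 2 by rewrite divr_gt0.
have hs : s / 2 < s by rewrite ltr_pdivrMr// ltr_pMr// ltr1n.
have [dF F'] := @continuous_FTC1_closed R cusp_kernel (s / 2) s 1 s1
  (cusp_kernel_int h0 (lexx _)) hs (cusp_kernel_cont s01).
have dP : is_derive s 1 (fun y => RI `[s / 2, y] cusp_kernel) (cusp_kernel s).
  apply: DeriveDef; first exact: dF.
  by rewrite -derive1E; exact: F'.
have := isdB (isd_cst s (cusp_J (s / 2))) dP.
rewrite sub0r; apply: isd_near; near=> y.
rewrite (@cusp_J_split (s / 2) y)//; first by rewrite addrC addKr.
- by apply: ltW; near: y; exact: lt_nbhsr.
- by apply: ltW; near: y; exact: lt_nbhsl.
Unshelve. all: by end_near. Qed.

(** Since - ln (1 - t^2) <= 4 t^2 for t <= 1/2, the kernel at t is at least 1 / (2 t), and each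
    dyadic interval [t / 2, t] contributes at least 1/4. This logarithmic divergence at 0 is what
    makes the soliton extend to the whole line. *)
Lemma cusp_J_ge_half (n : nat) : n%:R / 4 <= cusp_J (2 ^- n.+1).
Proof.
have p2 k : 0 < (2 : R) ^- k by rewrite invr_gt0 exprn_gt0.
elim: n => [|n IH].
  rewrite mul0r ltW// cusp_J_gt0// p2/= expr1 invf_lt1//.
  by rewrite ltr1n.
have le1 k : (2 : R) ^- k.+1 <= 2^-1.
  by rewrite exprS invfM ler_piMr// invf_le1 ?exprn_gt0// exprn_ege1// ler1n.
have half : (2 : R) ^- n.+2 = 2 ^- n.+1 / 2 by rewrite exprS invfM mulrC.
set t : R := 2 ^- n.+1 in IH half *.
have t0 : 0 < t by exact: p2.
have t12 : t <= 2^-1 by exact: le1.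
have tlt1 : t < 1 by apply: le_lt_trans t12 _; rewrite invf_lt1// ltr1n.
have st : t / 2 <= t by rewrite ler_pdivrMr// ler_pMr// ler1n.
rewrite half.
have := cusp_J_diff_ge (divr_gt0 t0 (ltr0n _ 2)) st (ltW tlt1).
suff kt : (2 * t)^-1 <= cusp_kernel t.
  have : 4^-1 <= (t - t / 2) * cusp_kernel t.
    apply: le_trans (ler_wpM2l _ kt); last by rewrite subr_ge0.
    by rewrite le_eqVlt; apply/orP; left; apply/eqP; field; rewrite gt_eqF.
  rewrite -(natr1 n); clear -IH.
  move: (_ * cusp_kernel t) (cusp_J (t / 2)) (cusp_J t) (n%:R : R) IH; clear.
  by move=> a b c d; lra.
have t01 : 0 < t < 1 by rewrite t0.
rewrite /cusp_kernel lef_pV2 ?posrE ?sqrtr_gt0 ?lnN_gt0//; last by rewrite mulr_gt0.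
rewrite (_ : 2 * t = Num.sqrt ((2 * t) ^+ 2)); last first.
  by rewrite sqrtr_sqr ger0_norm// mulr_ge0// ltW.
apply: ler_wsqrtr.
have [h0 _] := andP (oneBsqr_itv t01).
rewrite -lnV ?posrE//.
have h1 : (1 - t ^+ 2)^-1 = 1 + t ^+ 2 / (1 - t ^+ 2).
  by field; rewrite gt_eqF.
rewrite h1; apply: le_trans (le_ln1Dx _) _.
  by apply: (@lt_trans _ _ 0); rewrite ?ltrN10// divr_gt0// exprn_gt0.
rewrite ler_pdivrMr// exprMn.
have : t ^+ 2 <= 2^-1 ^+ 2 by rewrite lerXn2r// nnegrE ltW.
have : 0 <= t ^+ 2 by rewrite sqr_ge0.
move: (t ^+ 2) => y y0; rewrite exprVn => y4.
have : y <= 1 / 4 by move: y4; rewrite expr2; lra.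
move=> y4'; rewrite (_ : 2 ^+ 2 = 4); last by rewrite expr2; lra.
nra.
Qed.

Lemma cusp_J_surj (y : R) : 0 < y -> exists2 s, 0 < s < 1 & cusp_J s = y.
Proof.
move=> y0.
(* n + 1 exceeds 4 y, so that [cusp_J] is at least y at 2^-(n + 2); the intermediate value theorem
   applies between that point and 1. *)
pose n := Num.truncn (4 * y).
have yn : y <= cusp_J (2 ^- n.+2).
  apply: le_trans (cusp_J_ge_half n.+1).
  rewrite ler_pdivlMr// mulrC ltW//.
  by have := truncnS_gt (4 * y).
set a : R := 2 ^- n.+2 in yn.
have a0 : 0 < a by rewrite invr_gt0 exprn_gt0.
have a1 : a < 1 by rewrite invf_lt1 ?exprn_gt0// exprn_egt1// ltr1n.
have cJ : {within `[a, 1%R], continuous cusp_J}.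
  have := parameterized_integral_continuous (ltW a1) (cusp_kernel_int a0 (lexx 1)).
  move=> cP.
  have cQ : {within `[a, 1%R], continuous
      (fun x => cusp_J a - parameterized_integral lebesgue_measure a x cusp_kernel)}.
    by move=> x; apply: cvgB; [exact: cvg_cst|exact: cP].
  apply: (subspace_eq_continuous _ cQ) => x /set_mem/=.
  rewrite in_itv/= => /andP[ax x1].
  rewrite /from_subspace /= (cusp_J_split a0 ax x1) /parameterized_integral.
  by rewrite addrAC subrr add0r.
have yint : Num.min (cusp_J a) (cusp_J 1) <= y <= Num.max (cusp_J a) (cusp_J 1).
  by rewrite cusp_J1 ge_min (ltW y0) orbT/= le_max yn.
have [c] := IVT (ltW a1) cJ yint.
rewrite in_itv/= => /andP[ac c1] cy; exists c => //.
rewrite (lt_le_trans a0 ac)/=; move: c1; rewrite le_eqVlt => /predU1P[c1|//].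
by exfalso; move: y0; rewrite -cy c1 cusp_J1 ltxx.
Qed.

Lemma ucuspP (x : R) : x != 0 -> 0 < ucusp x < 1 /\ cusp_J (ucusp x) = `|x|.
Proof.
move=> x0; rewrite /ucusp (negbTE x0).
have [s s01 sx] := @cusp_J_surj `|x| (ltac:(by rewrite normr_gt0)).
case: xgetP => [y _ [y01 yx]|/(_ s)]; last first.
  by case; split => //; rewrite cusp_integralE ?sx//; case/andP: s01.
by split => //; move: yx; rewrite cusp_integralE; [case=> -> |case/andP: y01].
Qed.

Lemma ucuspN (x : R) : ucusp (- x) = ucusp x.
Proof. by rewrite /ucusp oppr_eq0 normrN. Qed.

Lemma ucusp_J (s : R) : 0 < s < 1 -> ucusp (cusp_J s) = s.
Proof.
move=> s01; have J0 := cusp_J_gt0 s01.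
have [u01 uJ] := @ucuspP (cusp_J s) (ltac:(by rewrite gt_eqF)).
by apply: cusp_J_inj => //; rewrite uJ ger0_norm// ltW.
Qed.

(** The inverse function rule; the result is the decreasing branch of the first integral u'^2 = - ln
    (1 - u^2) of the soliton equation. *)
Lemma ucusp_derive (x : R) : 0 < x ->
  is_derive x 1 (@ucusp R) (- Num.sqrt (- ln (1 - ucusp x ^+ 2))).
Proof.
move=> x0; have [/[dup] u01 /andP[u0 u1] uJ] := @ucuspP x (ltac:(by rewrite gt_eqF)).
have -> : - Num.sqrt (- ln (1 - ucusp x ^+ 2)) = (- cusp_kernel (ucusp x))^-1.
  by rewrite invrN invrK.
rewrite -[X in is_derive X]ger0_norm ?ltW// -uJ.
apply: is_derive_inverse.
- near=> y; apply: ucusp_J; apply/andP; split; near: y; [exact: lt_nbhsr|exact: lt_nbhsl].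
- near=> y; apply: isd_cont; apply: cusp_J_derive.
  by apply/andP; split; near: y; [exact: lt_nbhsr|exact: lt_nbhsl].
- exact: cusp_J_derive.
- by rewrite oppr_eq0 gt_eqF// cusp_kernel_gt0.
Unshelve. all: by end_near. Qed.

Lemma ucusp_lt_near (s x : R) : 0 < s < 1 -> cusp_J s < x -> ucusp x < s.
Proof.
move=> /[dup] s01 /andP[s0 s1] Jx.
have x0 : 0 < x by exact: lt_trans (cusp_J_gt0 s01) Jx.
have [/andP[u0 u1] uJ] := @ucuspP x (ltac:(by rewrite gt_eqF)).
rewrite ltNge; apply/negP; rewrite le_eqVlt => /predU1P[E|su].
  by move: Jx; rewrite E uJ gtr0_norm// ltxx.
by have := cusp_J_lt s0 su (ltW u1); rewrite uJ gtr0_norm// ltNge (ltW Jx).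
Qed.

Lemma ucusp_gt_near (s x : R) : 0 < s < 1 -> 0 < x < cusp_J s -> s < ucusp x.
Proof.
move=> /[dup] s01 /andP[s0 s1] /andP[x0 Jx].
have [/andP[u0 u1] uJ] := @ucuspP x (ltac:(by rewrite gt_eqF)).
rewrite ltNge; apply/negP; rewrite le_eqVlt => /predU1P[E|su].
  by move: Jx; rewrite -E uJ gtr0_norm// ltxx.
by have := cusp_J_lt u0 su (ltW s1); rewrite uJ gtr0_norm// ltNge (ltW Jx).
Qed.

End Cusp.

(** * The coefficients and two solutions of the homogeneous equation *)

Section Coefficients.
Context {R : realType}.
Implicit Types (x y : R).

Lemma nondecreasing_derive (F f : R -> R) :
  (forall x, 0 < x -> is_derive x 1 F (f x)) ->
  (forall x, 0 < x -> 0 <= f x) ->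
  forall x y, 0 < x -> x <= y -> F x <= F y.
Proof.
move=> Ff f0 x y x0 xy.
have [| |c] := @MVT_segment R F f x y xy.
- by move=> z; rewrite in_itv/= => /andP[xz _]; apply: Ff; exact: lt_trans xz.
-  apply: continuous_subspace_itv => z; rewrite in_itv/= => /andP[xz _].
  by apply: isd_cont (Ff z _); exact: lt_le_trans xz.
rewrite in_itv/= => /andP[xc _] E.
by rewrite -subr_ge0 E mulr_ge0 ?subr_ge0// f0// (lt_le_trans x0).
Qed.

Definition aco x : R := 1 - ucusp x ^+ 2.
Definition psol x : R := Num.sqrt (- ln (aco x)).
(** This is - u'', by u'' = u / (1 - u^2). *)
Definition psol' x : R := - (ucusp x / aco x).

Lemma ucusp_gt0 x : 0 < x -> 0 < ucusp x.
Proof. by move=> x0; have [/andP[]] := @ucuspP R x (ltac:(by rewrite gt_eqF)). Qed.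

Lemma ucusp_lt1 x : 0 < x -> ucusp x < 1.
Proof. by move=> x0; have [/andP[]] := @ucuspP R x (ltac:(by rewrite gt_eqF)). Qed.

Lemma aco_gt0 x : 0 < x -> 0 < aco x.
Proof.
by move=> x0; have [/oneBsqr_itv/andP[]] := @ucuspP R x (ltac:(by rewrite gt_eqF)).
Qed.

Lemma aco_lt1 x : 0 < x -> aco x < 1.
Proof.
by move=> x0; have [/oneBsqr_itv/andP[]] := @ucuspP R x (ltac:(by rewrite gt_eqF)).
Qed.

Lemma ucusp_sqr x : ucusp x ^+ 2 = 1 - aco x.
Proof. by rewrite /aco opprB addrC subrK. Qed.

Lemma psol_gt0 x : 0 < x -> 0 < psol x.
Proof. by move=> x0; rewrite sqrtr_gt0 oppr_gt0 ln_lt0// aco_gt0//= aco_lt1. Qed.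

Lemma aco_derive x : 0 < x -> is_derive x 1 aco (2 * ucusp x * psol x).
Proof.
move=> x0; have du := ucusp_derive x0.
have := isdB (isd_cst x 1) (isdM du du).
rewrite [X in is_derive _ _ X](_ : _ = aco) => [H|].
  by apply: isd_eq H _; rewrite /psol /aco; ring.
by apply/funext => t; rewrite /aco expr2.
Qed.

Lemma psol_derive x : 0 < x -> is_derive x 1 psol (psol' x).
Proof.
move=> x0; have da := aco_derive x0.
have d1 := isdN (isd_comp (f := aco) (is_derive1_ln (aco_gt0 x0)) da).
have l0 : 0 < - ln (aco x) by rewrite -sqrtr_gt0 psol_gt0.
have d2 := isd_comp (f := fun t => - ln (aco t)) (is_derive1_sqrt l0) d1.
apply: isd_eq d2 _; rewrite /psol' -/(psol x).
by field; rewrite !gt_eqF ?psol_gt0 ?aco_gt0.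
Qed.

Lemma psol'_derive x : 0 < x ->
  is_derive x 1 psol' ((2 - aco x) / aco x ^+ 2 * psol x).
Proof.
move=> x0; have du := ucusp_derive x0; have da := aco_derive x0.
have a0 : aco x != 0 by rewrite gt_eqF// aco_gt0.
have d := isdN (isdM du (isdV a0 da)).
apply: isd_eq d _; rewrite -/(aco x) -/(psol x).
rewrite (_ : _ - _ = 1 + ucusp x ^+ 2); last by rewrite ucusp_sqr; ring.
have -> : (1 + ucusp x ^+ 2) / aco x ^+ 2 * psol x =
          (aco x + 2 * ucusp x ^+ 2) / aco x ^+ 2 * psol x.
  by rewrite {2}/aco; congr (_ / _ * _); ring.
by field.
Qed.

Lemma psol'_lt0 x : 0 < x -> psol' x < 0.
Proof. by move=> x0; rewrite oppr_lt0 divr_gt0 ?ucusp_gt0 ?aco_gt0. Qed.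

Lemma psol_le x y : 0 < x -> x <= y -> psol y <= psol x.
Proof.
move=> x0 xy; rewrite -lerN2.
apply: (@nondecreasing_derive (fun t => - psol t) (fun t => - psol' t)) => // z z0.
  by apply: isdN; exact: psol_derive.
by rewrite oppr_ge0 ltW// psol'_lt0.
Qed.

Lemma aco_cont : {in `](0:R), +oo[, continuous aco}.
Proof. by move=> x; rewrite in_itv/= andbT => /aco_derive/isd_cont. Qed.

Lemma psol_cont : {in `](0:R), +oo[, continuous psol}.
Proof. by move=> x; rewrite in_itv/= andbT => /psol_derive/isd_cont. Qed.

Lemma psol'_cont : {in `](0:R), +oo[, continuous psol'}.
Proof. by move=> x; rewrite in_itv/= andbT => /psol'_derive/isd_cont. Qed.

Lemma contM (f g : R -> R) : {in `](0:R), +oo[, continuous f} ->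
  {in `](0:R), +oo[, continuous g} ->
  {in `](0:R), +oo[, continuous (fun x => f x * g x)}.
Proof. by move=> cf cg x x0; apply: continuousM; [exact: cf|exact: cg]. Qed.

Lemma contD (f g : R -> R) : {in `](0:R), +oo[, continuous f} ->
  {in `](0:R), +oo[, continuous g} ->
  {in `](0:R), +oo[, continuous (fun x => f x + g x)}.
Proof. by move=> cf cg x x0; apply: continuousD; [exact: cf|exact: cg]. Qed.

Lemma cont_cst (k : R) : {in `](0:R), +oo[, continuous (fun _ : R => k)}.
Proof. by move=> x x0; exact: cst_continuous. Qed.

Lemma contN (f : R -> R) : {in `](0:R), +oo[, continuous f} ->
  {in `](0:R), +oo[, continuous (fun x => - f x)}.
Proof. by move=> cf x x0; apply: continuousN; exact: cf. Qed.

Lemma contV (f : R -> R) : (forall x, 0 < x -> f x != 0) ->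
  {in `](0:R), +oo[, continuous f} ->
  {in `](0:R), +oo[, continuous (fun x => (f x)^-1)}.
Proof.
move=> f0 cf x x0; apply: continuousV; last exact: cf.
by apply: f0; move: x0; rewrite in_itv/= andbT.
Qed.

Lemma acoV_cont : {in `](0:R), +oo[, continuous (fun x => (aco x)^-1)}.
Proof. by apply: contV aco_cont => x x0; rewrite gt_eqF// aco_gt0. Qed.

(* the potential of the equation v'' = pot v solved by psol *)
Definition pot x : R := (2 - aco x) / aco x ^+ 2.

Lemma pot_cont : {in `](0:R), +oo[, continuous pot}.
Proof.
have -> : pot = fun x => (2 + - aco x) * ((aco x)^-1 * (aco x)^-1).
  by apply/funext => x; rewrite /pot expr2 invfM.
apply: contM; first by apply: contD; [exact: cont_cst|apply: contN; exact: aco_cont].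
by apply: contM; exact: acoV_cont.
Qed.

Lemma pot_ge x : 0 < x -> (aco x ^+ 2)^-1 <= pot x.
Proof.
move=> x0; rewrite /pot -[leLHS]mul1r ler_wpM2r ?invr_ge0 ?sqr_ge0//.
by have := aco_lt1 x0; lra.
Qed.

(** Reduction of order: the second solution is p times a primitive of p^-2. The primitive starts at
    0, where p^-2 tends to 0. *)
Definition rQ x : R := (psol x ^+ 2)^-1.
Definition Qint x : R := RI `[0%R, x] rQ.

Lemma rQ_cont : {in `](0:R), +oo[, continuous rQ}.
Proof.
have -> : rQ = fun x => (psol x)^-1 * (psol x)^-1.
  by apply/funext => x; rewrite /rQ expr2 invfM.
by apply: contM; apply: contV psol_cont => x x0; rewrite gt_eqF// psol_gt0.
Qed.

Lemma rQ_ge0 x : 0 <= rQ x.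
Proof. by rewrite invr_ge0 sqr_ge0. Qed.

Lemma rQ_le x y : 0 < y -> 0 <= x <= y -> rQ x <= rQ y.
Proof.
move=> y0 /andP[]; rewrite le_eqVlt => /predU1P[<- _|x0 xy].
  (* At x = 0 the conventions ln 0 = 0 and 0^-1 = 0 give [rQ] the value 0, which is also its
     limit. *)
  rewrite {1}/rQ /psol /aco /ucusp eqxx expr1n subrr ln0// oppr0 sqrtr0.
  by rewrite expr0n/= invr0 rQ_ge0.
rewrite lef_pV2 ?posrE ?exprn_gt0 ?psol_gt0//.
apply: lerXn2r; rewrite ?nnegrE; [exact: ltW (psol_gt0 y0)|exact: ltW (psol_gt0 x0)|exact: psol_le].
Qed.

Lemma rQ_int x : intR `[0%R, x] rQ.
Proof.
have [x0|x0] := ltP 0 x; last first.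
  have [x1|x1|->] := ltgtP x 0; first by rewrite set_itv_ge ?bnd_simp -?ltNge//; exact: integrable_set0.
      by move: x0; rewrite leNgt x1.
  apply: (@intR_bounded_itv R 0 0 (rQ 0)).
    by rewrite set_itv1; exact: measurable_fun_set1.
  by move=> t /le_anti <-; rewrite ger0_norm ?rQ_ge0.
apply: (@intR_bounded_itv R 0 x (rQ x)); last first.
  by move=> t tx; rewrite ger0_norm ?rQ_ge0// rQ_le.
apply: (@measurable_fun_itv_cc R 0 x false false).
apply: measurable_funS (cont_meas rQ_cont) => //; exact: subset_itvl.
Qed.

Lemma Qint_ge0 x : 0 <= Qint x.
Proof. by apply: Rintegral_ge0 => t _; exact: rQ_ge0. Qed.

Lemma Qint_le x : 0 < x -> Qint x <= x * rQ x.
Proof.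
move=> x0; have -> : x * rQ x = RI `[0%R, x] (fun=> rQ x).
  by rewrite Rintegral_cst//= lebesgue_measure_itv/= lte_fin x0/= subr0 mulrC.
apply: le_RI => //; [exact: rQ_int|exact: intR_cst|].
by move=> t /=; rewrite in_itv/= => tx; exact: rQ_le.
Qed.

Lemma Qint_derive x : 0 < x -> is_derive x 1 Qint (rQ x).
Proof.
move=> x0.
have xx1 : x < x + 1 by rewrite ltrDl.
have cx : {for x, continuous rQ} by apply: rQ_cont; rewrite in_itv/= x0.
have [dF F'] := @continuous_FTC1_closed R rQ 0 x (x + 1) xx1 (rQ_int _) x0 cx.
apply: DeriveDef; first exact: dF.
by rewrite -derive1E; exact: F'.
Qed.

(** This inequality is q' >= 0 in disguise. The difference D of the two sides has derivative 2 + aco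
    / u^2 >= 0, and D d >= - Qint d, which tends to 0 with d. *)
Lemma Qint_le_aco x : 0 < x -> Qint x <= aco x / (psol x * ucusp x).
Proof.
move=> x0.
pose D t := aco t / (psol t * ucusp t) - Qint t.
have dD (t : R) : 0 < t -> is_derive t 1 D (2 + (ucusp t)^-1 ^+ 2 * aco t + (psol t)^-1 ^+ 2 - rQ t).
  move=> t0.
  have p0 := psol_gt0 t0; have u0 := ucusp_gt0 t0; have a0 := aco_gt0 t0.
  have pu0 : psol t * ucusp t != 0 by rewrite gt_eqF// mulr_gt0.
  have d1 := isdV (f := fun t => psol t * ucusp t) pu0
     (isdM (psol_derive t0) (ucusp_derive t0)).
  have := isdB (isdM (aco_derive t0) d1) (Qint_derive t0).
  move=> H; apply: isd_eq H _; rewrite /= -/(aco t) -/(psol t) /psol'.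
  congr (_ - _).
  by field; rewrite !gt_eqF.
have D0 (t : R) : 0 < t -> 0 <= 2 + (ucusp t)^-1 ^+ 2 * aco t + (psol t)^-1 ^+ 2 - rQ t.
  move=> t0; rewrite /rQ -exprVn addrK addr_ge0// mulr_ge0 ?sqr_ge0//.
  by rewrite ltW// aco_gt0.
have DD := nondecreasing_derive dD D0.
suff : 0 <= D x by rewrite subr_ge0.
rewrite leNgt; apply/negP => Dx.
(* Then Qint d <= d * rQ x <= - D x / 2, so D d >= D x / 2 > D x although d <= x. *)
pose d := Num.min x (- D x / (2 * rQ x)).
have r0 : 0 < rQ x by rewrite invr_gt0 exprn_gt0// psol_gt0.
have d0 : 0 < d by rewrite lt_min x0/= divr_gt0 ?oppr_gt0// mulr_gt0.
have dx : d <= x by rewrite ge_min lexx.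
have := DD d x d0 dx.
have : - (d * rQ x) <= D d.
  rewrite /D -[leLHS]add0r lerD//.
    by rewrite divr_ge0// ?mulr_ge0 ?ltW ?aco_gt0 ?psol_gt0 ?ucusp_gt0.
  rewrite lerN2; apply: le_trans (Qint_le d0) _.
  apply: ler_wpM2l; first exact: ltW.
  by apply: rQ_le => //; rewrite dx ltW.
have : d * rQ x <= - D x / 2.
  rewrite -ler_pdivlMr// ge_min; apply/orP; right.
  by rewrite invfM mulrA.
move: Dx; move: (D x) (D d) (d * rQ x); clear => a b c; lra.
Qed.

Definition qsol x := psol x * Qint x.
Definition qsol' x := psol' x * Qint x + (psol x)^-1.

Lemma qsol_ge0 x : 0 < x -> 0 <= qsol x.
Proof. by move=> x0; rewrite mulr_ge0 ?Qint_ge0// ltW// psol_gt0. Qed.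

Lemma qsol_derive x : 0 < x -> is_derive x 1 qsol (qsol' x).
Proof.
move=> x0; have := isdM (psol_derive x0) (Qint_derive x0).
move=> H; apply: isd_eq H _; rewrite /qsol' /rQ; congr (_ + _).
by field; rewrite gt_eqF// psol_gt0.
Qed.

Lemma qsol'_derive x : 0 < x -> is_derive x 1 qsol' (pot x * qsol x).
Proof.
move=> x0; have p0 : psol x != 0 by rewrite gt_eqF// psol_gt0.
have := isdD (isdM (psol'_derive x0) (Qint_derive x0)) (isdV p0 (psol_derive x0)).
move=> H; apply: isd_eq H _; rewrite /qsol -/(pot x) /rQ.
by field.
Qed.

Lemma qsol'_ge0 x : 0 < x -> 0 <= qsol' x.
Proof.
move=> x0; have p0 := psol_gt0 x0; have u0 := ucusp_gt0 x0; have a0 := aco_gt0 x0.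
have := Qint_le_aco x0; rewrite ler_pdivlMr ?mulr_gt0// => H.
rewrite /qsol' /psol' mulNr addrC subr_ge0.
rewrite -ler_pdivlMl ?divr_gt0//.
apply: le_trans (Qint_le_aco x0) _; rewrite le_eqVlt; apply/orP; left; apply/eqP.
by field; rewrite !gt_eqF.
Qed.

Lemma wronskian x : 0 < x -> psol x * qsol' x - psol' x * qsol x = 1.
Proof.
move=> x0; rewrite /qsol' /qsol; field.
by rewrite gt_eqF// psol_gt0.
Qed.

Lemma qsol_le x y : 0 < x -> x <= y -> qsol x <= qsol y.
Proof. exact: nondecreasing_derive qsol_derive qsol'_ge0 _ _. Qed.

Lemma qsol_cont : {in `](0:R), +oo[, continuous qsol}.
Proof. by move=> x; rewrite in_itv/= andbT => /qsol_derive/isd_cont. Qed.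

Lemma qsol'_cont : {in `](0:R), +oo[, continuous qsol'}.
Proof. by move=> x; rewrite in_itv/= andbT => /qsol'_derive/isd_cont. Qed.

Lemma prim_psol : prim psol psol'.
Proof. exact: prim_derive psol'_cont psol_derive. Qed.

Lemma prim_psol' : prim psol' (fun x => pot x * psol x).
Proof. by apply: prim_derive psol'_derive; apply: contM; [exact: pot_cont|exact: psol_cont]. Qed.

Lemma prim_qsol : prim qsol qsol'.
Proof. exact: prim_derive qsol'_cont qsol_derive. Qed.

Lemma prim_qsol' : prim qsol' (fun x => pot x * qsol x).
Proof. by apply: prim_derive qsol'_derive; apply: contM; [exact: pot_cont|exact: qsol_cont]. Qed.

Lemma psol_large (M : R) : 0 < M -> exists2 d, 0 < d & forall x, 0 < x < d -> M < psol x.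
Proof.
move=> M0.
have e01 : 0 < expR (- M ^+ 2) < 1.
  by rewrite expR_gt0 expR_lt1 oppr_lt0 exprn_gt0.
have [e0 e1] := andP e01.
(* p > M means aco < e^(- M^2), that is u > s. *)
pose s := Num.sqrt (1 - expR (- M ^+ 2)).
have s2 : s ^+ 2 = 1 - expR (- M ^+ 2) by rewrite sqr_sqrtr// subr_ge0 ltW.
have s0 : 0 < s by rewrite sqrtr_gt0 subr_gt0.
have s1 : s < 1.
  by rewrite -(@expr_lt1 _ 2) ?ltW// s2 ltrBlDr ltrDl.
have s01 : 0 < s < 1 by rewrite s0.
exists (cusp_J s); first exact: cusp_J_gt0.
move=> x /[dup] /andP[x0 _] xJ; have su := ucusp_gt_near s01 xJ.
rewrite -[M]ger0_norm ?ltW// -sqrtr_sqr ltr_sqrt; last first.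
  by rewrite oppr_gt0 ln_lt0// aco_gt0//= aco_lt1.
rewrite ltrNr -[- M ^+ 2]expRK ltr_ln ?posrE// ?aco_gt0//.
rewrite /aco ltrBlDr -ltrBlDl -s2 ltrXn2r// ?nnegrE ?ltW// ucusp_gt0.
Qed.

Lemma ucusp_small (e : R) : 0 < e -> exists2 A, 0 < A & forall x, A < x -> ucusp x < e.
Proof.
move=> e0; pose s := Num.min e (2^-1).
have s0 : 0 < s by rewrite lt_min e0/= invr_gt0.
have s01 : 0 < s < 1.
  by rewrite s0/= gt_min; apply/orP; right; rewrite invf_lt1// ltr1n.
exists (cusp_J s); first exact: cusp_J_gt0.
move=> x xJ; apply: lt_le_trans (ucusp_lt_near s01 xJ) _.
by rewrite ge_min lexx.
Qed.

End Coefficients.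

(** * The Green operator *)

Section Green.
Context {R : realType}.
Implicit Types (f g : R -> R) (x y : R).

Notation Dp := (`](0:R), +oo[%classic).

Lemma in_Dp x : Dp x = (0 < x) :> Prop.
Proof. by rewrite /= in_itv/= andbT. Qed.

Lemma exhaust_itv (x0 : R) : 0 < x0 ->
  \bigcup_i `[x0 / i.+1%:R, x0 * i.+1%:R]%classic = Dp.
Proof.
move=> x00; apply/seteqP; split => [x [i _]|x].
  rewrite in_Dp /= in_itv/= => /andP[+ _]; apply: lt_le_trans.
  by rewrite divr_gt0.
rewrite in_Dp => xp.
pose n := (Num.truncn (x0 / x) + Num.truncn (x / x0))%N.
exists n => //=; rewrite in_itv/=; apply/andP; split.
  rewrite ler_pdivrMr ?ltr0n// mulrC -ler_pdivrMr//.
  apply: le_trans (ltW (truncnS_gt _)) _.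
  by rewrite ler_nat ltnS leq_addr.
rewrite mulrC -ler_pdivrMr//.
apply: le_trans (ltW (truncnS_gt _)) _.
by rewrite ler_nat ltnS leq_addl.
Qed.

(** Monotone convergence along the intervals of [exhaust_itv]: a bound that is uniform over the
    compact intervals around x0 yields integrability as well as the bound on the half-line. *)
Lemma exhaust_int f (x0 C : R) : 0 < x0 -> measurable_fun Dp f ->
  (forall x, 0 < x -> 0 <= f x) ->
  (forall a b, 0 < a -> a <= x0 -> x0 <= b -> intR `[a, b] f /\ RI `[a, b] f <= C) ->
  intR Dp f /\ RI Dp f <= C.
Proof.
move=> x00 mf f0 fC.
have Fi i : intR `[x0 / i.+1%:R, x0 * i.+1%:R] f /\
            RI `[x0 / i.+1%:R, x0 * i.+1%:R] f <= C.
  apply: fC; first by rewrite divr_gt0.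
    by rewrite ler_pdivrMr// ler_pMr// ler1n.
  by rewrite ler_pMr// ler1n.
have nd : nondecreasing_seq (fun i => `[x0 / i.+1%:R, x0 * i.+1%:R]%classic).
  move=> i j ij; rewrite subsetEset; apply: subset_itv; rewrite bnd_simp.
    by rewrite ler_pM2l// lef_pV2 ?posrE ?ltr0n// ler_nat ltnS.
  by rewrite ler_pM2l// ler_nat ltnS.
have iC : (\int[@lebesgue_measure R]_(x in Dp) (f x)%:E <= C%:E)%E.
  rewrite -(exhaust_itv x00).
  have cv : (\int[@lebesgue_measure R]_(x in `[(x0 / i.+1%:R)%R, (x0 * i.+1%:R)%R]%classic) (EFin \o f) x
      @[i --> \oo] --> \int[@lebesgue_measure R]_(x in
        \bigcup_i `[(x0 / i.+1%:R)%R, (x0 * i.+1%:R)%R]%classic) (EFin \o f) x)%E.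
    apply: ge0_nondecreasing_set_cvg_integral.
    - exact: nd.
    - by move=> i; exact: measurable_itv.
    - by move=> i; apply/measurable_EFinP; apply: intR_meas; exact: (Fi i).1.
    - move=> i x; rewrite /= in_itv/= lee_fin => /andP[h _]; apply: f0.
      by apply: lt_le_trans h; rewrite divr_gt0.
  rewrite -(cvg_lim _ cv)//; apply: lime_le; first by apply/cvg_ex; eexists; exact: cv.
  apply: nearW => i /=.
  by rewrite RI_fin ?lee_fin; [case: (Fi i)|case: (Fi i)|exact: measurable_itv].
have fi : intR Dp f.
  apply/integrableP; split; first exact/measurable_EFinP.
  apply: le_lt_trans (ltry C); apply: le_trans iC.
  rewrite le_eqVlt; apply/orP; left; apply/eqP.
  by apply: eq_integral => x /set_mem; rewrite in_Dp => xp /=; rewrite ger0_norm// f0.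
by split => //; rewrite -lee_fin -RI_fin.
Qed.

Definition sqint (D : set R) f := measurable_fun D f /\ intR D (fun x => f x ^+ 2).

(** Extension by 0 to the whole line, so that [green] is measurable on the plane and Tonelli's
    theorem can be applied there. *)
Definition pT := (@psol R) \_ Dp.
Definition qT := (@qsol R) \_ Dp.
(** The Green function of - d^2/dx^2 + [pot]: p decays at +oo, q vanishes at 0, and the Wronskian by
    which one would divide is 1. *)
Definition green x y : R := pT (Num.max x y) * qT (Num.min x y).

Lemma greenC x y : green x y = green y x.
Proof. by rewrite /green maxC minC. Qed.

Lemma pTE x : 0 < x -> pT x = psol x.
Proof. by move=> x0; rewrite /pT patchE mem_set// in_Dp. Qed.

Lemma qTE x : 0 < x -> qT x = qsol x.
Proof. by move=> x0; rewrite /qT patchE mem_set// in_Dp. Qed.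

Lemma greenE1 x y : 0 < y -> y <= x -> green x y = psol x * qsol y.
Proof.
move=> y0 yx; rewrite /green (max_idPl _)// (min_idPr _)// pTE ?qTE//.
exact: lt_le_trans yx.
Qed.

Lemma greenE2 x y : 0 < x -> x <= y -> green x y = qsol x * psol y.
Proof. by move=> x0 xy; rewrite greenC greenE1// mulrC. Qed.

Lemma green_ge0 x y : 0 < x -> 0 < y -> 0 <= green x y.
Proof.
move=> x0 y0; have [yx|/ltW xy] := leP y x.
  by rewrite greenE1// mulr_ge0 ?qsol_ge0// ltW// psol_gt0.
by rewrite greenE2// mulr_ge0 ?qsol_ge0// ltW// psol_gt0.
Qed.

Lemma green_le x y : 0 < x -> 0 < y -> green x y <= psol x * qsol x.
Proof.
move=> x0 y0; have [yx|/ltW xy] := leP y x.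
  by rewrite greenE1// ler_wpM2l ?(ltW (psol_gt0 x0))// qsol_le.
by rewrite greenE2// mulrC ler_wpM2r ?qsol_ge0// psol_le.
Qed.

Lemma green_meas :
  measurable_fun setT (fun z : measurableTypeR R * measurableTypeR R => green z.1 z.2).
Proof.
have mp : measurable_fun setT pT.
  apply/(measurable_restrictT _ _).1; [exact: measurable_itv|exact: cont_meas psol_cont].
have mq : measurable_fun setT qT.
  apply/(measurable_restrictT _ _).1; [exact: measurable_itv|exact: cont_meas qsol_cont].
apply: measurable_funM.
  by apply: (measurableT_comp mp); exact: measurable_maxr.
by apply: (measurableT_comp mq); exact: measurable_minr.
Qed.

Lemma green_measr x : measurable_fun setT (green x).
Proof. exact: (measurableT_comp green_meas (pair1_measurable x)). Qed.

Lemma acoV_meas : measurable_fun Dp (fun y => (aco y)^-1).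
Proof. exact: cont_meas acoV_cont. Qed.

Lemma green_meas_aco x : measurable_fun Dp (fun y => green x y * (aco y)^-1 ^+ 2).
Proof.
apply: measurable_funM; first exact: measurable_funTS (green_measr x).
by apply: measurable_funX; exact: acoV_meas.
Qed.

(** As aco^-2 <= pot while pot q = q'' and pot p = p'', the integral over [a, b] is at most p(x)
    (q'(x) - q'(a)) + q(x) (p'(b) - p'(x)). The end terms have the good sign, because q' >= 0 and p'
    <= 0, and what remains is the Wronskian. *)
Lemma green_schur x : 0 < x ->
  intR Dp (fun y => green x y * (aco y)^-1 ^+ 2) /\
  RI Dp (fun y => green x y * (aco y)^-1 ^+ 2) <= 1.
Proof.
move=> x0; apply: (@exhaust_int _ x) => //; first exact: green_meas_aco.
  by move=> y y0; rewrite mulr_ge0 ?sqr_ge0// green_ge0.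
move=> a b a0 ax xb.
have i1 u v : 0 < u -> intR `[u, v] (fun y => green x y * (aco y)^-1 ^+ 2).
  move=> u0; apply: (@intRM_bounded R _ (psol x * qsol x)) => //.
  - exact: measurable_funTS (green_measr x).
  - move=> y /(itv_pos_sub u0); rewrite in_Dp => y0.
    by rewrite ger0_norm ?green_le// green_ge0.
  - apply: cont_intR => //.
    have -> : (fun y => (@aco R y)^-1 ^+ 2) = fun y => (aco y)^-1 * (aco y)^-1 by [].
    by apply: contM; exact: acoV_cont.
split; first exact: i1.
have b0 : 0 < b by exact: lt_le_trans xb.
rewrite (RI_split ax xb (i1 a b a0)) -(wronskian x0).
apply: lerD.
  have [qi qE] := prim_qsol' a0 ax.
  apply: (@le_trans _ _ (psol x * RI `[a, x] (fun y => pot y * qsol y))).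
    rewrite -RIZ//; apply: le_RI => //; [exact: i1|exact: intRZ|].
    move=> y; rewrite /= in_itv/= => /andP[ay yx].
    have y0 := lt_le_trans a0 ay.
    rewrite greenE1// -mulrA ler_wpM2l ?(ltW (psol_gt0 x0))//.
    by rewrite mulrC ler_wpM2r ?qsol_ge0// exprVn pot_ge.
  rewrite -qE ler_wpM2l ?(ltW (psol_gt0 x0))//.
  by rewrite lerBlDr lerDl qsol'_ge0.
have [pi pE] := prim_psol' x0 xb.
apply: (@le_trans _ _ (qsol x * RI `[x, b] (fun y => pot y * psol y))).
  rewrite -RIZ//; apply: le_RI => //; [exact: i1|exact: intRZ|].
  move=> y; rewrite /= in_itv/= => /andP[xy yb].
  have y0 := lt_le_trans x0 xy.
  rewrite greenE2// -mulrA ler_wpM2l ?qsol_ge0//.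
  by rewrite mulrC ler_wpM2r ?(ltW (psol_gt0 y0))// exprVn pot_ge.
rewrite -pE mulrC -mulNr ler_wpM2r ?qsol_ge0//.
by rewrite gerDr ltW// psol'_lt0.
Qed.

Lemma green_sq_int x f : 0 < x -> sqint Dp f ->
  intR Dp (fun y => green x y * f y ^+ 2).
Proof.
move=> x0 [mf fi]; apply: (@intRM_bounded R _ (psol x * qsol x)) => //.
- exact: measurable_funTS (green_measr x).
- move=> y; rewrite in_Dp => y0.
  by rewrite ger0_norm ?green_le// green_ge0.
Qed.

Lemma green_int x f : 0 < x -> sqint Dp f ->
  intR Dp (fun y => green x y * (f y / aco y)).
Proof.
move=> x0 sf; have [mf fi] := sf.
apply: (@le_intR R _ _ (fun y => green x y * f y ^+ 2 + green x y * (aco y)^-1 ^+ 2)) => //.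
- apply: measurable_funM; first exact: measurable_funTS (green_measr x).
  by apply: measurable_funM => //; exact: acoV_meas.
- move=> y; rewrite in_Dp => y0.
  rewrite normrM ger0_norm ?green_ge0// -mulrDr ler_wpM2l ?green_ge0//.
  (* |s t| <= s^2 + t^2, each square being integrable against [green x]. *)
  move: (f y) (aco y)^-1 => s t; rewrite ler_norml; apply/andP; split; nra.
- by apply: intRD => //; [exact: green_sq_int|case: (green_schur x0)].
Qed.

(** The inverse of L on the half-line: L v = f reads - v'' + pot v = f / aco. *)
Definition greenM f x := RI Dp (fun y => green x y * (f y / aco y)).

(** Cauchy-Schwarz for the weight [green x]: with s = greenM f x, expand the integral of green x y
    (f y - s / aco y)^2, which is nonnegative, and bound the coefficient of s^2 by [green_schur]. *)
Lemma greenM_sq x f : 0 < x -> sqint Dp f ->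
  greenM f x ^+ 2 <= RI Dp (fun y => green x y * f y ^+ 2).
Proof.
move=> x0 sf; set s := greenM f x.
have i1 := green_sq_int x0 sf.
have i2 := green_int x0 sf.
have [i3 le1] := green_schur x0.
have : 0 <= RI Dp (fun y => green x y * f y ^+ 2 - (2 * s) * (green x y * (f y / aco y))
                      + s ^+ 2 * (green x y * (aco y)^-1 ^+ 2)).
  apply: Rintegral_ge0 => y; rewrite in_Dp => y0.
  rewrite (_ : _ + _ = green x y * (f y - s / aco y) ^+ 2); last by ring.
  by rewrite mulr_ge0 ?sqr_ge0// green_ge0.
rewrite RID ?RIB ?RIZ//; first last.
- exact: intRZ.
- by apply: intRB => //; exact: intRZ.
- exact: intRZ.
rewrite -/(greenM f x) -/s.
have := sqr_ge0 s; move: le1; move: (RI _ _) (RI _ _) => b a.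
rewrite (_ : 2 * s * s = 2 * s ^+ 2); last by ring.
move: (s ^+ 2) => t; nra.
Qed.

Lemma sqintD D f g : measurable D -> sqint D f -> sqint D g ->
  sqint D (fun x => f x + g x).
Proof.
move=> mD [mf fi] [mg gi]; split; first exact: measurable_funD.
apply: (@le_intR R _ _ (fun x => 2 * f x ^+ 2 + 2 * g x ^+ 2)) => //.
- by apply: measurable_funX; exact: measurable_funD.
- move=> x _; rewrite ger0_norm ?sqr_ge0//; have := sqr_ge0 (f x - g x).
  by move: (f x) (g x) => a b; rewrite !expr2; lra.
- by apply: intRD => //; exact: intRZ.
Qed.

Lemma sqintZ D k f : measurable D -> sqint D f -> sqint D (fun x => k * f x).
Proof.
move=> mD [mf fi]; split; first by apply: measurable_funM => //; exact: measurable_cst.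
apply: (@eq_intR R _ (fun x => k ^+ 2 * f x ^+ 2)) => //; last exact: intRZ.
by move=> x _; rewrite exprMn.
Qed.

Lemma greenMD f g x : 0 < x -> sqint Dp f -> sqint Dp g ->
  greenM (fun y => f y + g y) x = greenM f x + greenM g x.
Proof.
move=> x0 sf sg; rewrite /greenM -RID//; [|exact: green_int..].
by apply: eq_RI => y _; ring.
Qed.

Lemma greenMZ k f x : 0 < x -> sqint Dp f ->
  greenM (fun y => k * f y) x = k * greenM f x.
Proof.
move=> x0 sf; rewrite /greenM -RIZ//; last exact: green_int.
by apply: eq_RI => y _; ring.
Qed.

End Green.

(** * The Green operator solves the equation and is bounded *)

Section GreenSolution.
Context {R : realType}.
Implicit Types (f g : R -> R) (x y : R).

Notation Dp := (`](0:R), +oo[%classic).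

Lemma sqintS (D E : set R) f : measurable D -> measurable E -> E `<=` D ->
  sqint D f -> sqint E f.
Proof.
by move=> mD mE ED [mf fi]; split; [exact: measurable_funS mf|exact: intRS fi].
Qed.

(** Variation of constants: greenM f = p A + q B, where p A' + q B' = 0. *)
Definition greenA f x : R := RI `]0, x] (fun y => qsol y * (f y / aco y)).
Definition greenB f x : R := RI `]x, +oo[ (fun y => psol y * (f y / aco y)).

(** For y <= x the kernel is psol x * qsol y, so integrability near 0 is inherited from [green_int]
    after division by the constant psol x. *)
Lemma greenA_int f x : 0 < x -> sqint Dp f ->
  intR `]0, x] (fun y => qsol y * (f y / aco y)).
Proof.
move=> x0 sf.
have i : intR `]0, x] (fun y => green x y * (f y / aco y)).
  by apply: intRS (green_int x0 sf) => //; exact: subset_itvl.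
apply: (@eq_intR R _ (fun y => (psol x)^-1 * (green x y * (f y / aco y)))) => //.
  move=> y; rewrite /= in_itv/= => /andP[y0 yx].
  by rewrite greenE1//; field; rewrite !gt_eqF// ?psol_gt0// aco_gt0.
exact: intRZ.
Qed.

Lemma qsol_gt0 x : 0 < x -> 0 < qsol x.
Proof.
move=> x0; rewrite mulr_gt0 ?psol_gt0// /Qint.
have h0 : 0 < x / 2 by rewrite divr_gt0.
have hx : x / 2 <= x by rewrite ler_pdivrMr// ler_pMr// ler1n.
have := RI_split (ltW h0) hx (rQ_int x) => ->.
rewrite ltr_wpDl ?Qint_ge0//.
have r0 : 0 < rQ (x / 2) by rewrite invr_gt0 exprn_gt0// psol_gt0.
apply: (@lt_le_trans _ _ (RI `[x / 2, x] (fun=> rQ (x / 2)))).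
  rewrite Rintegral_cst//= lebesgue_measure_itv/= lte_fin.
  have -> : x / 2 < x by rewrite ltr_pdivrMr// ltr_pMr// ltr1n.
  by rewrite /= mulr_gt0// subr_gt0 ltr_pdivrMr// ltr_pMr// ltr1n.
apply: le_RI => //; first exact: intR_cst.
  by apply: intRS (rQ_int x) => //; apply: subset_itvr; rewrite bnd_simp ltW.
move=> y /=; rewrite in_itv/= => /andP[hy yx].
by apply: rQ_le; [exact: lt_le_trans hy|rewrite (ltW h0)].
Qed.

Lemma greenB_int f x : 0 < x -> sqint Dp f ->
  intR `]x, +oo[ (fun y => psol y * (f y / aco y)).
Proof.
move=> x0 sf.
have i : intR `]x, +oo[ (fun y => green x y * (f y / aco y)).
  by apply: intRS (green_int x0 sf) => //; apply: subset_itvr; rewrite bnd_simp ltW.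
apply: (@eq_intR R _ (fun y => (qsol x)^-1 * (green x y * (f y / aco y)))) => //.
  move=> y; rewrite /= in_itv/= andbT => xy.
  rewrite greenE2 ?(ltW xy)//; field.
  by rewrite !gt_eqF// ?qsol_gt0// aco_gt0// (lt_trans x0).
exact: intRZ.
Qed.

Lemma greenME f x : 0 < x -> sqint Dp f ->
  greenM f x = psol x * greenA f x + qsol x * greenB f x.
Proof.
move=> x0 sf; rewrite /greenM.
have E : Dp = `]0, x]%classic `|` `]x, +oo[%classic.
  apply/seteqP; split => y /=; rewrite !in_itv/= !andbT.
    by move=> y0; case: (leP y x) => yx; [left; rewrite y0|right].
  by case=> [/andP[]//|]; exact: lt_trans.
rewrite E Rintegral_setU//; last 2 first.
- by rewrite -E; exact: green_int.
- apply/disj_setPS => y [/=]; rewrite !in_itv/= => /andP[_ yx].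
  by rewrite andbT ltNge yx.
congr (_ + _).
  rewrite -RIZ//; last exact: greenA_int.
  apply: eq_RI => y /=; rewrite in_itv/= => /andP[y0 yx].
  by rewrite greenE1// -mulrA.
rewrite -RIZ//; last exact: greenB_int.
apply: eq_RI => y /=; rewrite in_itv/= andbT => xy.
by rewrite greenE2 ?(ltW xy)// -mulrA.
Qed.

Lemma prim_greenA f : sqint Dp f ->
  prim (greenA f) (fun y => qsol y * (f y / aco y)).
Proof.
move=> sf x y x0 xy; have y0 := lt_le_trans x0 xy.
have iy := greenA_int y0 sf.
split; first by apply: intRS iy => // z /=; rewrite !in_itv/= => /andP[xz ->]; rewrite (lt_le_trans x0 xz).
rewrite /greenA (Rintegral_itvB iy) ?bnd_simp ?(ltW x0)//.
apply: Rintegral_itv_obnd_cbnd; apply: intRS iy => //.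
by move=> z /=; rewrite !in_itv/= => /andP[xz ->]; rewrite (lt_trans x0 xz).
Qed.

Lemma prim_greenB f : sqint Dp f ->
  prim (greenB f) (fun y => - (psol y * (f y / aco y))).
Proof.
move=> sf x y x0 xy; have y0 := lt_le_trans x0 xy.
have h0 : 0 < x / 2 by rewrite divr_gt0.
have hx : x / 2 < x by rewrite ltr_pdivrMr// ltr_pMr// ltr1n.
have ix := greenB_int x0 sf.
have ixy : intR `[x, y] (fun y => psol y * (f y / aco y)).
  apply: intRS (greenB_int h0 sf) => // z /=; rewrite !in_itv/= => /andP[xz _].
  by rewrite andbT (lt_le_trans hx xz).
have ixy' : intR `]x, y] (fun y => psol y * (f y / aco y)).
  by apply: intRS ix => //; exact: subset_itvl.
split; first exact: intRN.
have -> : RI `[x, y] (fun y => - (psol y * (f y / aco y))) =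
          - RI `[x, y] (fun y => psol y * (f y / aco y)).
  by rewrite -mulN1r -RIZ//; apply: eq_RI => z _; rewrite mulN1r.
rewrite -(@Rintegral_itv_obnd_cbnd _ x (BRight y))//.
rewrite /greenB -(Rintegral_itvB (x := y) ix) ?bnd_simp//.
by rewrite addrAC subrr add0r.
Qed.

Definition greenM' f x := psol' x * greenA f x + qsol' x * greenB f x.

Lemma prim_greenM f : sqint Dp f -> prim (greenM f) (greenM' f).
Proof.
move=> sf.
have := primD (primM prim_psol (prim_greenA sf)) (primM prim_qsol (prim_greenB sf)).
apply: eq_prim => x x0; first by rewrite greenME.
by rewrite /greenM'; ring.
Qed.

Lemma prim_greenM' f : sqint Dp f ->
  prim (greenM' f) (fun x => pot x * greenM f x - f x / aco x).
Proof.
move=> sf.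
have := primD (primM prim_psol' (prim_greenA sf)) (primM prim_qsol' (prim_greenB sf)).
apply: eq_prim => x x0 //.
(* The terms containing f add up to - (p q' - p' q) f / aco, and the Wronskian is 1. *)
rewrite greenME// -[X in _ - X]mul1r -(wronskian x0).
by ring.
Qed.

Lemma greenM_meas f : sqint Dp f -> measurable_fun Dp (greenM f).
Proof. by move=> sf; apply: cont_meas; exact: prim_cont (prim_greenM sf). Qed.

(** Tonelli's theorem in the shape of Schur's test: only one-sided bounds on the two partial
    integrals are given, and the integrability of A is part of the outcome. *)
Lemma RI_tonelli_le (k : R -> R -> R) (A B : R -> R) :
  measurable_fun setT (fun z : measurableTypeR R * measurableTypeR R => k z.1 z.2) ->
  (forall x y, 0 <= k x y) ->
  measurable_fun setT A -> (forall x, 0 <= A x) -> intR setT B ->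
  (forall x, intR setT (k x) /\ A x <= RI setT (k x)) ->
  (forall y, intR setT (k^~ y) /\ RI setT (k^~ y) <= B y) ->
  intR setT A /\ RI setT A <= RI setT B.
Proof.
move=> mk k0 mA A0 iB kA kB.
pose h (z : measurableTypeR R * measurableTypeR R) : \bar R := (k z.1 z.2)%:E.
have mh : measurable_fun setT h by exact/measurable_EFinP.
have h0 z : (0 <= h z)%E by rewrite lee_fin.
have Tonelli := fubini_tonelli (m1 := @lebesgue_measure R) (m2 := @lebesgue_measure R) h mh h0.
have mF := measurable_fun_fubini_tonelli_F (m2 := @lebesgue_measure R) h mh h0.
have mG := measurable_fun_fubini_tonelli_G (m1 := @lebesgue_measure R) h mh h0.
have B0 y : 0 <= B y.
  by apply: le_trans (kB y).2; apply: Rintegral_ge0.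
have le1 : (\int[@lebesgue_measure R]_x (A x)%:E
    <= \int[@lebesgue_measure R]_x \int[@lebesgue_measure R]_y h (x, y))%E.
  apply: ge0_le_integral.
  - exact: measurableT.
  - by move=> x _; rewrite lee_fin.
  - exact/measurable_EFinP.
  - exact: mF.
  - move=> x _; have [ki Ak] := kA x.
    by rewrite /h /= (RI_fin ki measurableT) lee_fin.
have le2 : (\int[@lebesgue_measure R]_y \int[@lebesgue_measure R]_x h (x, y)
    <= (RI setT B)%:E)%E.
  rewrite -(RI_fin iB measurableT); apply: ge0_le_integral.
  - exact: measurableT.
  - by move=> y _; apply: integral_ge0 => x _; exact: h0.
  - exact: mG.
  - by apply/measurable_EFinP; exact: intR_meas iB.
  - move=> y _; have [ki Bk] := kB y.
    by rewrite /h /= (RI_fin ki measurableT) lee_fin.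
have le3 : (\int[@lebesgue_measure R]_x (A x)%:E <= (RI setT B)%:E)%E.
  by apply: le_trans le1 _; rewrite Tonelli.
have iA : intR setT A.
  apply/integrableP; split; first exact/measurable_EFinP.
  apply: le_lt_trans (ltry (RI setT B)); apply: le_trans le3.
  rewrite le_eqVlt; apply/orP; left; apply/eqP.
  by apply: eq_integral => x _ /=; rewrite ger0_norm.
by split; [exact: iA|rewrite -lee_fin -(RI_fin iA measurableT)].
Qed.

(** Schur's test: integrate [greenM_sq] against aco^-2 in x and exchange the integrals. Since
    [green] is symmetric, [green_schur] bounds the inner integral by 1 as well. The factor 1 / aco
    is kept, as both the domain of L and the energy estimate ask for v / aco. *)
Lemma greenM_bound f : sqint Dp f ->
  sqint Dp (fun x => greenM f x / aco x) /\
  RI Dp (fun x => (greenM f x / aco x) ^+ 2) <= RI Dp (fun x => f x ^+ 2).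
Proof.
move=> sf; have [mf fi] := sf.
have mD : measurable Dp by exact: measurable_itv.
have mM : measurable_fun Dp (fun x => greenM f x / aco x).
  by apply: measurable_funM; [exact: greenM_meas|exact: acoV_meas].
pose fT := f \_ Dp.
pose aT := (fun x : R => (aco x)^-1) \_ Dp.
have mfT : measurable_fun setT fT by apply/(measurable_restrictT _ _).1.
have maT : measurable_fun setT aT.
  by apply/(measurable_restrictT _ _).1; [exact: mD|exact: acoV_meas].
have green_nneg x y : 0 <= green x y.
  rewrite /green /pT /qT !patchE; apply: mulr_ge0; case: ifP => //.
    by move=> /set_mem; rewrite in_Dp => ?; rewrite ltW// psol_gt0.
  by move=> /set_mem; rewrite in_Dp => ?; exact: qsol_ge0.
pose k x y := aT x ^+ 2 * (green x y * fT y ^+ 2).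
pose A := (fun x => (greenM f x / aco x) ^+ 2) \_ Dp.
pose B := (fun x => f x ^+ 2) \_ Dp.
have fT2 y : fT y ^+ 2 = B y.
  by rewrite /fT /B !patchE; case: ifP => // _; rewrite expr0n.
have aT2 x : aT x ^+ 2 = ((fun x => (aco x)^-1 ^+ 2) \_ Dp) x.
  by rewrite /aT !patchE; case: ifP => // _; rewrite expr0n.
have mk : measurable_fun setT
    (fun z : measurableTypeR R * measurableTypeR R => k z.1 z.2).
  apply: measurable_funM.
    by apply: measurable_funX; exact: (measurableT_comp maT measurable_fst).
  apply: measurable_funM; first exact: green_meas.
  by apply: measurable_funX; exact: (measurableT_comp mfT measurable_snd).
have k0 x y : 0 <= k x y.
  by apply: mulr_ge0; [exact: sqr_ge0|apply: mulr_ge0; [exact: green_nneg|exact: sqr_ge0]].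
have mA : measurable_fun setT A.
  by apply/(measurable_restrictT _ _).1; [exact: mD|exact: measurable_funX].
have A0 x : 0 <= A x by rewrite /A patchE; case: ifP => // _; exact: sqr_ge0.
have iB : intR setT B by apply/(intR_patch _ mD).1.
have kA x : intR setT (k x) /\ A x <= RI setT (k x).
  rewrite {1}/A patchE; case: ifPn => [xD|xD]; last first.
    have E y : k x y = 0 by rewrite /k aT2 patchE (negbTE xD) mul0r.
    have -> : k x = fun=> 0 by apply/funext.
    split; last by rewrite Rintegral_cst// mul0r.
    exact: integrable0.
  have x0 : 0 < x by move/set_mem: xD; rewrite in_Dp.
  have ig := green_sq_int x0 sf.
  have E : k x = (fun y => (aco x)^-1 ^+ 2 * (green x y * f y ^+ 2)) \_ Dp.
    apply/funext => y; rewrite /k aT2 fT2 /B !patchE xD.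
    by case: ifP => // _; rewrite !mulr0.
  rewrite E -Rintegral_mkcond; split; first by apply/(intR_patch _ mD).1; exact: intRZ.
  rewrite (RIZ _ mD ig) expr_div_n -exprVn mulrC.
  by apply: ler_wpM2l; [exact: sqr_ge0|exact: greenM_sq].
have kB y : intR setT (k^~ y) /\ RI setT (k^~ y) <= B y.
  rewrite {1}/B patchE; case: ifPn => [yD|yD]; last first.
    have E x : k x y = 0 by rewrite /k fT2 /B patchE (negbTE yD) !mulr0.
    have -> : k^~ y = fun=> 0 by apply/funext.
    split; last by rewrite Rintegral_cst// mul0r.
    exact: integrable0.
  have y0 : 0 < y by move/set_mem: yD; rewrite in_Dp.
  have [ig gle] := green_schur y0.
  have E : k^~ y = (fun x => f y ^+ 2 * (green y x * (aco x)^-1 ^+ 2)) \_ Dp.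
    apply/funext => x; rewrite /k aT2 fT2 /B !patchE yD greenC.
    by case: ifP => _; [ring|rewrite mul0r].
  rewrite E -Rintegral_mkcond; split; first by apply/(intR_patch _ mD).1; exact: intRZ.
  rewrite (RIZ _ mD ig) -[leRHS]mulr1.
  by apply: ler_wpM2l; [exact: sqr_ge0|exact: gle].
have [iA leA] := RI_tonelli_le mk k0 mA A0 iB kA kB.
split; first by split; [exact: mM|apply/(intR_patch _ mD).2; exact: iA].
by rewrite Rintegral_mkcond [leRHS]Rintegral_mkcond.
Qed.

End GreenSolution.

(** * The energy estimate *)

Section Energy.
Context {R : realType}.
Implicit Types (x y : R).

Notation Dp := (`](0:R), +oo[%classic).

Lemma le0_of_le_eps (X Y e0 : R) : 0 < e0 ->
  (forall e, 0 < e -> e <= e0 -> X <= e * Y) -> X <= 0.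
Proof.
move=> e00 H; rewrite leNgt; apply/negP => X0.
have [Y0|Y0] := leP Y 0.
  have h : e0 * Y <= 0 by rewrite mulr_ge0_le0// ltW.
  by have := le_lt_trans (le_trans (H e0 e00 (lexx _)) h) X0; rewrite ltxx.
pose e := Num.min e0 (X / (2 * Y)).
have e0' : 0 < e by rewrite lt_min e00 divr_gt0// mulr_gt0.
have := H e e0' (ltac:(by rewrite ge_min lexx)).
have : e * Y <= X / 2.
  rewrite -ler_pdivlMr// ge_min; apply/orP; right.
  by rewrite invfM mulrA.
by move: X0; move: (e * Y); clear; move=> z X0 h1 h2; lra.
Qed.

(** The positive part. Its square is of class C^1 ([posp_sqr_derive]), hence usable as a cut-off
    with a continuous derivative. *)
Definition posp (t : R) : R := (t + `|t|) / 2.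

Lemma posp_ge0 t : 0 <= posp t.
Proof. by rewrite divr_ge0// addrC -[X in _ + X]opprK subr_ge0 -normrN ler_norm. Qed.

Lemma posp_pos t : 0 <= t -> posp t = t.
Proof. by move=> t0; rewrite /posp ger0_norm//; field. Qed.

Lemma posp_neg t : t <= 0 -> posp t = 0.
Proof. by move=> t0; rewrite /posp ler0_norm// subrr mul0r. Qed.

Lemma posp_sqr t : posp t ^+ 2 = t * posp t.
Proof.
by have [t0|/ltW t0] := leP 0 t; [rewrite posp_pos// expr2|rewrite posp_neg// expr0n mulr0].
Qed.

Lemma posp_cont : continuous posp.
Proof.
move=> t; apply: cvgM; last exact: cvg_cst.
by apply: cvgD; [exact: cvg_id|exact: norm_continuous].
Qed.

Lemma posp_sqr_derive (t : R) : is_derive t 1 (fun x => posp x ^+ 2) (2 * posp t).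
Proof.
have [t0|t0|<-] := ltgtP 0 t.
- rewrite (posp_pos (ltW t0)).
  have := isdM (is_derive_id t 1) (is_derive_id t 1).
  move=> H; have {}H : is_derive t 1 (fun x : R => x * x) (2 * t).
    by apply: isd_eq H _; ring.
  apply: isd_near H; near=> x.
  have x0 : 0 <= x by apply: ltW; near: x; exact: lt_nbhsr.
  by rewrite posp_pos// expr2.
- rewrite (posp_neg (ltW t0)) mulr0.
  apply: isd_near (isd_cst t 0); near=> x.
  have x0 : x <= 0 by apply: ltW; near: x; exact: lt_nbhsl.
  by rewrite posp_neg// expr0n.
- rewrite posp_pos// mulr0; apply/is_derive1_caratheodory.
  exists posp; split.
  + by move=> x; rewrite !posp_sqr mul0r !subr0 mulrC.
  + exact: posp_cont.
  + exact: posp_pos.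
Unshelve. all: by end_near. Qed.

(* |cut_off'| <= e / aco everywhere, hence the error terms it produces are
   controlled by the norm of v / aco, at 0 as well as at +oo. *)
Definition cut_arg (e : R) x : R := 1 - e * (psol x + x).
Definition cut_arg' (e : R) x : R := - (e * (psol' x + 1)).
Definition cut_off e x : R := posp (cut_arg e x) ^+ 2.
Definition cut_off' e x : R := 2 * posp (cut_arg e x) * cut_arg' e x.

Lemma cut_off_derive e x : 0 < x -> is_derive x 1 (cut_off e) (cut_off' e x).
Proof.
move=> x0.
have := isdB (isd_cst x 1) (isdZ e (isdD (psol_derive x0) (is_derive_id x 1))).
move=> H; have {}H : is_derive x 1 (cut_arg e) (cut_arg' e x).
  by apply: isd_eq H _; rewrite sub0r.
exact: (isd_comp (f := cut_arg e) (posp_sqr_derive _) H).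
Qed.

Lemma cut_arg_cont e : {in `](0:R), +oo[, continuous (cut_arg e)}.
Proof.
apply: contD; first exact: cont_cst.
apply: contN; apply: contM; first exact: cont_cst.
by apply: contD; [exact: psol_cont|move=> x _].
Qed.

Lemma prim_cut_off e : prim (cut_off e) (cut_off' e).
Proof.
apply: prim_derive (cut_off_derive e).
apply: contM.
  apply: contM; first exact: cont_cst.
  move=> x x0; apply: continuous_comp; first exact: cut_arg_cont.
  exact: posp_cont.
apply: contN; apply: contM; first exact: cont_cst.
by apply: contD; [exact: psol'_cont|exact: cont_cst].
Qed.

(** |1 - u / aco| <= 1 / aco, because 0 < u < 1 and aco < 1. *)
Lemma cut_arg'_le e x : 0 <= e -> 0 < x -> cut_arg' e x ^+ 2 <= (e / aco x) ^+ 2.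
Proof.
move=> e0 x0; rewrite /cut_arg' sqrrN !exprMn ler_wpM2l ?sqr_ge0//.
have a0 := aco_gt0 x0; have a1 := aco_lt1 x0.
have u0 := ucusp_gt0 x0; have u1 := ucusp_lt1 x0.
have ai : 1 <= (aco x)^-1 by rewrite invf_ge1// ltW.
rewrite /psol'; move: ai; move: (aco x)^-1 => b b1.
have : ucusp x * b <= b by rewrite ler_piMl ?(le_trans ler01)// ltW.
have : 0 <= ucusp x * b by rewrite mulr_ge0 ?(ltW u0)// (le_trans ler01).
move: (ucusp x * b) => t t0 tb; nra.
Qed.

Lemma cut_off_le1 e x : 0 <= e -> 0 < x -> cut_off e x <= 1.
Proof.
move=> e0 x0; rewrite /cut_off expr_le1 ?posp_ge0//.
have [s0|/ltW s0] := leP 0 (cut_arg e x); last by rewrite posp_neg.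
rewrite posp_pos// /cut_arg lerBlDr lerDl mulr_ge0// addr_ge0// ltW//.
exact: psol_gt0.
Qed.

Lemma le_RI_subset (D E : set R) (f : R -> R) : measurable D -> measurable E ->
  E `<=` D -> (forall x, D x -> 0 <= f x) -> intR D f -> RI E f <= RI D f.
Proof.
move=> mD mE ED f0 fi; have fiE := intRS mD mE ED fi.
rewrite -lee_fin -(RI_fin fi mD) -(RI_fin fiE mE).
apply: ge0_subset_integral => //.
by apply/measurable_EFinP; exact: intR_meas fi.
Qed.

(** Young's inequality for the right-hand side f = (r, s) against y / aco = (t, u), where y = (1 - i
    beta) v, n = |v / aco|^2 and B = 1 + beta^2. *)
Lemma energy_young (B c r s t u n : R) : 0 < B -> t ^+ 2 + u ^+ 2 = B * n ->
  2 * c * (r * t + s * u) <= B * (r ^+ 2 + s ^+ 2) + c ^+ 2 * n.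
Proof.
move=> B0 E; rewrite -subr_ge0 -(pmulr_rge0 _ B0).
rewrite [X in 0 <= X](_ : _ = (B * r - c * t) ^+ 2 + (B * s - c * u) ^+ 2
   + c ^+ 2 * (B * n - (t ^+ 2 + u ^+ 2))); last by ring.
by rewrite E subrr mulr0 addr0 addr_ge0// sqr_ge0.
Qed.

(** Completing the square. Since the cut-off is p^2 with derivative 2 p s, the cross term y W
    cut_off' is absorbed by |W|^2 p^2, at the price of s^2 |y|^2 alone: this is the reason for
    squaring the cut-off. *)
Lemma energy_cut (p s r1 r2 t1 t2 T : R) : s ^+ 2 * (t1 ^+ 2 + t2 ^+ 2) <= T ->
  - T <= 2 * p * s * (r1 * t1 + r2 * t2) + p ^+ 2 * (r1 ^+ 2 + r2 ^+ 2).
Proof.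
move=> h; have := sqr_ge0 (p * r1 + s * t1); have := sqr_ge0 (p * r2 + s * t2).
by rewrite !expr2 => h1 h2; move: h; rewrite !expr2; nra.
Qed.

(** With the coefficient q at least c, half of the coercive term 2 c^2 X n pays for f by Young's
    inequality and the other half is kept; Z collects the terms where the derivative of v occurs. *)
Lemma energy_point (c B X n F fy Z q e2 : R) : 0 < c -> 0 < B -> 0 <= X <= 1 ->
  0 <= n -> 0 <= F -> c <= q -> 2 * c * fy <= B * F + c ^+ 2 * n ->
  - (e2 * (B * n)) <= Z ->
  c ^+ 2 * (X * n) - B * F - 2 * c * B * e2 * n <= 2 * c * (X * (q * n - fy) + Z).
Proof.
move=> c0 B0 /andP[X0 X1] n0 F0 cq hy hZ.
have t1 : 2 * c * (X * (c * n)) <= 2 * c * (X * (q * n)).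
  by rewrite ler_wpM2l ?mulr_ge0 ?(ltW c0)// ler_wpM2l// ler_wpM2r.
have t2 : X * (2 * c * fy) <= B * F + X * (c ^+ 2 * n).
  apply: le_trans (ler_wpM2l X0 hy) _; rewrite mulrDr lerD2r.
  by rewrite ler_piMl// mulr_ge0// ltW.
have t3 : 2 * c * (- (e2 * (B * n))) <= 2 * c * Z.
  by rewrite ler_wpM2l ?mulr_ge0 ?(ltW c0).
rewrite -subr_ge0.
rewrite (_ : _ - _ = (2 * c * (X * (q * n)) - 2 * c * (X * (c * n)))
  + (B * F + X * (c ^+ 2 * n) - X * (2 * c * fy))
  + (2 * c * Z - 2 * c * (- (e2 * (B * n))))); last by ring.
by apply: addr_ge0; [apply: addr_ge0|]; rewrite subr_ge0.
Qed.

(** H is the almost everywhere derivative of W * (cut_off e * g), which vanishes at both ends. *)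
Lemma energy_identity e (v W w g G : R -> R) (b d : R) : 0 < e -> 0 < b -> b <= d ->
  cut_off e b = 0 -> cut_off e d = 0 ->
  prim W w -> prim g G ->
  let H := fun x => w x * (cut_off e x * g x) +
                    W x * (cut_off' e x * g x + cut_off e x * G x) in
  intR `[b, d] H /\ RI `[b, d] H = 0.
Proof.
move=> e0 b0 bd cb cd Ww gG.
have [i E] := primM Ww (primM (prim_cut_off e) gG) b0 bd.
by split => //; rewrite -E cb cd !(mul0r, mulr0) subrr.
Qed.

(** The expression bounded below by c, taken at s = aco x, is the coefficient of |v / aco|^2 once
    the equation is divided by [aco] and tested against y = (1 - i beta) v. The inequality is proved
    on a compact interval [b, d] up to an error O(e); then e tends to 0 and the intervals exhaust
    the half-line. *)
Lemma energy_estimate (zr zi beta c : R) (v1 v2 W1 W2 w1 w2 f1 f2 : R -> R) :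
  0 < c ->
  (forall s, 0 <= s <= 1 -> c <= 2 - (1 + zr) * s + beta * zi * s) ->
  prim v1 W1 -> prim W1 w1 -> prim v2 W2 -> prim W2 w2 ->
  (forall x, 0 < x -> f1 x = - (aco x * w1 x) + (2 - aco x) / aco x * v1 x
                            - (zr * v1 x - zi * v2 x)) ->
  (forall x, 0 < x -> f2 x = - (aco x * w2 x) + (2 - aco x) / aco x * v2 x
                            - (zr * v2 x + zi * v1 x)) ->
  sqint Dp (fun x => v1 x / aco x) -> sqint Dp (fun x => v2 x / aco x) ->
  sqint Dp f1 -> sqint Dp f2 ->
  c ^+ 2 * RI Dp (fun x => (v1 x / aco x) ^+ 2 + (v2 x / aco x) ^+ 2) <=
  (1 + beta ^+ 2) * RI Dp (fun x => f1 x ^+ 2 + f2 x ^+ 2).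
Proof.
move=> c0 hc pv1 pW1 pv2 pW2 Ef1 Ef2 sv1 sv2 sf1 sf2.
pose N x := (v1 x / aco x) ^+ 2 + (v2 x / aco x) ^+ 2.
pose F x := f1 x ^+ 2 + f2 x ^+ 2.
have mD : measurable Dp by exact: measurable_itv.
have iN : intR Dp N by apply: intRD => //; [exact: sv1.2|exact: sv2.2].
have iF : intR Dp F by apply: intRD => //; [exact: sf1.2|exact: sf2.2].
have N0 x : 0 <= N x by rewrite addr_ge0// sqr_ge0.
have F0 x : 0 <= F x by rewrite addr_ge0// sqr_ge0.
pose B := 1 + beta ^+ 2.
have B0 : 0 < B by rewrite ltr_pwDl// sqr_ge0.
pose y1 x := v1 x + beta * v2 x.
pose y2 x := v2 x + (- beta) * v1 x.
pose Y1 x := W1 x + beta * W2 x.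
pose Y2 x := W2 x + (- beta) * W1 x.
have py1 : prim y1 Y1 by apply: primD => //; exact: primZ.
have py2 : prim y2 Y2 by apply: primD => //; exact: primZ.
suff main b d : 0 < b -> b <= d ->
    c ^+ 2 * RI `[b, d] N <= B * RI Dp F.
  have [_ NC] : intR Dp N /\ RI Dp N <= (B * RI Dp F) / c ^+ 2.
    apply: (@exhaust_int R N 1) => //.
      exact: intR_meas iN.
    move=> b d b0 b1 d1; have bd := le_trans b1 d1.
    split; first by apply: intRS iN => //; exact: itv_pos_sub.
    by rewrite ler_pdivlMr ?exprn_gt0// mulrC main.
  by rewrite -ler_pdivlMl ?exprn_gt0// mulrC.
move=> b0 bd.
(* psol x + x <= P on [b, d], so there the cut-off is at least (1 - e P)^2 >= 1 - 2 e P. *)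
pose P := psol b + d.
have d0 : 0 < d by exact: lt_le_trans bd.
have P0 : 0 < P by rewrite addr_gt0// psol_gt0.
have ibd : intR `[b, d] N by apply: intRS iN => //; exact: itv_pos_sub.
rewrite -subr_le0.
apply: (@le0_of_le_eps _ (2 * c ^+ 2 * P * RI `[b, d] N + 2 * c * B * RI Dp N)
   (Num.min 1 P^-1)).
  by rewrite lt_min ltr01 invr_gt0.
move=> e e0; rewrite le_min => /andP[e1 eP].
have [dl dl0 dlP] := @psol_large R e^-1 (ltac:(by rewrite invr_gt0)).
(* The cut-off vanishes at b', where psol > 1 / e, and at d', which is at least 1 / e. *)
pose b' := Num.min b (dl / 2).
pose d' := Num.max d e^-1.
have b'0 : 0 < b' by rewrite lt_min b0 divr_gt0.
have b'b : b' <= b by rewrite ge_min lexx.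
have dd' : d <= d' by rewrite le_max lexx.
have b'd' : b' <= d' by apply: le_trans b'b (le_trans bd dd').
have d'0 : 0 < d' by exact: lt_le_trans dd'.
have cut0 x : 0 < x -> 1 <= e * (psol x + x) -> cut_off e x = 0.
  by move=> x0 h; rewrite /cut_off posp_neg ?expr0n// subr_le0.
have cb : cut_off e b' = 0.
  apply: cut0 => //; rewrite -ler_pdivrMl// mulr1.
  apply: (@le_trans _ _ (psol b')); last by rewrite lerDl ltW.
  apply: ltW; apply: dlP; rewrite b'0/= gt_min; apply/orP; right.
  by rewrite ltr_pdivrMr// ltr_pMr// ltr1n.
have cd : cut_off e d' = 0.
  apply: cut0 => //; rewrite -ler_pdivrMl// mulr1.
  apply: (@le_trans _ _ d'); first by rewrite le_max lexx orbT.
  by rewrite lerDr ltW// psol_gt0.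
have [i1 I1] := @energy_identity e v1 W1 w1 y1 Y1 b' d' e0 b'0 b'd' cb cd pW1 py1.
have [i2 I2] := @energy_identity e v2 W2 w2 y2 Y2 b' d' e0 b'0 b'd' cb cd pW2 py2.
move: i1 I1 i2 I2.
set H1 := (fun x => w1 x * _ + _); set H2 := (fun x => w2 x * _ + _).
move=> i1 I1 i2 I2.
have point x : 0 < x ->
  c ^+ 2 * (cut_off e x * N x) - B * F x - 2 * c * B * e ^+ 2 * N x <=
  2 * c * (H1 x + H2 x).
  move=> x0; have a0 := aco_gt0 x0; have a1 := aco_lt1 x0.
  have hq := hc (aco x) (ltac:(by rewrite !ltW)).
  have X1 := cut_off_le1 (ltW e0) x0.
  have hs := cut_arg'_le (ltW e0) x0.
  have w1E : w1 x = ((2 - aco x) / aco x * v1 x - (zr * v1 x - zi * v2 x) - f1 x) / aco x.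
    by rewrite Ef1//; field; rewrite gt_eqF.
  have w2E : w2 x = ((2 - aco x) / aco x * v2 x - (zr * v2 x + zi * v1 x) - f2 x) / aco x.
    by rewrite Ef2//; field; rewrite gt_eqF.
  (* The skew terms cancel in the sum: y . v = |v|^2 and Y . W = |W|^2, while z v . y is (zr - beta
     zi) |v|^2. *)
  have HE : H1 x + H2 x =
      cut_off e x * ((2 - (1 + zr) * aco x + beta * zi * aco x) * N x
        - (f1 x * (y1 x / aco x) + f2 x * (y2 x / aco x)))
      + cut_off' e x * (W1 x * y1 x + W2 x * y2 x)
      + cut_off e x * (W1 x ^+ 2 + W2 x ^+ 2).
    rewrite /H1 /H2 w1E w2E /N /y1 /y2 /Y1 /Y2.
    by field; rewrite gt_eqF.
  have yN : (y1 x / aco x) ^+ 2 + (y2 x / aco x) ^+ 2 = B * N x.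
    by rewrite /y1 /y2 /N /B; field; rewrite gt_eqF.
  have cutW : - (e ^+ 2 * (B * N x)) <=
      cut_off' e x * (W1 x * y1 x + W2 x * y2 x) + cut_off e x * (W1 x ^+ 2 + W2 x ^+ 2).
    apply: energy_cut; rewrite -yN.
    rewrite (_ : e ^+ 2 * _ = (e / aco x) ^+ 2 * (y1 x ^+ 2 + y2 x ^+ 2)).
      by rewrite ler_wpM2r// addr_ge0 ?sqr_ge0.
    by field; rewrite gt_eqF.
  rewrite HE -[X in _ <= _ * X]addrA; apply: energy_point => //.
  - by rewrite X1 sqr_ge0.
  - exact: energy_young.
have mI : measurable `[b', d']%classic by exact: measurable_itv.
have subI : `[b', d']%classic `<=` Dp by exact: itv_pos_sub.
have iNI : intR `[b', d'] N by exact: intRS iN.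
have iFI : intR `[b', d'] F by exact: intRS iF.
have mX : measurable_fun `[b', d'] (cut_off e).
  by apply: cont_meas_itv => //; exact: prim_cont (prim_cut_off e).
have X01 x : `[b', d']%classic x -> 0 <= cut_off e x <= 1.
  by move=> /subI; rewrite in_Dp => x0; rewrite sqr_ge0 cut_off_le1// ltW.
have iXN : intR `[b', d'] (fun x => cut_off e x * N x).
  apply: (intRM_bounded mI mX (M := 1)) iNI => x /X01 /andP[? ?].
  by rewrite ger0_norm.
have J1 : c ^+ 2 * RI `[b', d'] (fun x => cut_off e x * N x) - B * RI `[b', d'] F
      - 2 * c * B * e ^+ 2 * RI `[b', d'] N <= 0.
  have <- : 2 * c * RI `[b', d'] (fun x => H1 x + H2 x) = 0.
    by rewrite (RID mI i1 i2) I1 I2 addr0 mulr0.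
  rewrite -(RIZ _ mI iXN) -(RIZ _ mI iFI) -(RIZ (2 * c * B * e ^+ 2) mI iNI).
  have k1 := intRZ (c ^+ 2) mI iXN; have k2 := intRZ B mI iFI.
  have k3 := intRZ (2 * c * B * e ^+ 2) mI iNI.
  have k4 := intRD mI i1 i2.
  rewrite -(RIZ _ mI k4) -(RIB mI k1 k2) -(RIB mI (intRB mI k1 k2) k3).
  apply: le_RI => //; [exact: intRB (intRB mI k1 k2) k3|exact: intRZ|].
  by move=> x /subI; rewrite in_Dp; exact: point.
have J2 : RI `[b', d'] F <= RI Dp F by exact: le_RI_subset.
have J3 : RI `[b', d'] N <= RI Dp N by exact: le_RI_subset.
have J4 : (1 - 2 * (e * P)) * RI `[b, d] N <= RI `[b', d'] (fun x => cut_off e x * N x).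
  apply: (@le_trans _ _ (RI `[b, d] (fun x => cut_off e x * N x))); last first.
    apply: le_RI_subset => //.
      by apply: subset_itv; rewrite bnd_simp.
    by move=> x /X01/andP[? _]; rewrite mulr_ge0.
  rewrite -RIZ//; apply: le_RI => //; first exact: intRZ.
    by apply: (intRS mI _ _ iXN) => //; apply: subset_itv; rewrite bnd_simp.
  move=> x; rewrite /= in_itv/= => /andP[bx xd]; apply: ler_wpM2r => //.
  have x0 : 0 < x by exact: lt_le_trans bx.
  have eP1 : e * P <= 1 by rewrite -ler_pdivlMr// div1r.
  have h1 : 1 - e * P <= cut_arg e x.
    rewrite /cut_arg lerD2l lerN2 ler_wpM2l ?(ltW e0)// /P lerD// psol_le//.
  have h0 : 0 <= 1 - e * P by rewrite subr_ge0.
  rewrite /cut_off posp_pos ?(le_trans h0)//.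
  apply: (@le_trans _ _ ((1 - e * P) ^+ 2)); last by rewrite lerXn2r// nnegrE (le_trans h0).
  by rewrite -subr_ge0 (_ : _ - _ = (e * P) ^+ 2) ?sqr_ge0//; ring.
have n0 : 0 <= RI Dp N by apply: Rintegral_ge0 => x _; exact: N0.
have ee : e ^+ 2 <= e by rewrite expr2 ler_piMr// ltW.
have J5 : c ^+ 2 * ((1 - 2 * (e * P)) * RI `[b, d] N) <=
   c ^+ 2 * RI `[b', d'] (fun x => cut_off e x * N x).
  by rewrite ler_wpM2l// sqr_ge0.
have J6 : B * RI `[b', d'] F <= B * RI Dp F by rewrite ler_wpM2l// ltW.
have J7 : 2 * c * B * e ^+ 2 * RI `[b', d'] N <= 2 * c * B * e * RI Dp N.
  apply: (@le_trans _ _ (2 * c * B * e ^+ 2 * RI Dp N)).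
    by rewrite ler_wpM2l// !mulr_ge0 ?sqr_ge0// ltW.
  by rewrite ler_wpM2r// ler_wpM2l// !mulr_ge0// ltW.
move: J1 J5 J6 J7.
set rX := RI `[b', d'] (fun x => _); set rF := RI `[b', d'] F.
set rN := RI `[b', d'] N; set n := RI `[b, d] N.
set nD := RI Dp N; set fD := RI Dp F.
by clear; move=> J1 J5 J6 J7; lra.
Qed.

End Energy.

(** * The method of continuity *)

Section ContinuityMethod.
Context {R : realType} {T : Type}.
Notation E := (T -> R).
(** S is a linear subspace and Q the square of a seminorm on it, so Q = 0 stands for equality almost
    everywhere. The triangle inequality is used in the squared form [QD], and completeness only for
    series whose terms decrease geometrically. *)
Variables (S : E -> Prop) (Q : E -> R) (A : E -> E) (K C : R).
Hypothesis SD : forall x y : E, S x -> S y -> S (x \+ y).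
Hypothesis SZ : forall k (x : E), S x -> S (k \*o x).
Hypothesis Q_ge0 : forall x : E, 0 <= Q x.
Hypothesis QD : forall x y : E, S x -> S y -> Q (x \+ y) <= 2 * Q x + 2 * Q y.
Hypothesis QZ : forall k (x : E), S x -> Q (k \*o x) = k ^+ 2 * Q x.
Hypothesis Q_complete : forall (x : nat -> E) B, (forall n, S (x n)) ->
  (forall n, Q (x n) <= B / 4 ^+ n) ->
  exists2 y : E, S y &
    exists B', forall n, Q (fun z => y z - \sum_(k < n) x k z) <= B' / 2 ^+ n.
Hypothesis AS : forall x, S x -> S (A x).
Hypothesis AD : forall x y : E, S x -> S y -> A (x \+ y) = A x \+ A y.
Hypothesis AZ : forall k (x : E), S x -> A (k \*o x) = k \*o A x.
Hypothesis K_ge0 : 0 <= K.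
Hypothesis QA : forall x, S x -> Q (A x) <= K * Q x.
Hypothesis C_ge0 : 0 <= C.
Hypothesis apriori : forall t (x : E), 0 <= t <= 1 -> S x ->
  Q x <= C * Q (x \- (t \*o A x)).

Lemma methodB x y : S x -> S y -> S (x \- y).
Proof.
move=> Sx Sy; have -> : x \- y = x \+ ((-1) \*o y).
  by apply/funext => z /=; rewrite mulN1r.
by apply: SD => //; exact: SZ.
Qed.

Lemma method_null0 x : S x -> Q (fun=> 0) = 0.
Proof.
move=> Sx; have -> : (fun=> 0) = 0 \*o x by apply/funext => z /=; rewrite mul0r.
by rewrite QZ// expr0n mul0r.
Qed.

Lemma method_nullD x y : S x -> S y -> Q x = 0 -> Q y = 0 -> Q (x \+ y) = 0.
Proof.
move=> Sx Sy x0 y0; apply/eqP; rewrite eq_le Q_ge0 andbT.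
by apply: le_trans (QD Sx Sy) _; rewrite x0 y0 !mulr0 addr0.
Qed.

Lemma methodAB x y : S x -> S y -> A (x \- y) = A x \- A y.
Proof.
move=> Sx Sy; have -> : x \- y = x \+ ((-1) \*o y).
  by apply/funext => z /=; rewrite mulN1r.
rewrite AD//; last exact: SZ.
by rewrite AZ//; apply/funext => z /=; rewrite mulN1r.
Qed.

Definition solvable t := forall f, S f ->
  exists2 x : E, S x & Q (x \- (t \*o A x) \- f) = 0.

Lemma le_geometric0 (a B : R) : 0 <= a -> (forall n : nat, a <= B / 2 ^+ n) -> a = 0.
Proof.
move=> a0 H; apply/eqP; rewrite eq_le a0 andbT leNgt; apply/negP => ap.
have B0 : 0 < B by have := H 0%N; rewrite expr0 divr1; exact: lt_le_trans.
pose n := Num.truncn (B / a).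
have := H n; rewrite ler_pdivlMr ?exprn_gt0// mulrC -ler_pdivlMr// leNgt => /negP; apply.
apply: lt_le_trans (truncnS_gt _) _; rewrite -/n -natrX ler_nat.
exact: ltn_expl.
Qed.

(** Neumann series around t: with r a right inverse of 1 - t A, put x_0 = r f and x_(n+1) = r (s A
    x_n). The a priori bound and the smallness of s divide Q x_n by 4 at each step, since Q x_(n+1)
    <= C * 2 * s^2 * K * Q x_n. The admissible s depends on C and K but not on t. *)
Lemma solvable_step t s : 0 <= t <= 1 -> 8 * C * K * s ^+ 2 <= 1 ->
  solvable t -> solvable (t + s).
Proof.
move=> t01 hs Pt f Sf.
have /choice[r rP] : forall g : E, exists x : E, S g ->
    S x /\ Q (x \- (t \*o A x) \- g) = 0.
  move=> g; have [Sg|nSg] := pselect (S g); last by exists g.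
  by have [x Sx xg] := Pt g Sg; exists x.
pose x := fix x n := if n is m.+1 then r (s \*o A (x m)) else r f.
have Sx n : S (x n).
  elim: n => [|n IH]; first by have [] := rP f Sf.
  by have [] := rP (s \*o A (x n)) (SZ s (AS IH)).
have SAx n k : S (k \*o A (x n)) by apply: SZ; exact: AS.
have xS n : Q (x n.+1 \- (t \*o A (x n.+1)) \- (s \*o A (x n))) = 0.
  by have [] := rP (s \*o A (x n)) (SAx n s).
have Q4 n : Q (x n.+1) <= Q (x n) / 4.
  apply: le_trans (apriori t01 (Sx _)) _.
  have : Q (x n.+1 \- (t \*o A (x n.+1))) <= 2 * (s ^+ 2 * (K * Q (x n))).
    have -> : x n.+1 \- (t \*o A (x n.+1)) =
        (x n.+1 \- (t \*o A (x n.+1)) \- (s \*o A (x n))) \+ (s \*o A (x n)).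
      by apply/funext => z /=; rewrite subrK.
    apply: le_trans (QD _ _) _ => //.
      by apply: methodB => //; exact: methodB.
    rewrite xS mulr0 add0r QZ; last exact: AS.
    by rewrite ler_wpM2l// ler_wpM2l ?sqr_ge0// QA.
  move=> h; apply: le_trans (ler_wpM2l C_ge0 h) _.
  have := ler_wpM2r (Q_ge0 (x n)) hs; rewrite mul1r.
  rewrite (_ : 8 * C * K * s ^+ 2 * Q (x n) = 4 * (C * (2 * (s ^+ 2 * (K * Q (x n)))))); last by ring.
  by rewrite ler_pdivlMr// mulrC.
have Qx n : Q (x n) <= Q (x 0%N) / 4 ^+ n.
  elim: n => [|n IH]; first by rewrite expr0 divr1.
  apply: le_trans (Q4 n) _; rewrite exprS invfM [4^-1 * _]mulrC mulrA.
  by rewrite ler_wpM2r// invr_ge0.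
have [y Sy [B hB]] := Q_complete Sx Qx.
exists y => //.
pose p n : E := fun z => \sum_(k < n) x k z.
have pS n : p n.+1 = p n \+ x n.
  by apply/funext => z; rewrite /p big_ord_recr.
have p1 : p 1%N = x 0%N by apply/funext => z; rewrite /p big_ord1.
have Sp n : S (p n.+1).
  by elim: n => [|n IH]; [rewrite p1|rewrite pS; apply: SD].
have Spt n k : S (p n.+1 \- (k \*o A (p n.+1))).
  by apply: methodB => //; apply: SZ; exact: AS.
(* Telescoping: the partial sum p_(n+1) solves the equation at t + s up to - s A x_n. *)
have res n : Q (p n.+1 \- ((t + s) \*o A (p n.+1)) \- f \+ (s \*o A (x n))) = 0.
  elim: n => [|n IH].
    rewrite p1 -[RHS](rP f Sf).2; congr Q.
    by apply/funext => z /=; ring.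
  rewrite pS AD// (_ : _ \+ _ = (p n.+1 \- ((t + s) \*o A (p n.+1)) \- f \+ (s \*o A (x n)))
     \+ (x n.+1 \- (t \*o A (x n.+1)) \- (s \*o A (x n)))); last first.
    by apply/funext => z /=; ring.
  apply: method_nullD => //.
    by apply: SD => //; apply: methodB.
  by apply: methodB => //; exact: methodB.
pose c := 2 + 2 * (t + s) ^+ 2 * K.
have c0 : 0 <= c by rewrite addr_ge0// mulr_ge0// mulr_ge0// sqr_ge0.
(* The residual of y differs from that of a partial sum by a term controlled by y - p_(n+1), which
   is geometrically small by completeness. *)
have bound n : Q (y \- ((t + s) \*o A y) \- f) <=
    2 * (c * Q (y \- p n.+1)) + 2 * (2 * (s ^+ 2 * (K * Q (x n)))).
  have Sd : S (y \- p n.+1) by exact: methodB.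
  have SAd : S ((- (t + s)) \*o A (y \- p n.+1)) by apply: SZ; exact: AS.
  have -> : y \- ((t + s) \*o A y) \- f = ((y \- p n.+1) \+ ((- (t + s)) \*o A (y \- p n.+1)))
     \+ (p n.+1 \- ((t + s) \*o A (p n.+1)) \- f).
    by rewrite methodAB//; apply/funext => z /=; ring.
  apply: le_trans (QD _ _) _; [exact: SD|by apply: methodB|].
  apply: lerD; rewrite ler_wpM2l//.
    apply: le_trans (QD Sd SAd) _; rewrite QZ; last exact: AS.
    rewrite /c sqrrN; have := ler_wpM2l (sqr_ge0 (t + s)) (QA Sd).
    move: (Q (A (y \- p n.+1))) (Q (y \- p n.+1)) ((t + s) ^+ 2) => a b d; lra.
  have -> : p n.+1 \- ((t + s) \*o A (p n.+1)) \- f =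
    (p n.+1 \- ((t + s) \*o A (p n.+1)) \- f \+ (s \*o A (x n))) \+ ((- s) \*o A (x n)).
    by apply/funext => z /=; ring.
  apply: le_trans (QD _ _) _ => //.
    by apply: SD => //; apply: methodB.
  rewrite res mulr0 add0r QZ; last exact: AS.
  by rewrite sqrrN ler_wpM2l// ler_wpM2l ?sqr_ge0// QA.
pose B1 := 2 * c * `|B| + 4 * s ^+ 2 * K * Q (x 0%N).
apply: (@le_geometric0 _ B1); first exact: Q_ge0.
move=> n; apply: le_trans (bound n) _.
rewrite /B1 [leRHS]mulrDl; apply: lerD.
  rewrite -!mulrA ler_wpM2l// ler_wpM2l//.
  apply: le_trans (hB n.+1) _.
  apply: (@le_trans _ _ (`|B| / 2 ^+ n.+1)).
    by rewrite ler_wpM2r ?invr_ge0 ?exprn_ge0// ler_norm.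
  rewrite ler_wpM2l// lef_pV2 ?posrE ?exprn_gt0//.
  by rewrite ler_eXn2l// ltr1n.
rewrite (_ : 2 * (2 * _) = 4 * (s ^+ 2 * (K * Q (x n)))); last by ring.
rewrite (_ : 4 * s ^+ 2 * K * Q (x 0%N) / 2 ^+ n = 4 * (s ^+ 2 * (K * (Q (x 0%N) / 2 ^+ n)))); last by ring.
rewrite ler_wpM2l// ler_wpM2l ?sqr_ge0// ler_wpM2l//.
apply: le_trans (Qx n) _; rewrite ler_wpM2l ?Q_ge0//.
by rewrite lef_pV2 ?posrE ?exprn_gt0// lerXn2r ?nnegrE// ler_nat.
Qed.

Lemma continuity_method f : S f -> exists2 x : E, S x & Q (x \- A x \- f) = 0.
Proof.
(* N steps of length 1 / N lead from 0 to 1; each is admissible because 8 C K < N <= N^2. *)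
pose N := (Num.truncn (8 * C * K)).+1.
have N0 : (0 : R) < N%:R by rewrite ltr0n.
have hN : 8 * C * K * (N%:R^-1) ^+ 2 <= 1.
  rewrite exprVn ler_pdivrMr ?exprn_gt0// mul1r.
  apply: le_trans (ltW (truncnS_gt _)) _.
  by rewrite -/N -natrX ler_nat -mulnn leq_pmulr.
have H k : (k <= N)%N -> solvable (k%:R / N%:R).
  elim: k => [_|k IH kN].
    move=> g Sg; exists g => //.
    rewrite -[RHS](method_null0 Sg); congr Q.
    by apply/funext => z /=; rewrite mul0r mul0r subr0 subrr.
  rewrite -natr1 mulrDl div1r; apply: solvable_step => //; last by apply: IH; exact: ltnW.
  by rewrite divr_ge0//= ler_pdivrMr// mul1r ler_nat ltnW.
move=> Sf; have [x Sx] := H N (leqnn N) f Sf.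
rewrite divff ?gt_eqF// => <-; exists x => //; congr Q.
by apply/funext => z /=; rewrite mul1r.
Qed.

End ContinuityMethod.

(** * Completeness of L^2 for geometrically decreasing series *)

Section Completeness.
Context {R : realType}.
Variables (D : set R).
Hypothesis mD : measurable D.
Implicit Types (f g : R -> R) (x : nat -> R -> R).

(** Cauchy-Schwarz with the weights 2^-(n + k), whose sum is at most 2 / 2^n. *)
Lemma sum_sqr_geometric (a : nat -> R) n m :
  (\sum_(k < m) a (n + k)%N) ^+ 2 <= 2 / 2 ^+ n * \sum_(k < m) 2 ^+ (n + k) * a (n + k)%N ^+ 2.
Proof.
elim: m n => [|m IH] n; first by rewrite !big_ord0 expr0n mulr0.
rewrite !big_ord_recl/= addn0.
under eq_bigr do rewrite /bump/= add1n addnS -addSn.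
under [X in _ <= _ * (_ + X)]eq_bigr do rewrite /bump/= add1n addnS -addSn.
have := IH n.+1.
move: (\sum_(k < m) _) (\sum_(k < m) _) => G r.
have -> : 2 / 2 ^+ n.+1 = (2 ^+ n)^-1 :> R.
  by rewrite exprS; field; rewrite expf_neq0.
have -> : 2 / 2 ^+ n * (2 ^+ n * a n ^+ 2 + G) = 2 * a n ^+ 2 + 2 * ((2 ^+ n)^-1 * G).
  by field; rewrite expf_neq0.
have := sqr_ge0 (a n - r); move: ((2 ^+ n)^-1 * G) (a n) => H b.
by rewrite !expr2; lra.
Qed.

Lemma sqint_sum x n : (forall k, sqint D (x k)) ->
  sqint D (fun t => \sum_(k < n) x k t).
Proof.
move=> sx; elim: n => [|n IH].
  split.
    by under eq_fun do rewrite big_ord0; exact: measurable_cst.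
  by under eq_fun do rewrite big_ord0 expr0n; exact: integrable0.
have := sqintD mD IH (sx n).
by congr sqint; apply/funext => t; rewrite big_ord_recr.
Qed.

Lemma intR_sum x n : (forall k, intR D (x k)) ->
  intR D (fun t => \sum_(k < n) x k t) /\
  RI D (fun t => \sum_(k < n) x k t) = \sum_(k < n) RI D (x k).
Proof.
move=> ix; elim: n => [|n [IH IE]].
  rewrite big_ord0 (_ : (fun t => _) = fun=> 0); last by apply/funext => t; rewrite big_ord0.
  by split; [exact: integrable0|rewrite Rintegral_cst// mul0r].
rewrite (_ : (fun t => _) = fun t => \sum_(k < n) x k t + x n t); last first.
  by apply/funext => t; rewrite big_ord_recr.
by split; [exact: intRD|rewrite RID// IE big_ord_recr].
Qed.

(** The Riesz-Fischer argument. The function G = sum_k 2^k x_k^2 has integral at most 2 B, hence is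
    finite almost everywhere; where it is finite the series converges, and by [sum_sqr_geometric]
    the square of its n-th tail is at most 2 G / 2^n. *)
Lemma L2_complete x B : (forall n, sqint D (x n)) ->
  (forall n, RI D (fun t => x n t ^+ 2) <= B / 4 ^+ n) ->
  exists2 y : R -> R, sqint D y &
    forall n, sqint D (fun t => y t - \sum_(k < n) x k t) /\
      RI D (fun t => (y t - \sum_(k < n) x k t) ^+ 2) <= (4 * B) / 2 ^+ n.
Proof.
move=> sx xB.
have B0 : 0 <= B.
  have := xB 0%N; rewrite expr0 divr1; apply: le_trans.
  by apply: Rintegral_ge0 => t _; exact: sqr_ge0.
pose g n t := \sum_(k < n) 2 ^+ k * x k t ^+ 2.
have g_nd t : {homo g ^~ t : n m / (n <= m)%N >-> n <= m}.
  apply/nondecreasing_seqP => n; rewrite /g big_ord_recr/= lerDl.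
  by apply: mulr_ge0; [exact: exprn_ge0|exact: sqr_ge0].
have g_ge0 n t : 0 <= g n t.
  by apply: sumr_ge0 => k _; apply: mulr_ge0; [exact: exprn_ge0|exact: sqr_ge0].
have ixk k : intR D (fun t => 2 ^+ k * x k t ^+ 2) by apply: intRZ => //; exact: (sx k).2.
have igE n : intR D (g n) /\ RI D (g n) <= 2 * B.
  have [i E] := @intR_sum (fun k t => 2 ^+ k * x k t ^+ 2) n ixk.
  split; first exact: i.
  rewrite /g E; apply: (@le_trans _ _ (2 * B - 2 * B / 2 ^+ n)); last first.
    by rewrite gerBl divr_ge0// ?mulr_ge0 ?exprn_ge0.
  elim: n {i E} => [|n IH]; first by rewrite big_ord0 expr0 divr1 subrr.
  rewrite big_ord_recr/= RIZ//; last exact: (sx n).2.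
  apply: le_trans (lerD IH (ler_wpM2l _ (xB n))) _; first exact: exprn_ge0.
  have -> : (4 : R) ^+ n = 2 ^+ n * 2 ^+ n.
    by rewrite -exprMn -[2 * 2]natrM.
  rewrite exprS le_eqVlt; apply/orP; left; apply/eqP.
  by field; rewrite expf_neq0.
have ig n := (igE n).1.
have gE n := (igE n).2.
pose G t := limn (fun n => (g n t)%:E).
have mgn n : measurable_fun D (fun t => (g n t)%:E).
  by apply/measurable_EFinP; exact: intR_meas (ig n).
have gcvg t : (fun n => (g n t)%:E) @ \oo --> G t.
  apply: ereal_nondecreasing_is_cvgn => n m nm; rewrite lee_fin; exact: g_nd.
have mG : measurable_fun D G.
  by apply: (emeasurable_fun_cvg (fun n t => (g n t)%:E)) => // t _; exact: gcvg.
have G0 t : (0 <= G t)%E.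
  apply: lime_ge; first by apply/cvg_ex; eexists; exact: gcvg.
  by apply: nearW => n; rewrite lee_fin.
have iG : (\int[@lebesgue_measure R]_(t in D) G t <= (2 * B)%:E)%E.
  rewrite /G monotone_convergence//; last 2 first.
  - by move=> n t _; rewrite lee_fin.
  - by move=> t _ n m nm; rewrite lee_fin; exact: g_nd.
  apply: lime_le.
    apply: ereal_nondecreasing_is_cvgn => n m nm; apply: ge0_le_integral => //.
    - by move=> t _; rewrite lee_fin.
    - exact: mgn.
    - exact: mgn.
    - by move=> t _; rewrite lee_fin; exact: g_nd.
  apply: nearW => n; rewrite (RI_fin (ig n) mD) lee_fin; exact: gE.
pose N := D `&` [set t | (G t < +oo)%E].
have mN : measurable N by exact: emeasurable_fun_infty_o.
have gG t n : N t -> g n t <= fine (G t).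
  move=> [_ Gt]; rewrite -lee_fin fineK ?ge0_fin_numE//.
  apply: lime_ge; first by apply/cvg_ex; eexists; exact: gcvg.
  exists n => // m /= nm; rewrite lee_fin; exact: g_nd.
(* Multiplied by the indicator of N, the partial sums converge at every point, so that their limit
   is measurable. *)
pose s n t := (\sum_(k < n) x k t) * \1_N t.
have ms n : measurable_fun D (s n).
  apply: measurable_funM; first exact: (sqint_sum n sx).1.
  exact: measurable_indic.
have s_tail t n m : N t ->
    (s (n + m)%N t - s n t) ^+ 2 <= 2 / 2 ^+ n * fine (G t).
  move=> Nt; rewrite /s indicE mem_set// !mulr1 big_split_ord/= addrAC subrr add0r.
  apply: le_trans (sum_sqr_geometric (fun k => x k t) n m) _.
  apply: ler_wpM2l; first by rewrite divr_ge0 ?exprn_ge0.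
  apply: le_trans (gG t (n + m)%N Nt).
  rewrite /g big_split_ord/= lerDr; exact: (g_ge0 n t).
have s_cvg t : cvgn (fun n => s n t).
  have [Nt|nNt] := pselect (N t); last first.
    rewrite (_ : (fun n => s n t) = fun=> 0); first exact: is_cvg_cst.
    by apply/funext => n; rewrite /s indicE memNset// mulr0.
  have E : (fun n => s n t) = series (fun k => x k t).
    by apply/funext => n; rewrite /s indicE mem_set// mulr1 /series/= big_mkord.
  rewrite E; apply: normed_cvg.
  (* Comparison series: |x_k| <= 2^-k + 2^k x_k^2, which is summable on N. *)
  have term0 k : 0 <= (2^-1) ^+ k + 2 ^+ k * x k t ^+ 2.
    apply: addr_ge0; first by apply: exprn_ge0; rewrite invr_ge0.
    by apply: mulr_ge0; [exact: exprn_ge0|exact: sqr_ge0].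
  have : cvgn (series (fun k => (2^-1) ^+ k + 2 ^+ k * x k t ^+ 2)).
    apply: nondecreasing_is_cvgn.
      apply/nondecreasing_seqP => n; rewrite /series/= big_nat_recr//= lerDl.
      exact: term0.
    exists (2 + fine (G t)) => _ [n _ <-]; rewrite /series/= big_split/= lerD//.
      have -> : \sum_(0 <= k < n) (2^-1 : R) ^+ k = 2 - 2 / 2 ^+ n.
        elim: n => [|n IH]; first by rewrite big_nil expr0 divr1 subrr.
        rewrite big_nat_recr//= IH exprVn exprS; field.
        by rewrite expf_neq0.
      by rewrite gerBl divr_ge0// exprn_ge0.
    by rewrite big_mkord; exact: gG.
  apply: series_le_cvg => k.
  - exact: normr_ge0.
  - exact: term0.
  - rewrite exprVn; set p : R := 2 ^+ k.
    have p0 : 0 < p by rewrite exprn_gt0.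
    rewrite -(ler_pM2l p0) mulrDr divff ?gt_eqF// mulrA -expr2 -exprMn.
    rewrite -[X in X * `|_|]gtr0_norm// -normrM -[X in _ <= 1 + X]real_normK ?num_real//.
    move: `|_| (normr_ge0 (p * x k t)) => z z0; nra.
pose y t := limn (fun n => s n t).
have my : measurable_fun D y.
  by apply: (measurable_fun_cvg ms) => t _; exact: s_cvg.
pose d n t := y t - \sum_(k < n) x k t.
have md n : measurable_fun D (d n).
  by apply: measurable_funB => //; exact: (sqint_sum n sx).1.
have dG n t : D t -> (((d n t) ^+ 2)%:E <= (2 / 2 ^+ n)%:E * G t)%E.
  move=> Dt.
  have c0 : (0 : R) < 2 / 2 ^+ n by rewrite divr_gt0// exprn_gt0.
  have [Nt|nNt] := pselect (N t); last first.
    rewrite (_ : G t = +oo%E) ?gt0_muley ?lte_fin// ?leey//.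
    apply/eqP; rewrite -leye_eq leNgt; apply/negP => Gt.
    by apply: nNt.
  have Gfin : G t \is a fin_num by rewrite ge0_fin_numE//; case: Nt.
  rewrite -(fineK Gfin) -EFinM lee_fin.
  have cv : (fun m => (s (n + m)%N t - s n t) ^+ 2) @ \oo --> (y t - s n t) ^+ 2.
    have c1 : (fun m => s (n + m)%N t) @ \oo --> y t.
      by apply: (cvg_comp (fun m => (n + m)%N) (fun m => s m t)); [exact: cvg_addnl|exact: s_cvg].
    have c2 : (fun m => s (n + m)%N t - s n t) @ \oo --> y t - s n t.
      by apply: cvgB => //; exact: cvg_cst.
    by rewrite expr2; under eq_fun do rewrite expr2; exact: cvgM.
  have -> : d n t = y t - s n t by rewrite /d /s indicE mem_set// mulr1.
  rewrite -(cvg_lim _ cv)//; apply: limr_le; first by apply/cvg_ex; eexists; exact: cv.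
  by apply: nearW => m; exact: s_tail.
have main n : sqint D (d n) /\ RI D (fun t => (d n t) ^+ 2) <= 4 * B / 2 ^+ n.
  have c0 : (0 : R) <= 2 / 2 ^+ n by rewrite divr_ge0// exprn_ge0.
  have md2 : measurable_fun D (fun t => (d n t) ^+ 2) by exact: measurable_funX.
  have le1 : (\int[@lebesgue_measure R]_(t in D) ((d n t) ^+ 2)%:E <= (4 * B / 2 ^+ n)%:E)%E.
    apply: (@le_trans _ _ (\int[@lebesgue_measure R]_(t in D) ((2 / 2 ^+ n)%:E * G t))%E).
      apply: ge0_le_integral.
      - exact: mD.
      - by move=> t _; rewrite lee_fin sqr_ge0.
      - exact/measurable_EFinP.
      - exact: measurable_funeM.
      - exact: dG.
    rewrite ge0_integralZl//.
    apply: le_trans (lee_wpmul2l _ iG) _; first by rewrite lee_fin.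
    rewrite -EFinM lee_fin le_eqVlt; apply/orP; left; apply/eqP; ring.
  have id : intR D (fun t => (d n t) ^+ 2).
    apply/integrableP; split; first exact/measurable_EFinP.
    apply: le_lt_trans (ltry (4 * B / 2 ^+ n)); apply: le_trans le1.
    rewrite le_eqVlt; apply/orP; left; apply/eqP.
    by apply: eq_integral => t _ /=; rewrite ger0_norm// sqr_ge0.
  by split; [split|rewrite -lee_fin -(RI_fin id mD)].
exists y; last exact: main.
have [] := (main 0%N).1; rewrite /d => _ i0; split; first exact: my.
by apply: eq_intR i0 => // t _; rewrite big_ord0 subr0.
Qed.

End Completeness.

(** * Solving (L - z) v = f on the half-line *)

Section HalfLine.
Context {R : realType}.
Implicit Types (f g : R -> R) (x y : R).

Notation Dp := (`](0:R), +oo[%classic).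

Lemma mDp : measurable Dp.
Proof. exact: measurable_itv. Qed.

(** An effect of the truncation in [green]. It turns linearity into an equality of functions on the
    whole line, as the abstract continuity method requires. *)
Lemma greenM_out f x : x <= 0 -> greenM f x = 0.
Proof.
move=> x0; rewrite /greenM (@eq_RI R _ _ (fun=> 0)) ?Rintegral_cst ?mul0r//.
move=> y _; rewrite /green /qT patchE memNset ?mulr0 ?mul0r//.
by rewrite in_Dp; apply/negP; rewrite -leNgt ge_min x0.
Qed.

Lemma greenM_D f g : sqint Dp f -> sqint Dp g ->
  greenM (f \+ g) = greenM f \+ greenM g.
Proof.
move=> sf sg; apply/funext => x /=.
have [x0|x0] := leP x 0; first by rewrite !greenM_out// addr0.
exact: greenMD.
Qed.

Lemma greenM_Z k f : sqint Dp f -> greenM (k \*o f) = k \*o greenM f.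
Proof.
move=> sf; apply/funext => x /=.
have [x0|x0] := leP x 0; first by rewrite !greenM_out// mulr0.
exact: greenMZ.
Qed.

Lemma sqint_aco f : measurable_fun Dp f -> sqint Dp (fun x => f x / aco x) ->
  sqint Dp f /\ RI Dp (fun x => f x ^+ 2) <= RI Dp (fun x => (f x / aco x) ^+ 2).
Proof.
move=> mf [mfa ia].
have le x : Dp x -> f x ^+ 2 <= (f x / aco x) ^+ 2.
  rewrite in_Dp => x0; have a0 := aco_gt0 x0; have a1 := aco_lt1 x0.
  rewrite expr_div_n ler_peMr ?sqr_ge0// invf_ge1 ?exprn_gt0//.
  by rewrite expr_le1 ?ltW.
have i : intR Dp (fun x => f x ^+ 2).
  apply: le_intR ia; [exact: mDp|exact: measurable_funX|].
  by move=> x Dx; rewrite ger0_norm ?sqr_ge0// le.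
by split; [split|apply: le_RI => //; exact: mDp].
Qed.

Lemma sqintM_bounded (D : set R) (M : R) f g : measurable D -> measurable_fun D g ->
  (forall x, D x -> `|g x| <= M) -> sqint D f -> sqint D (fun x => g x * f x).
Proof.
move=> mD mg gM [mf fi]; split; first exact: measurable_funM.
apply: (@eq_intR R _ (fun x => g x ^+ 2 * f x ^+ 2)) => //.
  by move=> x _; rewrite exprMn.
apply: (@intRM_bounded R _ (M ^+ 2)) => //; first exact: measurable_funX.
move=> x Dx; rewrite normrX lerXn2r// ?nnegrE//; last exact: gM.
exact: le_trans (gM x Dx).
Qed.

Lemma RI_eq0_ae (D : set R) f : measurable D -> intR D f -> (forall x, D x -> 0 <= f x) ->
  RI D f = 0 -> {ae @lebesgue_measure R, forall x, D x -> f x = 0}.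
Proof.
move=> mD fi f0 E.
have mf : measurable_fun D (EFin \o f) by apply/measurable_EFinP; exact: intR_meas fi.
have := (@ae_eq_integral_abs _ _ _ (@lebesgue_measure R) D mD _ mf).1.
have -> : (\int[@lebesgue_measure R]_(x in D) `|(EFin \o f) x| = 0)%E.
  transitivity (RI D f)%:E; last by rewrite E.
  rewrite -(RI_fin fi mD).
  by apply: eq_integral => x /set_mem Dx /=; rewrite ger0_norm// f0.
move=> /(_ erefl); apply: filterS => x /= h Dx.
by have := h Dx; case.
Qed.

Variables (zr zi beta kappa : R).
Hypothesis kappaE : kappa = 1 - zr + beta * zi.
Hypothesis kappa_gt0 : 0 < kappa.

Definition coer : R := Num.min 1 kappa.

Lemma coer_gt0 : 0 < coer.
Proof. by rewrite lt_min ltr01. Qed.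

(** The right-hand side is 2 (1 - s) + s ((1 - t) + t kappa), a convex combination of 2, 1 and
    kappa. The estimate is thus uniform along the segment from 0 to z. *)
Lemma coer_le (t s : R) : 0 <= t <= 1 -> 0 <= s <= 1 ->
  coer <= 2 - (1 + t * zr) * s + beta * (t * zi) * s.
Proof.
move=> /andP[t0 t1] /andP[s0 s1].
have h1 : coer <= 1 by rewrite ge_min lexx.
have h2 : coer <= kappa by rewrite ge_min lexx orbT.
rewrite (_ : _ + _ = 2 * (1 - s) + s * ((1 - t) + t * kappa)); last by rewrite kappaE; ring.
have : coer <= (1 - t) + t * kappa.
  have := ler_wpM2l t0 h2; have : (1 - t) * coer <= 1 - t.
    by rewrite ler_piMr// subr_ge0.
  by move: coer => c; lra.
move: ((1 - t) + t * kappa) => k hk.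
have := ler_wpM2l s0 hk; have : (1 - s) * coer <= 1 - s.
  by rewrite ler_piMr// subr_ge0.
have : 0 <= 1 - s by rewrite subr_ge0.
by move: coer => c; lra.
Qed.

Notation E := ((bool * R)%type -> R).

(* Complex functions are encoded as maps on [bool * R], [true] giving the real
   part. *)
Definition hl_S (x : E) := sqint Dp (fun t => x (true, t)) /\ sqint Dp (fun t => x (false, t)).
Definition hl_Q (x : E) := RI Dp (fun t => x (true, t) ^+ 2 + x (false, t) ^+ 2).
Definition hl_M (x : E) : E := fun p => greenM (fun t => x (p.1, t)) p.2.
(** z M in real coordinates. For v = M x one has L v = x, so x - t A x = (L - t z) v: the unknown of
    the continuity method is L v rather than v, and all operators are bounded. *)
Definition hl_A (x : E) : E := fun p =>
  if p.1 then zr * hl_M x (true, p.2) - zi * hl_M x (false, p.2)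
  else zr * hl_M x (false, p.2) + zi * hl_M x (true, p.2).

Lemma hl_int (x : E) : hl_S x -> intR Dp (fun t => x (true, t) ^+ 2 + x (false, t) ^+ 2).
Proof. by move=> [[_ i1] [_ i2]]; apply: intRD => //; exact: mDp. Qed.

Lemma hl_SD (x y : E) : hl_S x -> hl_S y -> hl_S (x \+ y).
Proof. by move=> [x1 x2] [y1 y2]; split; apply: sqintD => //; exact: mDp. Qed.

Lemma hl_SZ k (x : E) : hl_S x -> hl_S (k \*o x).
Proof. by move=> [x1 x2]; split; apply: sqintZ => //; exact: mDp. Qed.

Lemma hl_Q_ge0 (x : E) : 0 <= hl_Q x.
Proof. by apply: Rintegral_ge0 => t _; rewrite addr_ge0// sqr_ge0. Qed.

Lemma hl_QD (x y : E) : hl_S x -> hl_S y -> hl_Q (x \+ y) <= 2 * hl_Q x + 2 * hl_Q y.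
Proof.
move=> Sx Sy; have ix := hl_int Sx; have iy := hl_int Sy.
have ixy := hl_int (hl_SD Sx Sy).
rewrite /hl_Q -(RIZ 2 mDp ix) -(RIZ 2 mDp iy) -(RID mDp (intRZ 2 mDp ix) (intRZ 2 mDp iy)).
apply: le_RI; [exact: mDp|exact: ixy|by apply: intRD; [exact: mDp|exact: intRZ mDp ix|exact: intRZ mDp iy]|].
move=> t _ /=.
have := sqr_ge0 (x (true, t) - y (true, t)); have := sqr_ge0 (x (false, t) - y (false, t)).
move: (x (true, t)) (y (true, t)) (x (false, t)) (y (false, t)) => a b c d.
by rewrite !expr2; lra.
Qed.

Lemma hl_QZ k (x : E) : hl_S x -> hl_Q (k \*o x) = k ^+ 2 * hl_Q x.
Proof.
move=> Sx; rewrite /hl_Q -(RIZ _ mDp (hl_int Sx)).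
by apply: eq_RI => t _ /=; ring.
Qed.

Lemma hl_complete (x : nat -> E) B : (forall n, hl_S (x n)) ->
  (forall n, hl_Q (x n) <= B / 4 ^+ n) ->
  exists2 y : E, hl_S y &
    exists B', forall n, hl_Q (fun z => y z - \sum_(k < n) x k z) <= B' / 2 ^+ n.
Proof.
move=> Sx xB.
have [b1 b2] : (forall n, RI Dp (fun t => x n (true, t) ^+ 2) <= B / 4 ^+ n) /\
   (forall n, RI Dp (fun t => x n (false, t) ^+ 2) <= B / 4 ^+ n).
  split => n; apply: le_trans (xB n).
    apply: (le_RI mDp (Sx n).1.2 (hl_int (Sx n))) => t _.
    by rewrite lerDl sqr_ge0.
  apply: (le_RI mDp (Sx n).2.2 (hl_int (Sx n))) => t _.
  by rewrite lerDr sqr_ge0.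
have [y1 sy1 h1] := L2_complete mDp (fun n => (Sx n).1) b1.
have [y2 sy2 h2] := L2_complete mDp (fun n => (Sx n).2) b2.
exists (fun p => if p.1 then y1 p.2 else y2 p.2) => //.
exists (8 * B) => n.
have [[_ i1] l1] := h1 n; have [[_ i2] l2] := h2 n.
rewrite /hl_Q /= (RID mDp i1 i2).
apply: le_trans (lerD l1 l2) _; rewrite -mulrDl.
by rewrite le_eqVlt; apply/orP; left; apply/eqP; ring.
Qed.

Lemma greenM_sqint f : sqint Dp f ->
  sqint Dp (greenM f) /\ RI Dp (fun x => greenM f x ^+ 2) <= RI Dp (fun x => f x ^+ 2).
Proof.
move=> sf; have [sM leM] := greenM_bound sf.
have [s1 le1] := sqint_aco (greenM_meas sf) sM.
by split => //; exact: le_trans leM.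
Qed.

Lemma hl_MS (x : E) : hl_S x -> hl_S (hl_M x).
Proof.
by move=> [s1 s2]; split; [have [] := greenM_sqint s1|have [] := greenM_sqint s2].
Qed.

Lemma hl_MQ (x : E) : hl_S x -> hl_Q (hl_M x) <= hl_Q x.
Proof.
move=> Sx; have [[_ i1] [_ i2]] := Sx; have [[_ j1] [_ j2]] := hl_MS Sx.
rewrite /hl_Q (RID mDp i1 i2) (RID mDp j1 j2).
by apply: lerD; [have [_] := greenM_sqint Sx.1|have [_] := greenM_sqint Sx.2].
Qed.

Lemma hl_AS (x : E) : hl_S x -> hl_S (hl_A x).
Proof.
move=> Sx; have [s1 s2] := hl_MS Sx; split.
  have -> : (fun t => hl_A x (true, t)) =
      fun t => zr * hl_M x (true, t) + (- zi) * hl_M x (false, t).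
    by apply/funext => t; rewrite mulNr.
  by apply: sqintD; [exact: mDp|apply: sqintZ; [exact: mDp|]..].
by apply: sqintD; [exact: mDp|apply: sqintZ; [exact: mDp|]..].
Qed.

Lemma hl_MD (x y : E) : hl_S x -> hl_S y -> hl_M (x \+ y) = hl_M x \+ hl_M y.
Proof.
move=> [x1 x2] [y1 y2]; apply/funext => -[[] t] /=; rewrite /hl_M /=.
  by rewrite (greenM_D x1 y1).
by rewrite (greenM_D x2 y2).
Qed.

Lemma hl_MZ k (x : E) : hl_S x -> hl_M (k \*o x) = k \*o hl_M x.
Proof.
move=> [x1 x2]; apply/funext => -[[] t] /=; rewrite /hl_M /=.
  by rewrite (greenM_Z k x1).
by rewrite (greenM_Z k x2).
Qed.

Lemma hl_AD (x y : E) : hl_S x -> hl_S y -> hl_A (x \+ y) = hl_A x \+ hl_A y.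
Proof.
by move=> Sx Sy; apply/funext => -[[] t] /=; rewrite /hl_A /= hl_MD//=; ring.
Qed.

Lemma hl_AZ k (x : E) : hl_S x -> hl_A (k \*o x) = k \*o hl_A x.
Proof.
by move=> Sx; apply/funext => -[[] t] /=; rewrite /hl_A /= hl_MZ//=; ring.
Qed.

Lemma hl_AQE (x : E) : hl_S x -> hl_Q (hl_A x) = (zr ^+ 2 + zi ^+ 2) * hl_Q (hl_M x).
Proof.
move=> Sx; rewrite /hl_Q -(RIZ _ mDp (hl_int (hl_MS Sx))).
by apply: eq_RI => t _; rewrite /hl_A /=; ring.
Qed.

Lemma hl_QA (x : E) : hl_S x -> hl_Q (hl_A x) <= (zr ^+ 2 + zi ^+ 2) * hl_Q x.
Proof.
by move=> Sx; rewrite hl_AQE// ler_wpM2l ?addr_ge0 ?sqr_ge0// hl_MQ.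
Qed.

(** The second derivative of [greenM f], see [prim_greenM']. *)
Definition hl_w f x := pot x * greenM f x - f x / aco x.

Lemma hl_eq f x : 0 < x ->
  - (aco x * hl_w f x) + (2 - aco x) / aco x * greenM f x = f x.
Proof.
move=> x0; rewrite /hl_w /pot; field.
by rewrite gt_eqF// aco_gt0.
Qed.

Definition hl_C : R := 2 + 2 * (zr ^+ 2 + zi ^+ 2) * ((1 + beta ^+ 2) / coer ^+ 2).

(** The energy estimate for v = M x bounds M x by x - t A x, and x = (x - t A x) + t A x with |A x|
    = |z| |M x| then recovers x itself; [hl_C] collects the constants. *)
Lemma hl_apriori t (x : E) : 0 <= t <= 1 -> hl_S x ->
  hl_Q x <= hl_C * hl_Q (x \- (t \*o hl_A x)).
Proof.
move=> t01 Sx.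
have Sh : hl_S (x \- (t \*o hl_A x)).
  have -> : x \- (t \*o hl_A x) = x \+ ((- t) \*o hl_A x).
    by apply/funext => p /=; rewrite mulNr.
  by apply: hl_SD => //; apply: hl_SZ; exact: hl_AS.
have [s1 s2] := Sx; have [h1 h2] := Sh.
have [t0 t1] := andP t01.
have en := energy_estimate coer_gt0 (fun s s01 => coer_le t01 s01)
  (prim_greenM s1) (prim_greenM' s1) (prim_greenM s2) (prim_greenM' s2)
  (f1 := fun u => (x \- (t \*o hl_A x)) (true, u))
  (f2 := fun u => (x \- (t \*o hl_A x)) (false, u)).
have e1 u : 0 < u -> (x \- (t \*o hl_A x)) (true, u) =
    - (aco u * (pot u * greenM (fun y => x (true, y)) u - x (true, u) / aco u)) +
    (2 - aco u) / aco u * greenM (fun y => x (true, y)) u -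
    (t * zr * greenM (fun y => x (true, y)) u - t * zi * greenM (fun y => x (false, y)) u).
  move=> u0; rewrite -/(hl_w (fun y => x (true, y)) u) hl_eq//= /hl_A /hl_M /=; ring.
have e2 u : 0 < u -> (x \- (t \*o hl_A x)) (false, u) =
    - (aco u * (pot u * greenM (fun y => x (false, y)) u - x (false, u) / aco u)) +
    (2 - aco u) / aco u * greenM (fun y => x (false, y)) u -
    (t * zr * greenM (fun y => x (false, y)) u + t * zi * greenM (fun y => x (true, y)) u).
  move=> u0; rewrite -/(hl_w (fun y => x (false, y)) u) hl_eq//= /hl_A /hl_M /=; ring.
have {en} := en e1 e2 (greenM_bound s1).1 (greenM_bound s2).1 h1 h2.
rewrite -/(hl_Q (x \- (t \*o hl_A x))) => en.
have leM : hl_Q (hl_M x) <= (1 + beta ^+ 2) / coer ^+ 2 * hl_Q (x \- (t \*o hl_A x)).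
  rewrite -mulrA mulrCA ler_pdivlMl ?exprn_gt0 ?coer_gt0//.
  apply: le_trans en; rewrite ler_wpM2l ?sqr_ge0//.
  have [[_ m1] l1] := sqint_aco (greenM_meas s1) (greenM_bound s1).1.
  have [[_ m2] l2] := sqint_aco (greenM_meas s2) (greenM_bound s2).1.
  rewrite /hl_Q (RID mDp m1 m2) (RID mDp (greenM_bound s1).1.2 (greenM_bound s2).1.2).
  exact: (lerD l1 l2).
have -> : hl_Q x = hl_Q ((x \- (t \*o hl_A x)) \+ (t \*o hl_A x)).
  by congr hl_Q; apply/funext => p /=; rewrite subrK.
have SA : hl_S (t \*o hl_A x) by apply: hl_SZ; exact: hl_AS.
apply: le_trans (hl_QD Sh SA) _.
rewrite hl_QZ ?hl_AQE//; last exact: hl_AS.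
have a1 : t ^+ 2 * ((zr ^+ 2 + zi ^+ 2) * hl_Q (hl_M x)) <= (zr ^+ 2 + zi ^+ 2) * hl_Q (hl_M x).
  by rewrite ler_piMl ?expr_le1// mulr_ge0 ?hl_Q_ge0// addr_ge0// sqr_ge0.
have Z0 : 0 <= zr ^+ 2 + zi ^+ 2 by rewrite addr_ge0// sqr_ge0.
have a2 := ler_wpM2l Z0 leM.
move: a1 a2; rewrite /hl_C.
move: (hl_Q (hl_M x)) (hl_Q _) ((1 + beta ^+ 2) / _) (zr ^+ 2 + zi ^+ 2) (t ^+ 2).
by clear; move=> m q b Z t2; lra.
Qed.

Lemma halfline_solve f1 f2 : sqint Dp f1 -> sqint Dp f2 ->
  exists v1 W1 w1 v2 W2 w2 : R -> R,
    [/\ [/\ prim v1 W1, prim W1 w1, prim v2 W2 & prim W2 w2],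
        [/\ sqint Dp (fun x => v1 x / aco x), sqint Dp (fun x => v2 x / aco x),
            sqint Dp (fun x => aco x * w1 x) & sqint Dp (fun x => aco x * w2 x)] &
        {ae @lebesgue_measure R, forall x, Dp x ->
          - (aco x * w1 x) + (2 - aco x) / aco x * v1 x - (zr * v1 x - zi * v2 x) = f1 x /\
          - (aco x * w2 x) + (2 - aco x) / aco x * v2 x - (zr * v2 x + zi * v1 x) = f2 x}].
Proof.
move=> sf1 sf2.
pose f (p : bool * R) := if p.1 then f1 p.2 else f2 p.2.
have K0 : 0 <= zr ^+ 2 + zi ^+ 2 by rewrite addr_ge0// sqr_ge0.
have C0 : 0 <= hl_C.
  rewrite addr_ge0// mulr_ge0//; first by rewrite mulr_ge0.
  by rewrite divr_ge0 ?sqr_ge0// addr_ge0// sqr_ge0.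
have [x Sx Qx] := continuity_method hl_SD hl_SZ hl_Q_ge0 hl_QD hl_QZ hl_complete
  hl_AS hl_AD hl_AZ K0 hl_QA C0 hl_apriori (f := f) (conj sf1 sf2).
have [s1 s2] := Sx.
pose x1 t := x (true, t); pose x2 t := x (false, t).
(* For v = greenM g, aco v'' = (2 - aco) v / aco - g, and v / aco is controlled by
   [greenM_bound]. *)
have acoM_sq g : sqint Dp g -> sqint Dp (fun x => aco x * hl_w g x).
  move=> sg; have [sM _] := greenM_bound sg.
  have : sqint Dp (fun x => (2 - aco x) * (greenM g x / aco x) + (-1) * g x).
    apply: sqintD; [exact: mDp| |by apply: sqintZ; [exact: mDp|]].
    apply: (@sqintM_bounded _ 2) => //.
      apply: cont_meas; apply: contD; first exact: cont_cst.
      by apply: contN; exact: aco_cont.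
    move=> t; rewrite in_Dp => t0; have := aco_gt0 t0; have := aco_lt1 t0.
    by move=> a1 a0; rewrite ger0_norm; [lra|lra].
  move=> [m i].
  have E t : Dp t -> (2 - aco t) * (greenM g t / aco t) + -1 * g t = aco t * hl_w g t.
    rewrite in_Dp => t0; rewrite /hl_w /pot; field.
    by rewrite gt_eqF// aco_gt0.
  split; first by apply: eq_measurable_fun m => t /set_mem; exact: E.
  apply: eq_intR i; first exact: mDp.
  by move=> t Dt; rewrite E.
exists (greenM x1), (greenM' x1), (hl_w x1), (greenM x2), (greenM' x2), (hl_w x2).
split.
- by split; [exact: prim_greenM|exact: prim_greenM'|exact: prim_greenM|exact: prim_greenM'].
- split; [exact: (greenM_bound s1).1|exact: (greenM_bound s2).1|exact: acoM_sq|exact: acoM_sq].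
have Sr : hl_S (x \- hl_A x \- f).
  have -> : x \- hl_A x \- f = (x \+ ((-1) \*o hl_A x)) \+ ((-1) \*o f).
    by apply/funext => p /=; rewrite !mulN1r.
  by apply: hl_SD; [apply: hl_SD => //; apply: hl_SZ; exact: hl_AS|exact: hl_SZ].
have := RI_eq0_ae mDp (hl_int Sr) _ Qx.
have p0 t : Dp t -> 0 <= (x \- hl_A x \- f) (true, t) ^+ 2 + (x \- hl_A x \- f) (false, t) ^+ 2.
  by move=> _; rewrite addr_ge0// sqr_ge0.
move=> /(_ p0); apply: ae_impl => t h Dt.
have t0 : 0 < t by rewrite -in_Dp.
move: (h Dt) => /eqP; rewrite paddr_eq0 ?sqr_ge0// !sqrf_eq0 /= /f /=.
rewrite !subr_eq0 => /andP[/eqP <- /eqP <-].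
by rewrite !hl_eq.
Qed.

End HalfLine.

(** * Bump functions and the du Bois-Reymond lemma *)

Section Smooth.
Context {R : realType}.
Implicit Types (f g : R -> R) (x : R).

(** Derivatives are given by witnesses instead of iterates of [derive1], so that stability under
    sums, products and affine substitutions is a plain induction. *)
Fixpoint nder n f : Prop :=
  if n is m.+1 then (exists2 g, (forall x, is_derive x 1 f (g x)) & nder m g) else True.

Definition smooth f := forall n, nder n f.

Lemma derive1_unique f g : (forall x, is_derive x 1 f (g x)) -> derive1 f = g.
Proof. by move=> fg; apply/funext => x; rewrite derive1E; have [_ ->] := fg x. Qed.

(** The link with the smoothness clause of [test_function]. *)
Lemma smoothP f : smooth f <-> forall n x, derivable (derive1n n f) x 1.
Proof.
split.
  move=> sf n; have := sf n.+1; elim: n f {sf} => [|n IH] f.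
    by case=> g fg _ x; have [] := fg x.
  case=> g fg /IH h x.
  by rewrite /derive1n iterSr -/(derive1n n (derive1 f)) (derive1_unique fg).
move=> H n; elim: n f H => [//|n IH] f H.
exists (derive1 f); last first.
  by apply: IH => k x; have := H k.+1 x; rewrite /derive1n iterSr.
move=> x; rewrite derive1E; apply: derivableP; exact: (H 0%N).
Qed.

Lemma smooth_family (P : (R -> R) -> Prop) :
  (forall f, P f -> exists2 g, P g & forall x, is_derive x 1 f (g x)) ->
  forall f, P f -> smooth f.
Proof.
move=> H f Pf n; elim: n f Pf => [//|n IH] f /H[g Pg fg].
by exists g => //; exact: IH.
Qed.

Lemma smooth_derive f : smooth f -> exists2 g, smooth g & forall x, is_derive x 1 f (g x).
Proof.
move=> sf; have [g fg _] := sf 1%N; exists g => // n.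
have [g' fg' ng'] := sf n.+1.
by rewrite -(derive1_unique fg) (derive1_unique fg').
Qed.

Lemma smooth_cont f : smooth f -> continuous f.
Proof. by move=> /smooth_derive[g _ fg] x; exact: isd_cont (fg x). Qed.

Lemma nderW n f : nder n.+1 f -> nder n f.
Proof. by elim: n f => [//|n IH] f [g fg ng]; exists g => //; exact: IH. Qed.

Lemma nderD n f g : nder n f -> nder n g -> nder n (fun x => f x + g x).
Proof.
elim: n f g => [//|n IH] f g [f' ff' nf'] [g' gg' ng'].
exists (fun x => f' x + g' x); last exact: IH.
by move=> x; exact: isdD.
Qed.

Lemma nderM n f g : nder n f -> nder n g -> nder n (fun x => f x * g x).
Proof.
elim: n f g => [//|n IH] f g nf ng.
have [f' ff' nf'] := nf; have [g' gg' ng'] := ng.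
exists (fun x => f' x * g x + f x * g' x).
  by move=> x; exact: isdM.
by apply: nderD; apply: IH => //; exact: nderW.
Qed.

Lemma nderZ n k f : nder n f -> nder n (fun x => k * f x).
Proof.
elim: n f => [//|n IH] f [f' ff' nf'].
exists (fun x => k * f' x); last exact: IH.
by move=> x; exact: isdZ.
Qed.

Lemma smoothD f g : smooth f -> smooth g -> smooth (fun x => f x + g x).
Proof. by move=> sf sg n; exact: nderD. Qed.

Lemma smoothM f g : smooth f -> smooth g -> smooth (fun x => f x * g x).
Proof. by move=> sf sg n; exact: nderM. Qed.

Lemma smoothZ k f : smooth f -> smooth (fun x => k * f x).
Proof. by move=> sf n; exact: nderZ. Qed.

Lemma isd_affine f (k c x a : R) : is_derive (k * x + c) 1 f a ->
  is_derive x 1 (fun t => f (k * t + c)) (k * a).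
Proof.
move=> fg; have := isdD (isdZ k (is_derive_id x 1)) (isd_cst x c).
rewrite mulr1 addr0 => h.
have := isd_comp (f := fun t => k * t + c) fg h.
by rewrite mulrC.
Qed.

Lemma smooth_affine f k c : smooth f -> smooth (fun t => f (k * t + c)).
Proof.
move=> sf n; elim: n f sf => [//|n IH] f /smooth_derive[g sg fg].
exists (fun t => k * g (k * t + c)); last by apply: nderZ; exact: IH.
by move=> x; apply: isd_affine; exact: fg.
Qed.

Lemma poly_bound (p : {poly R}) :
  exists C n, 0 <= C /\ forall y, 0 <= y -> `|p.[y]| <= C * (1 + y) ^+ n.
Proof.
elim/poly_ind: p => [|p c [C [n [C0 IH]]]].
  by exists 0, 0%N; split => // y _; rewrite horner0 normr0 mul0r.
exists (C + `|c|), n.+1; split; first by rewrite addr_ge0.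
move=> y y0; rewrite hornerD hornerM hornerX hornerC.
apply: le_trans (ler_normD _ _) _; rewrite mulrDl; apply: lerD.
  rewrite normrM exprSr mulrA; apply: ler_pM => //; first exact: IH.
  by rewrite ger0_norm// lerDr.
by rewrite ler_peMr// exprn_ege1// lerDl.
Qed.

Lemma pow_expR_bound n : exists2 C, 0 <= C & forall t : R, 0 <= t -> t ^+ n <= C * expR t.
Proof.
exists (n`!%:R); first by rewrite ler0n.
case: n => [|n] t t0; first by rewrite expr0 fact0 mul1r -expR0 ler_expR.
have := expR_ge1Dxn n t0; rewrite -lerBrDl.
have f0 : 0 < (n.+1)`!%:R :> R by rewrite ltr0n fact_gt0.
rewrite ler_pdivrMr// => h; apply: le_trans h _.
by rewrite mulrC ler_wpM2l ?ler0n// lerBlDr lerDl.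
Qed.

(* p(1/x) e^(-1/x) extended by 0; this family is stable under derivation. *)
Definition flat (p : {poly R}) x : R := if 0 < x then p.[x^-1] * expR (- x^-1) else 0.

(** With y = 1 / x, one has |p(y)| y <= C (1 + y)^(n + 1) <= C K e^(1 + y), and e^(- y) leaves the
    constant C K e. *)
Lemma flat_bound p : exists2 C, 0 <= C & forall x, `|flat p x| <= C * `|x|.
Proof.
have [C [n [C0 hp]]] := poly_bound p.
have [K K0 hK] := pow_expR_bound n.+1.
exists (C * K * expR 1); first by rewrite !mulr_ge0// expR_ge0.
move=> x; rewrite /flat; case: ifPn => [x0|_]; last first.
  by rewrite normr0 !mulr_ge0// expR_ge0.
set y := x^-1; have y0 : 0 < y by rewrite invr_gt0.
rewrite (gtr0_norm x0) -[x]invrK -/y ler_pdivlMr// normrM (gtr0_norm (expR_gt0 _)).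
have h1 := hp y (ltW y0).
have h2 := hK (1 + y) (ltac:(by rewrite addr_ge0// ltW)).
have e0 := expR_gt0 (- y).
apply: (@le_trans _ _ (C * (1 + y) ^+ n.+1 * expR (- y))).
  rewrite [leLHS]mulrAC; apply: ler_wpM2r; first exact: ltW.
  rewrite exprSr mulrA; apply: ler_pM => //; first exact: ltW.
  by rewrite lerDr.
rewrite -[leLHS]mulrA -[leRHS]mulrA; apply: ler_wpM2l => //.
apply: (@le_trans _ _ (K * expR (1 + y) * expR (- y))).
  by apply: ler_wpM2r => //; exact: ltW.
by rewrite -mulrA -expRD addrK.
Qed.

Lemma flat_cont0 p : {for 0, continuous (flat p)}.
Proof.
have [C C0 hC] := flat_bound p.
have f0 : flat p 0 = 0 by rewrite /flat ltxx.
rewrite /prop_for /continuous_at f0; apply/cvgr0Pnorm_lt => e e0.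
have C1 : 0 < C + 1 by rewrite ltr_pwDr.
near=> x.
apply: le_lt_trans (hC x) _.
apply: (@le_lt_trans _ _ ((C + 1) * `|x|)); first by rewrite ler_wpM2r// lerDl.
rewrite -ltr_pdivlMl//.
near: x; exists ((C + 1)^-1 * e); first by rewrite /= mulr_gt0// invr_gt0.
by move=> t /=; rewrite sub0r normrN.
Unshelve. all: by end_near. Qed.

(** For x > 0 the derivative of p(1/x) e^(-1/x) is x^-2 (p - p')(1/x) e^(-1/x). At 0 the difference
    quotient of [flat p] is [flat ('X * p)], again in the family and therefore continuous at 0. *)
Lemma flat_derive p x : is_derive x 1 (flat p) (flat ('X^2 * (p - p^`())) x).
Proof.
have [x0|x0|<-] := ltgtP 0 x.
- have xn : x != 0 by rewrite gt_eqF.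
  have d1 := isdV (f := id) xn (is_derive_id x 1).
  have d2 := isd_comp (f := fun t => t^-1) (is_derive_poly p x^-1) d1.
  have d3 := isd_comp (f := fun t => - t^-1) (is_derive_expR (- x^-1)) (isdN d1).
  have d4 := isdM d2 d3.
  rewrite {2}/flat x0.
  have : is_derive x 1 (fun t => p.[t^-1] * expR (- t^-1))
      (('X^2 * (p - p^`())).[x^-1] * expR (- x^-1)).
    apply: isd_eq d4 _; rewrite /= hornerM hornerXn hornerD hornerN; field.
    exact: xn.
  apply: isd_near; near=> t.
  by rewrite /flat; have -> : 0 < t by near: t; exact: lt_nbhsr.
- have := isd_cst x (0 : R); rewrite {2}/flat ltNge (ltW x0)/=.
  apply: isd_near; near=> t.
  by rewrite /flat ltNge; have -> : t <= 0 by apply: ltW; near: t; exact: lt_nbhsl.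
- apply/is_derive1_caratheodory; exists (flat ('X * p)); split.
  + move=> z; rewrite subr0 [flat p 0]/flat ltxx subr0 /flat.
    case: ifPn => z0; last by rewrite mul0r.
    by rewrite hornerM hornerX; field; rewrite gt_eqF.
  + exact: flat_cont0.
  + by rewrite /flat ltxx.
Unshelve. all: by end_near. Qed.

Lemma flat_smooth p : smooth (flat p).
Proof.
apply: (@smooth_family (fun f => exists q, f = flat q)); last by exists p.
move=> _ [q ->]; exists (flat ('X^2 * (q - q^`()))); first by eexists.
by move=> x; exact: flat_derive.
Qed.

Definition bump x : R := flat 1 (1 * x + 1) * flat 1 ((-1) * x + 1).

Lemma bump_smooth : smooth bump.
Proof. by apply: smoothM; apply: smooth_affine; exact: flat_smooth. Qed.

Lemma bump_ge0 x : 0 <= bump x.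
Proof.
rewrite /bump /flat; apply: mulr_ge0; case: ifP => // _;
  by rewrite hornerC mul1r expR_ge0.
Qed.

Lemma bump_gt0 x : -1 < x < 1 -> 0 < bump x.
Proof.
move=> /andP[x1 x2]; rewrite /bump /flat.
rewrite (_ : 0 < 1 * x + 1); last by lra.
rewrite (_ : 0 < -1 * x + 1); last by lra.
by rewrite !hornerC !mul1r mulr_gt0// expR_gt0.
Qed.

Lemma bump_out x : 1 <= `|x| -> bump x = 0.
Proof.
rewrite ler_normr => /orP[h|h]; rewrite /bump /flat.
  by rewrite [X in _ * X]ifF ?mulr0//; apply/negbTE; rewrite -leNgt; lra.
by rewrite ifF ?mul0r//; apply/negbTE; rewrite -leNgt; lra.
Qed.

End Smooth.

(** * Primitives of the bump and approximate identities *)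

Section BumpPrimitive.
Context {R : realType}.
Implicit Types (f g h : R -> R) (x : R).

Lemma RI_supp (D E : set R) f : E `<=` D -> (forall x, D x -> ~ E x -> f x = 0) ->
  RI D f = RI E f.
Proof.
move=> ED f0; rewrite [LHS]Rintegral_mkcond [RHS]Rintegral_mkcond.
apply: eq_RI => x _; rewrite !patchE.
have [/set_mem Ex|/negP Ex] := boolP (x \in E).
  by rewrite mem_set//; exact: ED.
have [/set_mem Dx|//] := boolP (x \in D).
by apply: f0 => //; rewrite in_setE in Ex.
Qed.

Lemma intR_supp (D E : set R) f : measurable D -> measurable E -> E `<=` D ->
  (forall x, D x -> ~ E x -> f x = 0) -> intR E f -> intR D f.
Proof.
move=> mD mE ED f0 /(intR_patch _ mE) fi; apply/(intR_patch _ mD).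
apply: eq_intR fi => // x _; rewrite !patchE.
have [/set_mem Ex|/negP Ex] := boolP (x \in E).
  by rewrite mem_set//; exact: ED.
have [/set_mem Dx|//] := boolP (x \in D).
by rewrite f0//; rewrite in_setE in Ex.
Qed.

Lemma bump_cont : continuous (@bump R).
Proof. exact/smooth_cont/bump_smooth. Qed.

Lemma antiderivative_cs f : continuous f -> (forall x, 1 <= `|x| -> f x = 0) ->
  exists F, (forall x, is_derive x 1 F (f x)) /\ (forall x, x <= -1 -> F x = 0).
Proof.
move=> cf f0.
have fi : intR setT f.
  apply: (@intR_supp setT `[-1, 1]) => //.
    move=> x _ h; apply: f0; rewrite leNgt; apply/negP; rewrite ltr_norml => /andP[h1 h2].
    by apply: h; rewrite /= in_itv/= !ltW.
  apply: continuous_compact_integrable; first exact: segment_compact.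
  exact: continuous_subspaceT.
exists (fun x => RI `]-oo, x] f); split => x.
  have x1 : x < x + 1 by rewrite ltrDl.
  have hx : (-oo%O < BRight x)%E by exact: ltNyr.
  have [d e] := @continuous_FTC1 R f -oo%O x (x + 1) x1
    (intRS measurableT (measurable_itv _) (@subsetT _ _) fi) hx (cf x).
  by have := derivableP d; rewrite -derive1E e.
move=> x1; transitivity (RI `]-oo, x] (fun=> 0 : R)).
  apply: eq_RI => y /=; rewrite in_itv/= => yx; apply: f0.
  by rewrite ler_normr; apply/orP; right; rewrite lerNr; exact: le_trans x1.
by rewrite Rintegral_cst// mul0r.
Qed.

Lemma derive0_const f (a b : R) : a <= b -> (forall x, a <= x <= b -> is_derive x 1 f 0) ->
  f a = f b.
Proof.
move=> ab f0.
have [c _] := @MVT_segment R f (fun=> 0) a b ab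
  (fun x hx => f0 x (ltac:(by move: hx; rewrite in_itv/= => /andP[h1 h2]; rewrite !ltW)))
  (ltac:(by apply: continuous_subspace_itv => z; rewrite in_itv/= => hz; exact: isd_cont (f0 z hz))).
by rewrite mul0r => /eqP; rewrite subr_eq0 => /eqP.
Qed.

(** S is a smooth step and P, equal to x S minus a primitive of x * bump, a smooth ramp: right of
    the support P is affine, with slope the integral I0 of the bump. *)
Lemma bump_primitives : exists S P : R -> R, exists I0 k : R,
  [/\ 0 < I0, (forall x, is_derive x 1 S (bump x)) /\ (forall x, is_derive x 1 P (S x)),
      (forall x, x <= -1 -> S x = 0), (forall x, 1 <= x -> S x = I0) &
      (forall x, x <= -1 -> P x = 0) /\ (forall x, 1 <= x -> P x = I0 * x + k)].
Proof.
have [S [dS S0]] := antiderivative_cs bump_cont (@bump_out R).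
have cb : continuous (fun x : R => x * bump x).
  by move=> x; apply: cvgM; [exact: cvg_id|exact: bump_cont].
have cb0 (x : R) : 1 <= `|x| -> x * bump x = 0 by move=> h; rewrite bump_out// mulr0.
have [T [dT T0]] := antiderivative_cs cb cb0.
have S1 x : 1 <= x -> S x = S 1.
  move=> x1; symmetry; apply: derive0_const => // t /andP[t1 _].
  apply: isd_eq (dS t) _; rewrite bump_out// ler_normr t1//.
have T1 x : 1 <= x -> T x = T 1.
  move=> x1; symmetry; apply: derive0_const => // t /andP[t1 _].
  by apply: isd_eq (dT t) _; rewrite bump_out ?mulr0// ler_normr t1.
exists S, (fun x => x * S x - T x), (S 1), (- T 1); split => //.
- have [c] := @MVT R S (@bump R) (-1) 1 (ltac:(by lra)) (fun x _ => dS x)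
    (ltac:(by apply: continuous_subspaceT => z; exact: isd_cont (dS z))).
  rewrite (S0 (-1))// subr0 => hc ->; apply: mulr_gt0; last by lra.
  by apply: bump_gt0; move: hc; rewrite in_itv.
- split => // x.
  have := isdB (isdM (is_derive_id x 1) (dS x)) (dT x).
  by move/isd_eq; apply; ring.
- split => x h; first by rewrite S0// T0// mulr0 subr0.
  by rewrite S1// T1// mulrC.
Qed.

Lemma bump_le : exists2 M, 0 <= M & forall x, @bump R x <= M.
Proof.
have [c _ cM] := @EVT_max R (@bump R) (-1) 1 (ltac:(by lra))
  (ltac:(by apply: continuous_subspaceT; exact: bump_cont)).
exists (bump c); first exact: bump_ge0.
move=> x; have [h|h] := leP 1 `|x|; first by rewrite bump_out// bump_ge0.
by apply: cM; rewrite in_itv/=; move: h; rewrite ltr_norml => /andP[h1 h2]; rewrite !ltW.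
Qed.

Definition bump_at (p e x : R) := @bump R (e^-1 * x - e^-1 * p).

Lemma bump_at_out p e x : 0 < e -> ~ `[p - e, p + e]%classic x -> bump_at p e x = 0.
Proof.
move=> e0 h; apply: bump_out; rewrite -mulrBr normrM ger0_norm ?invr_ge0 ?(ltW e0)//.
rewrite ler_pdivlMl// mulr1 leNgt; apply/negP; rewrite ltr_norml => /andP[h1 h2].
apply: h; rewrite /= in_itv/=; apply/andP; split; lra.
Qed.

Lemma bump_at_cont p e : continuous (bump_at p e).
Proof.
have h : smooth (bump_at p e) by exact: smooth_affine (@bump_smooth R).
exact: smooth_cont.
Qed.

Lemma RI_bump_at (S : R -> R) I0 p e : 0 < e -> 0 < p - e ->
  (forall x, is_derive x 1 S (bump x)) ->
  (forall x, x <= -1 -> S x = 0) -> (forall x, 1 <= x -> S x = I0) ->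
  RI `[p - e, p + e] (bump_at p e) = e * I0.
Proof.
move=> e0 pe dS S0 S1.
have en : e != 0 by rewrite gt_eqF.
have h : prim (fun x => e * S (e^-1 * x - e^-1 * p)) (bump_at p e).
  apply: prim_derive => [x _|x _]; first exact: bump_at_cont.
  have := isdZ e (isd_affine (f := S) (dS (e^-1 * x - e^-1 * p))).
  by move/isd_eq; apply; rewrite mulrA divff// mul1r.
have pp : p - e <= p + e by lra.
have [_ <-] := h _ _ pe pp.
rewrite S1; last first.
  rewrite -mulrBr ler_pdivlMl//; lra.
rewrite S0 ?mulr0 ?subr0//.
rewrite -mulrBr ler_pdivrMl//; lra.
Qed.

(* At a Lebesgue point the rescaled bumps act as approximate identities. *)
Definition bump_pt f p := forall I0 S, (forall x, is_derive x 1 S (bump x)) ->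
  (forall x, x <= -1 -> S x = 0) -> (forall x, 1 <= x -> S x = I0) ->
  forall eta, 0 < eta -> exists2 d, 0 < d & forall e, 0 < e -> e < d ->
    `|RI `](0:R), +oo[ (fun x => f x * bump_at p e x) - e * I0 * f p| <= eta * e.

(** The error is the integral of bump_at * (f - f p), at most M + 1 times the integral of |f - f p|
    over [p - e, p + e], and the latter is o(e) at a Lebesgue point. *)
Lemma lebesgue_pt_bump f (a b p : R) : 0 < a -> a < p < b -> intR `[a, b] f ->
  lebesgue_pt (f \_ `[a, b]) p -> bump_pt f p.
Proof.
move=> a0 /andP[ap pb] fi lp I0 S dS S0 S1 eta eta0.
have [M M0 hM] := bump_le.
have M1 : 0 < M + 1 by rewrite ltr_pwDr.
pose eta' := eta / (2 * (M + 1)).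
have eta'0 : 0 < eta' by rewrite divr_gt0// mulr_gt0.
have /fine_cvgP[fn /cvgr0Pnorm_lt/(_ _ eta'0)] := lp.
move=> [d1 /= d10 h1]; move: fn => [d2 /= d20 h2].
pose d := Num.min (Num.min d1 d2) (Num.min (p - a) (b - p)).
exists d; first by rewrite !lt_min d10 d20 !subr_gt0 ap pb.
move=> e e0; rewrite !lt_min => /andP[/andP[ed1 ed2] /andP[epa ebp]].
have ne : ball 0 d1 e /\ ball 0 d2 e.
  by rewrite /ball/= sub0r normrN gtr0_norm.
have pe0 : 0 < p - e by lra.
have sub : `[p - e, p + e]%classic `<=` `[a, b]%classic.
  by move=> x /=; rewrite !in_itv/= => /andP[? ?]; apply/andP; split; lra.
have fie : intR `[p - e, p + e] f by exact: intRS fi.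
have cfi (k : R) : intR `[p - e, p + e] (fun x => f x - k).
  by apply: intRB => //; exact: intR_cst.
have mb : measurable_fun `[p - e, p + e] (bump_at p e).
  by apply: measurable_funTS; apply: continuous_measurable_fun; exact: bump_at_cont.
have bb x : `|bump_at p e x| <= M + 1.
  by rewrite ger0_norm ?bump_ge0// (le_trans (hM _))// lerDl.
have pbi g : intR `[p - e, p + e] g -> intR `[p - e, p + e] (fun x => bump_at p e x * g x).
  by move=> gi; apply: (intRM_bounded (M := M + 1)).
have bi : intR `[p - e, p + e] (bump_at p e).
  by apply: (@intR_bounded_itv R _ _ (M + 1)).
rewrite (@RI_supp _ `[p - e, p + e]%classic); first last.
- by move=> x _ h; rewrite bump_at_out ?mulr0.
- exact: itv_pos_sub.
have -> : RI `[p - e, p + e] (fun x => f x * bump_at p e x) - e * I0 * f p =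
    RI `[p - e, p + e] (fun x => bump_at p e x * (f x - f p)).
  rewrite -(RI_bump_at e0 pe0 dS S0 S1) [_ * f p]mulrC.
  rewrite -(RIZ (f p) _ bi)// -RIB//.
  - by apply: eq_RI => x _; ring.
  - by apply: eq_intR (pbi _ fie) => // x _; rewrite mulrC.
  - exact: intRZ.
have pin : `[a, b]%classic p by rewrite /= in_itv/= !ltW.
have bE : ball p e = `](p - e), (p + e)[%classic.
  by apply/seteqP; split => x; rewrite /ball/= in_itv/= ltr_norml => /andP[? ?];
    apply/andP; split; lra.
have key : RI `[p - e, p + e] (fun x => `|f x - f p|) <= eta' * (2 * e).
  have := h1 e ne.1 e0; have := h2 e ne.2 e0.
  have i1 : intR `](p - e), (p + e)[ (fun x => `|f x - f p|).
    by apply: (intRS _ _ _ (intR_norm (cfi (f p)))) => //; exact: subset_itv_oo_cc.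
  have -> : RI `[p - e, p + e] (fun x => `|f x - f p|) =
      RI `](p - e), (p + e)[ (fun x => `|f x - f p|).
    rewrite (Rintegral_itv_bndo_bndc i1) Rintegral_itv_obnd_cbnd//.
    by apply: (intRS _ _ _ (intR_norm (cfi (f p)))) => //; exact: subset_itv_oc_cc.
  have -> : davg (f \_ `[a, b]) p e = ((2 * e)^-1 * RI `](p - e), (p + e)[ (fun x => `|f x - f p|))%:E.
    rewrite /davg /iavg bE lebesgue_measure_itv/= lte_fin.
    rewrite (_ : p - e < p + e); last by lra.
    rewrite EFinM; congr (_ * _)%E.
      rewrite -EFinD inver (_ : p + e - (p - e) = 2 * e); last by ring.
      by rewrite gt_eqF// mulr_gt0.
    rewrite -(RI_fin i1 (measurable_itv _)); apply: eq_integral => x.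
    rewrite inE/= in_itv/= => /andP[x1 x2].
    rewrite !patchE !mem_set//= in_itv/=; apply/andP; split; lra.
  rewrite /= normrM ger0_norm ?invr_ge0; last lra.
  move=> _; rewrite ltr_pdivrMl; last lra.
  rewrite mulrC => /ltW; apply: le_trans; exact: ler_norm.
apply: le_trans (le_norm_RI _ (pbi _ (cfi (f p)))) _ => //.
apply: (@le_trans _ _ ((M + 1) * RI `[p - e, p + e] (fun x => `|f x - f p|))).
  rewrite -(RIZ _ _ (intR_norm (cfi (f p))))//.
  apply: le_RI => //.
  - exact/intR_norm/pbi.
  - by apply: intRZ => //; exact: intR_norm.
  - by move=> x _; rewrite normrM ler_wpM2r.
apply: (le_trans (ler_wpM2l (ltW M1) key)).
by rewrite /eta' le_eqVlt; apply/orP; left; apply/eqP; field; rewrite gt_eqF.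
Qed.

End BumpPrimitive.

(** * Functions whose second distributional derivative vanishes *)

Section WeakPrimitive.
Context {R : realType}.
Implicit Types (f g h v w V W phi : R -> R) (x : R).
Notation Dp := (`](0 : R), +oo[%classic).

Definition locint f := forall x y : R, 0 < x -> x <= y -> intR `[x, y] f.

Lemma prim_locint f g : prim f g -> locint g.
Proof. by move=> fg x y x0 xy; exact: (fg x y x0 xy).1. Qed.

Lemma locintB f g : locint f -> locint g -> locint (fun x => f x - g x).
Proof. by move=> fi gi x y x0 xy; apply: intRB => //; [exact: fi|exact: gi]. Qed.

Lemma locintM f g : locint f -> {in `](0 : R), +oo[, continuous g} ->
  locint (fun x => f x * g x).
Proof.
move=> fi cg x y x0 xy.
have [M hM] := @cont_bounded R g x y cg x0.
apply: (@eq_intR R _ (fun x => g x * f x)) => //; first by move=> *; rewrite mulrC.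
apply: (@intRM_bounded R _ M) => //; last exact: fi.
exact: cont_meas_itv.
Qed.

(** The base point is 1, since f may fail to be integrable near 0. *)
Definition anti f x := if 1 <= x then RI `[1, x] f else - RI `[x, 1] f.

Lemma prim_anti f : locint f -> prim (anti f) f.
Proof.
move=> fi x y x0 xy; split; first exact: fi.
rewrite /anti; have [x1|x1] := leP 1 x.
  rewrite (le_trans x1 xy) (RI_split x1 xy); first ring.
  by apply: fi; rewrite // (le_trans x1).
have [y1|y1] := leP 1 y.
  rewrite opprK addrC -RI_split ?(ltW x1)//; exact: fi.
rewrite opprK addrC (RI_split xy (ltW y1)); first ring.
by apply: fi; rewrite // ltW.
Qed.

Lemma derive_supp phi phi1 (a b : R) :
  (forall x, 0 < x -> is_derive x 1 phi (phi1 x)) ->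
  (forall x, 0 < x -> ~ `[a, b]%classic x -> phi x = 0) ->
  forall x, 0 < x -> ~ `[a, b]%classic x -> phi1 x = 0.
Proof.
move=> dphi phi0 x x0 xab.
have o : open (~` `[a, b]%classic) by apply: closed_openC; exact: itv_closed.
have := isd_cst x (0 : R).
have h : {near x, (fun=> 0) =1 phi}.
  have h1 := open_nbhs_nbhs (conj o xab : open_nbhs x (~` `[a, b]%classic)).
  by near=> t; rewrite phi0//; near: t; [exact: lt_nbhsr|exact: h1].
move=> /(isd_near h) d; have d' := dphi x x0.
by rewrite -(@derive_val _ _ _ _ _ _ _ d) -(@derive_val _ _ _ _ _ _ _ d').
Unshelve. all: by end_near. Qed.

(** Subtract the product rules for W phi and V phi1, both of which vanish at the ends of an interval
    containing the support. *)
Lemma prim_weak V W w phi phi1 phi2 (a b : R) : prim V W -> prim W w ->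
  (forall x, 0 < x -> is_derive x 1 phi (phi1 x)) ->
  (forall x, 0 < x -> is_derive x 1 phi1 (phi2 x)) ->
  {in `](0 : R), +oo[, continuous phi2} -> 0 < a -> a <= b ->
  (forall x, 0 < x -> ~ `[a, b]%classic x -> phi x = 0) ->
  [/\ intR Dp (fun x => V x * phi2 x), intR Dp (fun x => w x * phi x) &
      RI Dp (fun x => V x * phi2 x) = RI Dp (fun x => w x * phi x)].
Proof.
move=> VW Ww d1 d2 c2 a0 ab s0.
have s1 := derive_supp d1 s0; have s2 := derive_supp d2 s1.
have c1 : {in `](0 : R), +oo[, continuous phi1}.
  by move=> x; rewrite in_itv/= andbT => x0; exact: isd_cont (d2 x x0).
have c0 : {in `](0 : R), +oo[, continuous phi}.
  by move=> x; rewrite in_itv/= andbT => x0; exact: isd_cont (d1 x x0).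
have p1 : prim phi phi1 := prim_derive c1 d1.
have p2 : prim phi1 phi2 := prim_derive c2 d2.
(* The support hypothesis speaks of points outside [a, b]; at a' and b' both phi and phi1 are known
   to vanish. *)
pose a' := a / 2; pose b' := b + 1.
have a'0 : 0 < a' by rewrite divr_gt0.
have a'a : a' < a by rewrite /a'; lra.
have bb' : b < b' by rewrite /b' ltrDl.
have ab' : a' <= b' by rewrite (le_trans (ltW a'a))// (le_trans ab)// ltW.
have na : ~ `[a, b]%classic a' by rewrite /= in_itv/= => /andP[]; rewrite leNgt a'a.
have nb : ~ `[a, b]%classic b' by rewrite /= in_itv/= => /andP[_]; rewrite leNgt bb'.
have sub : `[a', b']%classic `<=` Dp := itv_pos_sub a'0.
have nin x : ~ `[a', b']%classic x -> ~ `[a, b]%classic x.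
  move=> h /=; rewrite in_itv/= => /andP[h1 h2]; apply: h; rewrite /= in_itv/=.
  by rewrite (le_trans (ltW a'a) h1) (le_trans h2 (ltW bb')).
have cV := prim_cont VW.
have i1 : intR `[a', b'] (fun x => V x * phi2 x).
  by apply: cont_intR => // x x0; apply: cvgM; [exact: cV|exact: c2].
have i2 : intR `[a', b'] (fun x => w x * phi x).
  by apply: (locintM (prim_locint Ww) c0).
have z1 x : Dp x -> ~ `[a', b']%classic x -> V x * phi2 x = 0.
  by rewrite in_Dp => x0 /nin/(s2 x x0) ->; rewrite mulr0.
have z2 x : Dp x -> ~ `[a', b']%classic x -> w x * phi x = 0.
  by rewrite in_Dp => x0 /nin/(s0 x x0) ->; rewrite mulr0.
have b'0 : 0 < b' := lt_le_trans a'0 ab'.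
split.
- exact: (intR_supp _ _ sub z1 i1).
- exact: (intR_supp _ _ sub z2 i2).
rewrite (RI_supp sub) 1?(RI_supp (f := fun x => w x * phi x) sub)//.
have [i3 E1] := (primM Ww p1) a' b' a'0 ab'.
have [i4 E2] := (primM VW p2) a' b' a'0 ab'.
have : RI `[a', b'] (fun x => (w x * phi x + W x * phi1 x) - (W x * phi1 x + V x * phi2 x)) = 0.
  rewrite RIB// -E1 -E2 !s0// !s1//; ring.
move=> E0; apply/eqP; rewrite -subr_eq0 -RIB// -oppr_eq0; apply/eqP.
rewrite -[RHS]E0 -mulN1r -RIZ//; last exact: intRB.
by apply: eq_RI => x _; ring.
Qed.

Lemma test_function_itv phi (a b : R) (D : set R) : smooth phi ->
  `[a, b]%classic `<=` D -> (forall x, ~ `[a, b]%classic x -> phi x = 0) ->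
  test_function D phi.
Proof.
move=> /smoothP sphi sub s0; split => //; exists `[a, b]%classic; split => //.
exact: segment_compact.
Qed.

Definition weak0 h := forall phi (a b : R), smooth phi -> 0 < a -> a <= b ->
  (forall x, ~ `[a, b]%classic x -> phi x = 0) ->
  RI Dp (fun x => h x * derive1n 2 phi x) = 0.

(* Second primitives of bumps at p, q, r are affine to the right of their
   supports; the weights r - q, p - r, q - p annihilate affine functions, so the
   weighted sum is a test function, whose second derivative is a sum of bumps. *)
Lemma weak0_affine3 h (p q r : R) : locint h -> weak0 h ->
  0 < p -> 0 < q -> 0 < r -> bump_pt h p -> bump_pt h q -> bump_pt h r ->
  (r - q) * h p + (p - r) * h q + (q - p) * h r = 0.
Proof.
move=> hi h0 p0 q0 r0 bp bq br.
have [S [P [I0 [k [I00 [dS dP] S0 S1 [P0 P1]]]]]] := @bump_primitives R.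
have sP : smooth P.
  move=> [//|[|n]]; exists S => //; exists (@bump R) => //; exact: bump_smooth.
set X := _ + _.
pose Y := (`|r - q| + `|p - r| + `|q - p|).
have Y0 : 0 <= Y by rewrite !addr_ge0.
suff H eta : 0 < eta -> I0 * `|X| <= eta * Y.
  have := @le0_of_le_eps R (I0 * `|X|) Y 1 ltr01 (fun e e0 _ => H e e0).
  by rewrite pmulr_rle0// normr_le0 => /eqP.
move=> eta0.
have [dp dp0 hp] := bp I0 S dS S0 S1 eta eta0.
have [dq dq0 hq] := bq I0 S dS S0 S1 eta eta0.
have [dr dr0 hr] := br I0 S dS S0 S1 eta eta0.
have [m m0 [mp mq mr]] : exists2 m, 0 < m & [/\ m <= p, m <= q & m <= r].
  exists (Num.min p (Num.min q r)); first by rewrite !lt_min p0 q0 r0.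
  by rewrite !ge_min !lexx ?orbT.
pose d := Num.min (Num.min dp dq) (Num.min dr m).
have d0 : 0 < d by rewrite !lt_min dp0 dq0 dr0 m0.
pose e := d / 2; have e0 : 0 < e by rewrite divr_gt0.
have : e < d by rewrite /e; lra.
rewrite !lt_min => /andP[/andP[ep eq] /andP[er em]].
pose M := p + q + r.
pose a := m - e; pose b := M + e.
have a0 : 0 < a by rewrite subr_gt0.
pose T c x := P (e^-1 * x + - (e^-1 * c)).
pose phi x := ((r - q) * T p x + (p - r) * T q x) + (q - p) * T r x.
pose phi1 x := ((r - q) * (e^-1 * S (e^-1 * x + - (e^-1 * p))) +
  (p - r) * (e^-1 * S (e^-1 * x + - (e^-1 * q)))) + (q - p) * (e^-1 * S (e^-1 * x + - (e^-1 * r))).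
pose phi2 x := ((r - q) * (e^-1 * (e^-1 * bump_at p e x)) +
  (p - r) * (e^-1 * (e^-1 * bump_at q e x))) + (q - p) * (e^-1 * (e^-1 * bump_at r e x)).
have sphi : smooth phi by apply: smoothD; first apply: smoothD; apply: smoothZ; exact: smooth_affine.
have d1 x : is_derive x 1 phi (phi1 x).
  by apply: isdD; first apply: isdD; apply: isdZ; apply: isd_affine; exact: dP.
have d2 x : is_derive x 1 phi1 (phi2 x).
  by apply: isdD; first apply: isdD; apply: isdZ; apply: isdZ; apply: isd_affine; exact: dS.
have E2 : derive1n 2 phi = phi2.
  by rewrite /= (derive1_unique d1) (derive1_unique d2).
have ei0 : 0 < e^-1 by rewrite invr_gt0.
have Tl c x : m <= c -> x < a -> T c x = 0.
  move=> mc xa; apply: P0; rewrite -mulrBr ler_pdivrMl// /a in xa *; lra.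
have Tr c x : c <= M -> b < x -> T c x = I0 * (e^-1 * x + - (e^-1 * c)) + k.
  move=> cM bx; apply: P1; rewrite -mulrBr ler_pdivlMl// /b in bx *; lra.
have [pM qM rM] : [/\ p <= M, q <= M & r <= M] by rewrite /M; split; lra.
have s0 x : ~ `[a, b]%classic x -> phi x = 0.
  move=> nx; have [xa|ax] := ltP x a.
    by rewrite /phi !Tl//; ring.
  have bx : b < x.
    by rewrite ltNge; apply/negP => xb; apply: nx; rewrite /= in_itv/= ax.
  rewrite /phi !Tr//; ring.
have ab : a <= b by rewrite /a /b; lra.
have := h0 phi a b sphi a0 ab s0; rewrite E2.
have bi c : 0 < c -> c - e > 0 -> intR Dp (fun x => h x * bump_at c e x).
  move=> c0 ce; apply: (@intR_supp R _ `[c - e, c + e]%classic) => //.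
  - exact: itv_pos_sub.
  - by move=> x _ nx; rewrite bump_at_out ?mulr0.
  - by apply: (locintM hi (fun x _ => @bump_at_cont R c e x)) => //; lra.
have ip : intR Dp (fun x => h x * bump_at p e x) by apply: bi => //; lra.
have iq : intR Dp (fun x => h x * bump_at q e x) by apply: bi => //; lra.
have ir : intR Dp (fun x => h x * bump_at r e x) by apply: bi => //; lra.
have mD : measurable Dp by exact: measurable_itv.
have {hp} := hp e e0 ep; have {hq} := hq e e0 eq; have {hr} := hr e e0 er.
set Br := RI _ _; set Bq := RI _ _; set Bp := RI _ _ => hr hq hp.
have -> : RI Dp (fun x => h x * phi2 x) =
   e^-1 ^+ 2 * ((r - q) * Bp + (p - r) * Bq + (q - p) * Br).
  rewrite -!(RIZ _ mD)// -!(RID mD)//; try by do ?[apply: intRD => //]; apply: intRZ.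
  rewrite -(RIZ _ mD); last by do ?[apply: intRD => //]; apply: intRZ.
  by apply: eq_RI => x _; rewrite /phi2; ring.
move/eqP; rewrite mulf_eq0 expf_eq0/= gt_eqF//= => /eqP B0.
(* By [B0] the weighted sum of the three integrals is 0, so e I0 X is minus the weighted sum of
   their deviations from e I0 h, each of which is at most eta e. *)
have key : e * (I0 * `|X|) <= e * (eta * Y).
  rewrite -{1}(ger0_norm (ltW e0)) -{1}(ger0_norm (ltW I00)) -!normrM.
  rewrite (_ : e * (I0 * X) = - ((r - q) * (Bp - e * I0 * h p) +
     (p - r) * (Bq - e * I0 * h q) + (q - p) * (Br - e * I0 * h r))); last first.
    rewrite /X -[LHS]addr0 -[0]oppr0 -B0; ring.
  rewrite normrN.
  apply: (le_trans (ler_normD _ _)).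
  have t3 : `|(q - p) * (Br - e * I0 * h r)| <= `|q - p| * (eta * e) by rewrite normrM ler_wpM2l.
  have t2 : `|(p - r) * (Bq - e * I0 * h q)| <= `|p - r| * (eta * e) by rewrite normrM ler_wpM2l.
  have t1 : `|(r - q) * (Bp - e * I0 * h p)| <= `|r - q| * (eta * e) by rewrite normrM ler_wpM2l.
  rewrite (_ : e * (eta * Y) = `|r - q| * (eta * e) + `|p - r| * (eta * e)
      + `|q - p| * (eta * e)); last first.
    by rewrite /Y; ring.
  apply: (lerD _ t3); apply: (le_trans (ler_normD _ _)); exact: (lerD t1 t2).
by move: key; rewrite ler_pM2l.
Qed.

End WeakPrimitive.

(** * From weak derivatives to absolutely continuous representatives *)

Section WeakToPrimitive.
Context {R : realType}.
Implicit Types (f g h v w V W phi : R -> R) (x : R).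
Notation Dp := (`](0 : R), +oo[%classic).

(** Lebesgue differentiation on the countably many intervals [1 / (n + 2), n + 2], on each of which
    h is integrable. *)
Lemma ae_bump_pt h : locint h -> {ae @lebesgue_measure R, forall x, 0 < x -> bump_pt h x}.
Proof.
move=> hi.
have n0 n : 0 < (n.+2)%:R^-1 :> R by rewrite invr_gt0 ltr0n.
have n1 n : (n.+2)%:R^-1 <= (n.+2)%:R :> R.
  by apply: (@le_trans _ _ 1); [rewrite invf_le1 ?ltr0n// ler1n|rewrite ler1n].
have H n : {ae @lebesgue_measure R, forall x,
    lebesgue_pt (h \_ `[(n.+2)%:R^-1, (n.+2)%:R]) x}.
  apply: lebesgue_differentiation; apply: open_integrable_locally; first exact: openT.
  have := hi _ _ (n0 n) (n1 n).
  by move/(intR_patch _ (measurable_itv _)).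
have /ae_impl := ae_foralln H; apply => x Hx x0.
pose n := Num.truncn (x + x^-1).
have hn : x + x^-1 < n.+1%:R by exact: truncnS_gt.
have xi : 0 < x^-1 by rewrite invr_gt0.
have hn2 : (n.+1%:R : R) <= n.+2%:R by rewrite ler_nat.
apply: (@lebesgue_pt_bump R h (n.+2)%:R^-1 (n.+2)%:R) => //; last by apply: hi.
apply/andP; split; last by lra.
by rewrite -[ltRHS]invrK ltf_pV2 ?posrE ?ltr0n//; lra.
Qed.

Lemma ae_pick (P : R -> Prop) (a b : R) : a < b ->
  {ae @lebesgue_measure R, forall x, P x} -> exists x, a < x < b /\ P x.
Proof.
move=> ab aeP; apply: contrapT => nP.
have : (@lebesgue_measure R).-negligible `]a, b[%classic.
  apply: negligibleS aeP => x /=; rewrite in_itv/= => xab Px.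
  by apply: nP; exists x.
move=> [N [mN N0 sub]].
have : (@lebesgue_measure R `]a, b[%classic <= @lebesgue_measure R N)%E.
  by apply: le_measure => //; rewrite inE.
by rewrite N0 lebesgue_measure_itv/= lte_fin ab -EFinB lee_fin subr_le0 leNgt ab.
Qed.

(** Once two good points p < r are fixed, the three-point relation makes h at every other good point
    the affine interpolation between them. *)
Lemma weak0_affine h : locint h -> weak0 h -> exists A B : R,
  {ae @lebesgue_measure R, forall x, 0 < x -> h x = A + B * x}.
Proof.
move=> hi h0; have aeb := ae_bump_pt hi.
have [p [/andP[p0 p1] bp]] := ae_pick ltr01 aeb.
have [r [/andP[r1 _] br]] := @ae_pick _ 1 2 (ltac:(by lra)) aeb.
have r0 : 0 < r by lra.
exists ((r * h p - p * h r) / (r - p)), ((h r - h p) / (r - p)).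
apply: ae_impl aeb => x bx x0.
have E := weak0_affine3 hi h0 p0 x0 r0 (bp p0) (bx x0) (br r0).
have rp : r - p != 0 by rewrite subr_eq0 gt_eqF//; lra.
apply: (mulfI rp).
rewrite (_ : (r - p) * h x = (r - x) * h p + (x - p) * h r); last by lra.
by field.
Qed.

Definition weakD v w := forall phi (a b : R), smooth phi -> 0 < a -> a <= b ->
  (forall x, ~ `[a, b]%classic x -> phi x = 0) ->
  RI Dp (fun x => v x * derive1n 2 phi x) = RI Dp (fun x => w x * phi x).

(** The difference of v and a second primitive of w has zero weak second derivative, so it is affine
    almost everywhere and can be added to that primitive. *)
Lemma weak_prim_exists v w : locint v -> locint w -> weakD v w ->
  exists V W, [/\ prim V W, prim W w &
    {ae @lebesgue_measure R, forall x, 0 < x -> v x = V x}].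
Proof.
move=> vi wi vw.
have p1 := prim_anti wi.
have p0 : prim (anti (anti w)) (anti w).
  by apply: prim_anti => x y x0 _; apply: cont_intR => //; exact: prim_cont p1.
set W0 := anti w in p1 p0 *; set V0 := anti W0 in p0 *.
have hi : locint (fun x => v x - V0 x).
  by apply: locintB => //; move=> x y x0 _; apply: cont_intR => //; exact: prim_cont p0.
have [|A [B AB]] := weak0_affine hi.
  move=> phi a b sphi a0 ab s0.
  have [phi1 sphi1 d1] := smooth_derive sphi; have [phi2 sphi2 d2] := smooth_derive sphi1.
  have E2 : derive1n 2 phi = phi2 by rewrite /= (derive1_unique d1) (derive1_unique d2).
  have c2 := smooth_cont sphi2.
  have [i1 i2 E] := prim_weak p0 p1 (fun x _ => d1 x) (fun x _ => d2 x)
    (fun x _ => c2 x) a0 ab (fun x _ => s0 x).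
  have i3 : intR Dp (fun x => v x * phi2 x).
    apply: (@intR_supp R _ `[a, b]%classic) => //.
    - exact: itv_pos_sub.
    - move=> x; rewrite in_Dp => x0.
      move=> /(derive_supp (fun x _ => d2 x) (derive_supp (fun x _ => d1 x) (fun x _ => s0 x)) x0) ->.
      by rewrite mulr0.
    - exact: (locintM vi (fun x _ => c2 x)).
  have := vw phi a b sphi a0 ab s0; rewrite E2 -E => Ev.
  apply/eqP; rewrite (_ : RI Dp _ = RI Dp (fun x => v x * phi2 x - V0 x * phi2 x)); last first.
    by apply: eq_RI => x _; rewrite mulrBl.
  by rewrite RIB// Ev subrr.
exists (fun x => V0 x + (A + B * x)), (fun x => W0 x + B); split.
- apply: primD => //; apply: prim_derive => [x _|x _]; first exact: cst_continuous.
  have := isdD (isd_cst x A) (isdZ B (is_derive_id x 1)).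
  by move/isd_eq; apply; rewrite add0r mulr1.
- have := primD p1 (@prim_derive R (fun=> B) (fun=> 0 : R)
    (fun x _ => @cst_continuous R R 0 x) (fun x _ => isd_cst x B)).
  by apply: eq_prim => // x _; rewrite addr0.
- by apply: ae_impl AB => x H x0; rewrite -H// addrC subrK.
Qed.

End WeakToPrimitive.

(** * Reflection and square-integrable complex functions *)

Section Reflection.
Context {R : realType}.
Implicit Types (f g h : R -> R) (x : R).
Notation Dp := (`](0 : R), +oo[%classic).

Lemma oppr_meas : measurable_fun setT (fun x : R => - x).
Proof. by apply: continuous_measurable_fun => x; exact: opp_continuous. Qed.

Lemma meas_refl f : measurable_fun setT f -> measurable_fun setT (fun x => f (- x)).
Proof. by move=> mf; apply: (measurableT_comp mf); exact: oppr_meas. Qed.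

Lemma intR_refl f : intR setT f -> intR setT (fun x => f (- x)).
Proof.
move=> /integrableP[mf fi]; apply/integrableP; split.
  by apply/measurable_EFinP; apply: meas_refl; apply/measurable_EFinP.
have mN : measurable_fun setT (-%R : R -> measurableTypeR R) by exact: oppr_meas.
apply: le_lt_trans fi; rewrite le_eqVlt; apply/orP; left; apply/eqP.
rewrite -[RHS](@eq_measure_integral _ _ _ _ (@lebesgue_measure R)
  (pushforward (@lebesgue_measure R) (-%R : R -> measurableTypeR R))); last first.
  by move=> A mA _; exact: lebesgue_measureN.
rewrite ge0_integral_pushforward//.
by apply: measurableT_comp.
Qed.

Lemma RI_refl f : intR setT f -> RI setT (fun x => f (- x)) = RI setT f.
Proof.
move=> fi; rewrite /Rintegral; congr fine.
have mN : measurable_fun setT (-%R : R -> measurableTypeR R) by exact: oppr_meas.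
rewrite -[RHS](@eq_measure_integral _ _ _ _ (@lebesgue_measure R)
  (pushforward (@lebesgue_measure R) (-%R : R -> measurableTypeR R))); last first.
  by move=> A mA _; exact: lebesgue_measureN.
rewrite integral_pushforward//; last exact: (intR_refl fi).
by apply/measurable_EFinP; exact: intR_meas fi.
Qed.

Lemma ae_refl (P : R -> Prop) : {ae @lebesgue_measure R, forall x, P x} ->
  {ae @lebesgue_measure R, forall x, P (- x)}.
Proof.
move=> [A [mA A0 PA]]; exists (-%R @^-1` A); split.
- rewrite -[X in measurable X]setTI; exact: oppr_meas.
- by have := lebesgue_measureN mA; rewrite /pushforward A0.
- by move=> x /= Px; apply: PA.
Qed.

Lemma ae_neq0 : {ae @lebesgue_measure R, forall x, x != 0}.
Proof.
exists [set 0]; split => //; first exact: lebesgue_measure_set1.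
by move=> x /= /negP; rewrite negbK => /eqP.
Qed.

Lemma ae_halves (P : R -> Prop) :
  {ae @lebesgue_measure R, forall x, 0 < x -> P x} ->
  {ae @lebesgue_measure R, forall x, 0 < x -> P (- x)} ->
  {ae @lebesgue_measure R, forall x, P x}.
Proof.
move=> P1 /ae_refl P2.
apply: ae_impl (ae_and (ae_and P1 P2) ae_neq0) => x [[H1 H2] x0].
have [h|h|h] := ltgtP 0 x; first exact: H1.
- by have := H2 ltac:(by rewrite oppr_gt0); rewrite opprK.
- by rewrite -h eqxx in x0.
Qed.

(** The last term carries the value at 0, which neither half-line sees. *)
Lemma halvesE f x : f x = (f \_ Dp) x + ((fun y => f (- y)) \_ Dp) (- x)
  + ((fun=> f 0) \_ `[0, 0]) x.
Proof.
rewrite !patchE.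
have E (y : R) : (y \in Dp) = (0 < y) by rewrite mem_setE in_itv/= andbT.
have E0 : (x \in `[(0:R), 0]%classic) = (x == 0).
  by rewrite mem_setE in_itv/= eq_le andbC.
rewrite !E E0 oppr_gt0.
by have [h|h|->] := ltgtP 0 x; rewrite ?opprK ?addr0 ?add0r.
Qed.

Lemma measurable_halves f : measurable_fun Dp f -> measurable_fun Dp (fun x => f (- x)) ->
  measurable_fun setT f.
Proof.
have mD : measurable Dp by exact: measurable_itv.
move=> /(measurable_restrictT _ mD) m1 /(measurable_restrictT _ mD) m2.
rewrite (funext (halvesE f)); apply: measurable_funD; first apply: measurable_funD => //.
- exact: (meas_refl m2).
- apply: (measurable_restrictT _ (measurable_itv _)).1.
  exact: measurable_cst.
Qed.

Lemma RI_halves f : intR Dp f -> intR Dp (fun x => f (- x)) ->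
  intR setT f /\ RI setT f = RI Dp f + RI Dp (fun x => f (- x)).
Proof.
have mD : measurable Dp by exact: measurable_itv.
move=> /(intR_patch _ mD) i1 /(intR_patch _ mD) i2.
have i2' := intR_refl i2.
have mI : measurable `[(0:R), 0]%classic by exact: measurable_itv.
have i3 : intR setT ((fun=> f 0) \_ `[(0:R), 0]).
  by apply/(intR_patch _ mI); exact: intR_cst.
have i12 := intRD measurableT i1 i2'.
split; first by rewrite (funext (halvesE f)); exact: intRD.
rewrite [in LHS](funext (halvesE f)) (RID measurableT i12 i3) (RID measurableT i1 i2') (RI_refl i2).
by rewrite -!Rintegral_mkcond set_itv1 Rintegral_set1 addr0.
Qed.

Lemma sqint_refl f : sqint setT f -> sqint setT (fun x => f (- x)).
Proof.
move=> [mf fi]; split; last exact: (intR_refl (f := fun x => f x ^+ 2)).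
exact: meas_refl.
Qed.

Lemma sqint_half f : sqint setT f -> sqint Dp f /\ sqint Dp (fun x => f (- x)).
Proof.
have mD : measurable Dp by exact: measurable_itv.
by move=> sf; split; apply: (sqintS measurableT mD) => //; exact: sqint_refl.
Qed.

Lemma sqint_halves f : sqint Dp f -> sqint Dp (fun x => f (- x)) -> sqint setT f.
Proof.
move=> [m1 i1] [m2 i2]; split; first exact: measurable_halves.
exact: (RI_halves (f := fun x => f x ^+ 2) i1 i2).1.
Qed.

Lemma Lfun2P f : (f \in Lfun (@lebesgue_measure R) 2%:E) <-> sqint setT f.
Proof.
split => [fL|[mf fi]].
  split; first by move: fL; rewrite inE => /andP[/[!inE]].
  exact: Lfun2_integrable_sqr.
rewrite inE; apply/andP; split; rewrite inE/=; first exact: mf.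
rewrite /finite_norm unlock poweR_lty//.
move/integrableP : fi => [_]; apply: le_lt_trans.
rewrite le_eqVlt; apply/orP; left; apply/eqP; apply: eq_integral => x _.
by rewrite /= powR_mulrn// normrX.
Qed.

End Reflection.

(** * Complex L^2 functions as pairs of real ones *)

Section ComplexL2.
Context {R : realType}.
Local Open Scope complex_scope.
Implicit Types (f g : R -> R[i]).

Definition re f x := complex.Re (f x).
Definition im f x := complex.Im (f x).

Lemma L2P f : L2 f <-> sqint setT (re f) /\ sqint setT (im f).
Proof. by split=> -[/Lfun2P h1 /Lfun2P h2]. Qed.

Definition sqnorm f := RI setT (fun x => re f x ^+ 2 + im f x ^+ 2).

Lemma sqnorm_ge0 f : 0 <= sqnorm f.
Proof. by apply: Rintegral_ge0 => x _; apply: addr_ge0; exact: sqr_ge0. Qed.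

Lemma L2normE f : L2 f -> L2norm f = (Num.sqrt (sqnorm f))%:E.
Proof.
move=> /L2P[[m1 i1] [m2 i2]].
have i : intR setT (fun x => re f x ^+ 2 + im f x ^+ 2) by exact: intRD.
rewrite /L2norm unlock.
rewrite (_ : (\int[_]_x _)%E = (sqnorm f)%:E); last first.
  rewrite -(RI_fin i measurableT); apply: eq_integral => x _.
  rewrite /= powR_mulrn// /re /im; case: (f x) => a b /=.
  by rewrite ger0_norm ?sqrtr_ge0// sqr_sqrtr// addr_ge0 ?sqr_ge0.
by rewrite poweR_EFin powR12_sqrt// sqnorm_ge0.
Qed.

End ComplexL2.

(** * Weak derivatives on R \ {0} and on the two half-lines *)

Section WeakDerivative.
Context {R : realType}.
Implicit Types (f g v w phi : R -> R) (x : R).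
Notation Dp := (`](0 : R), +oo[%classic).

Lemma compact_neq0 (K : set R) : compact K -> K `<=` [set~ 0] ->
  exists a b, [/\ 0 < a, a <= b & forall x, K x -> a <= `|x| <= b].
Proof.
move=> cK K0.
have [M [_ hM]] := compact_bounded cK.
have oK : open (~` K) by apply: closed_openC; apply: compact_closed => //; exact: Rhausdorff.
have nK0 : (~` K) 0 by move=> /K0; exact.
have [e /= e0 he] := open_nbhs_nbhs (conj oK nK0 : open_nbhs 0 (~` K)).
pose b := Num.max (M + 1) e.
exists e, b; split => //; first by rewrite le_max lexx orbT.
move=> x Kx; apply/andP; split.
  rewrite leNgt; apply/negP => xe; apply: (he x) => //.
  by rewrite /ball/= sub0r normrN.
have Mb : M < b by rewrite lt_max ltrDl ltr01.
exact: (hM b Mb x Kx).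
Qed.

Lemma derive_near0 phi x d : {near x, phi =1 fun=> 0} -> is_derive x 1 phi d -> d = 0.
Proof.
move=> h d1.
have h' : {near x, (fun=> 0) =1 phi} by move: h; apply: filterS => t ->.
have d0 := isd_near h' (isd_cst x (0 : R)).
by rewrite -(@derive_val _ _ _ _ _ _ _ d1) -(@derive_val _ _ _ _ _ _ _ d0).
Qed.

Lemma derive_closed_supp (K : set R) (f f' : R -> R) : closed K ->
  (forall x, is_derive x 1 f (f' x)) -> (forall x, ~ K x -> f x = 0) ->
  forall x, ~ K x -> f' x = 0.
Proof.
move=> cK df f0 x Kx; apply: (derive_near0 (x := x) _ (df x)).
have oK : open (~` K) by exact: closed_openC.
by apply: filterS (open_nbhs_nbhs (conj oK Kx : open_nbhs x (~` K))) => t /f0.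
Qed.

Lemma derive1n2_supp phi (K : set R) : smooth phi -> closed K ->
  (forall x, ~ K x -> phi x = 0) -> forall x, ~ K x -> derive1n 2 phi x = 0.
Proof.
move=> sphi cK s0.
have [phi1 sphi1 d1] := smooth_derive sphi; have [phi2 _ d2] := smooth_derive sphi1.
rewrite /= (derive1_unique d1) (derive1_unique d2).
exact: (derive_closed_supp cK d2 (derive_closed_supp cK d1 s0)).
Qed.

Lemma locint_meas v : locint v -> measurable_fun Dp v.
Proof.
move=> vi; rewrite -(exhaust_itv (@ltr01 R)).
apply/measurable_fun_bigcup => // n.
have h : 1 <= n.+1%:R :> R by rewrite ler1n.
have h0 : 0 < 1 / n.+1%:R :> R by rewrite divr_gt0// ltr0n.
have h1 : 1 / n.+1%:R <= 1 * n.+1%:R :> R.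
  by rewrite !mul1r; apply: le_trans h; rewrite invf_le1 ?ltr0n// ler1n.
by apply: intR_meas; exact: vi.
Qed.

Lemma locally_integrable_intR (D K : set R) v : locally_integrable D v ->
  compact K -> K `<=` D -> intR K v.
Proof.
move=> [mv oD vi] cK KD.
have mK : measurable K by apply: closed_measurable; apply: compact_closed => //; exact: Rhausdorff.
apply/integrableP; split; last exact: vi.
apply/measurable_EFinP; apply: (measurable_funS _ KD mv).
exact: open_measurable.
Qed.

Lemma locally_integrable_locint v : locally_integrable [set~ 0] v ->
  locint v /\ locint (fun x => v (- x)).
Proof.
move=> vi; split => x y x0 xy.
  apply: (locally_integrable_intR vi); first exact: segment_compact.
  by move=> z /=; rewrite in_itv/= => /andP[xz _] /eqP; rewrite gt_eqF// (lt_le_trans x0).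
have i1 : intR `[- y, - x] v.
  apply: (locally_integrable_intR vi); first exact: segment_compact.
  move=> z /=; rewrite in_itv/= => /andP[_ xz] /eqP; rewrite lt_eqF//.
  by rewrite (le_lt_trans xz)// oppr_lt0.
have := intR_refl ((intR_patch _ (measurable_itv _)).1 i1).
move=> h; apply/(intR_patch _ (measurable_itv _)).
apply: eq_intR h => // z _.
rewrite !patchE !mem_setE !in_itv/= !lerN2 andbC//.
Qed.

(** By [compact_neq0] a compact subset of R \ {0} is contained in the union of some [- b, - a] and
    [a, b] with a > 0. *)
Lemma locint_locally_integrable v : locint v -> locint (fun x => v (- x)) ->
  locally_integrable [set~ 0] v.
Proof.
move=> v1 v2.
have mv : measurable_fun setT v by apply: measurable_halves; exact: locint_meas.
have oD : open [set~ (0 : R)].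
  by apply: closed_openC; apply: accessible_closed_set1; exact/hausdorff_accessible/Rhausdorff.
split => //; first exact: measurable_funTS.
move=> K KD cK.
have [a [b [a0 ab Kab]]] := compact_neq0 cK KD.
have mK : measurable K by apply: closed_measurable; apply: compact_closed => //; exact: Rhausdorff.
suff : intR K v by move=> /integrableP[].
pose S := `[a, b]%classic `|` `[- b, - a]%classic.
have mS : measurable S by apply: measurableU; exact: measurable_itv.
apply: (@intRS R S) => //.
  move=> x /Kab /andP[ax xb]; rewrite /S/= !in_itv/=.
  move: ax xb; have [x0|x0] := leP 0 x.
    by rewrite ger0_norm// => -> ->; left.
  by rewrite ltr0_norm// => h1 h2; right; rewrite lerNr h1 lerNl h2.
apply/(intR_patch _ mS); apply: (RI_halves _ _).1.
  apply: (@intR_supp R _ `[a, b]%classic) => //; first exact: itv_pos_sub.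
    move=> x; rewrite in_Dp => x0 nx; rewrite patchE memNset// => -[//|/=].
    by rewrite in_itv/= => /andP[_ h]; lra.
  by apply: eq_intR (v1 a b a0 ab) => // x xab; rewrite patchE mem_set//; left.
apply: (@intR_supp R _ `[a, b]%classic) => //; first exact: itv_pos_sub.
  move=> x; rewrite in_Dp => x0 nx; rewrite patchE memNset// => -[/=|].
    by rewrite in_itv/= => /andP[h _]; lra.
  by rewrite /= in_itv/= !lerN2 andbC => h; apply: nx; rewrite /= in_itv.
apply: eq_intR (v2 a b a0 ab) => // x; rewrite /= in_itv/= => /andP[h1 h2].
by rewrite patchE mem_set//; right; rewrite /= in_itv/= !lerN2 h1 h2.
Qed.

Lemma reflect_derive1n2 phi : smooth phi ->
  smooth (fun x => phi (- x)) /\ derive1n 2 (fun x => phi (- x)) = (fun x => derive1n 2 phi (- x)).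
Proof.
move=> sphi.
have [phi1 sphi1 d1] := smooth_derive sphi; have [phi2 sphi2 d2] := smooth_derive sphi1.
have E f : (fun t => f (-1 * t + 0)) = (fun t : R => f (- t) : R).
  by apply/funext => t; rewrite addr0 mulN1r.
split; first by rewrite -E; exact: smooth_affine.
have H (f f' : R -> R) : (forall x, is_derive x 1 f (f' x)) ->
    forall x, is_derive x 1 (fun t => f (- t)) (- f' (- x)).
  move=> df x; have := @isd_affine R f (-1) 0 x (f' (- x)).
  by rewrite addr0 !mulN1r E; apply; exact: df.
rewrite /= (derive1_unique d1) (derive1_unique d2) (derive1_unique (H _ _ d1)).
apply: derive1_unique => x.
by have := isdN (H _ _ d2 x); rewrite opprK.
Qed.

Lemma itv_neg_neq0 (a b : R) : 0 < a -> `[- b, - a]%classic `<=` [set~ 0].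
Proof.
move=> a0 x /=; rewrite in_itv/= => /andP[_ h]; apply/eqP.
by rewrite lt_eqF// (le_lt_trans h)// oppr_lt0.
Qed.

Lemma RI_reflect_supp (a b : R) f g : 0 < a -> locint (fun x => f (- x)) -> continuous g ->
  (forall x, ~ `[a, b]%classic x -> g x = 0) ->
  RI [set~ 0] (fun x => f x * g (- x)) = RI Dp (fun x => f (- x) * g x).
Proof.
move=> a0 fi cg g0.
have z x : ~ `[a, b]%classic x -> f (- x) * g x = 0 by move=> /g0 ->; rewrite mulr0.
have i1 : intR setT (fun x => f (- x) * g x).
  have [ab|ba] := leP a b.
    apply: (@intR_supp R _ `[a, b]%classic) => //; first by move=> x _; exact: z.
    exact: (locintM fi (fun x _ => cg x)).
  apply: (@eq_intR _ _ (fun=> 0)) => //; last exact: integrable0.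
  by move=> x _; rewrite z// /= in_itv/= => /andP[h1 /(le_trans h1)]; rewrite leNgt ba.
rewrite -(@RI_supp R setT Dp)//; last first.
  by move=> x _ nx; apply: z => /(itv_pos_sub a0).
rewrite -(RI_refl i1) -(@RI_supp R setT [set~ 0])//.
  by apply: eq_RI => x _; rewrite opprK.
move=> x _ /= /contrapT ->; rewrite oppr0 g0 ?mulr0//= in_itv/= => /andP[/(lt_le_trans a0)].
by rewrite ltxx.
Qed.

(** A smooth function supported in [a, b] with a > 0 is a test function on R \ {0}, and so is its
    reflection. *)
Lemma weak_derive2_restrict v w : weak_derive2_real [set~ 0] v w ->
  [/\ locint v /\ locint w, locint (fun x => v (- x)) /\ locint (fun x => w (- x)),
      weakD v w & weakD (fun x => v (- x)) (fun x => w (- x))].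
Proof.
move=> [vi wi vw].
have [v1 v2] := locally_integrable_locint vi.
have [w1 w2] := locally_integrable_locint wi.
have pos0 (a b x : R) : 0 < a -> `[a, b]%classic x -> x != 0.
  by move=> a0 /=; rewrite in_itv/= => /andP[ax _]; rewrite gt_eqF// (lt_le_trans a0).
split => //.
  move=> phi a b sphi a0 ab s0.
  have tphi : test_function [set~ 0] phi.
    by apply: (test_function_itv sphi _ s0) => x /(pos0 _ _ _ a0)/eqP.
  have cab : closed `[a, b]%classic by exact: itv_closed.
have s2 := derive1n2_supp sphi cab s0.
  have sub : Dp `<=` [set~ 0] by move=> x; rewrite in_Dp => x0 /=; apply/eqP; rewrite gt_eqF.
  have := vw phi tphi; rewrite (RI_supp sub); last first.
    by move=> x _ nx; rewrite s2 ?mulr0// => /(itv_pos_sub a0).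
  rewrite (RI_supp (f := fun x => w x * phi x) sub)//.
  by move=> x _ nx; rewrite s0 ?mulr0// => /(itv_pos_sub a0).
move=> phi a b sphi a0 ab s0.
have [spsi Epsi] := reflect_derive1n2 sphi.
have cab : closed `[a, b]%classic by exact: itv_closed.
have s2 := derive1n2_supp sphi cab s0.
have c2 : continuous (derive1n 2 phi).
  have [phi1 sphi1 d1] := smooth_derive sphi; have [phi2 sphi2 d2] := smooth_derive sphi1.
  by rewrite /= (derive1_unique d1) (derive1_unique d2); exact: smooth_cont.
have tpsi : test_function [set~ 0] (fun x => phi (- x)).
  apply: (test_function_itv (a := - b) (b := - a) spsi).
    exact: itv_neg_neq0.
  move=> x nx; apply: s0 => /=; rewrite in_itv/= => /andP[h1 h2]; apply: nx.
  by rewrite /= in_itv/= lerNl h2 lerNr h1.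
have K := RI_reflect_supp a0.
have := vw _ tpsi; rewrite Epsi (K b _ _ v2 c2 s2) (K b _ _ w2 (smooth_cont sphi) s0); exact.
Qed.

(** The support of a test function on R \ {0} keeps away from 0, so the integrals split into two
    half-line identities without any jump term at 0. *)
Lemma weak_derive2_glue v w W1 W2 : prim v W1 -> prim W1 w ->
  prim (fun x => v (- x)) W2 -> prim W2 (fun x => w (- x)) ->
  weak_derive2_real [set~ 0] v w.
Proof.
move=> p1 q1 p2 q2.
have lv f g : prim f g -> locint f.
  by move=> fg x y x0 _; apply: cont_intR => //; exact: prim_cont fg.
split.
- by apply: locint_locally_integrable; [exact: lv p1|exact: lv p2].
- by apply: locint_locally_integrable; [exact: prim_locint q1|exact: prim_locint q2].
move=> phi [/smoothP sphi [K [cK K0 s0]]].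
have [a [b [a0 ab Kab]]] := compact_neq0 cK K0.
have clK : closed K by apply: compact_closed => //; exact: Rhausdorff.
have [spsi Epsi] := reflect_derive1n2 sphi.
have s2 := derive1n2_supp sphi clK s0.
have H f : smooth f -> (forall x, 0 < x -> ~ `[a, b]%classic x -> f x = 0) ->
  forall V W u, prim V W -> prim W u -> 
  [/\ intR Dp (fun x => V x * derive1n 2 f x), intR Dp (fun x => u x * f x) &
      RI Dp (fun x => V x * derive1n 2 f x) = RI Dp (fun x => u x * f x)].
  move=> sf f0 V W u VW Wu.
  have [f1 sf1 d1] := smooth_derive sf; have [f2 sf2 d2] := smooth_derive sf1.
  rewrite /= (derive1_unique d1) (derive1_unique d2).
  have c2 : {in `](0:R), +oo[, continuous f2} by move=> x _; exact: (smooth_cont sf2).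
  exact: (prim_weak VW Wu (fun x _ => d1 x) (fun x _ => d2 x) c2 a0 ab f0).
have f1 x : 0 < x -> ~ `[a, b]%classic x -> phi x = 0.
  by move=> x0 nx; apply: s0 => /Kab; rewrite gtr0_norm// => h; apply: nx; rewrite /= in_itv.
have f2 x : 0 < x -> ~ `[a, b]%classic x -> phi (- x) = 0.
  by move=> x0 nx; apply: s0 => /Kab; rewrite normrN gtr0_norm// => h; apply: nx; rewrite /= in_itv.
have [i1 j1 E1] := H _ sphi f1 _ _ _ p1 q1.
have [i2 j2 E2] := H _ spsi f2 _ _ _ p2 q2.
rewrite Epsi in i2 E2.
have nK0 x : ~ [set~ 0] x -> ~ K x by move=> h /K0.
have z1 x : [set: R] x -> ~ [set~ 0] x -> v x * derive1n 2 phi x = 0.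
  by move=> _ /nK0/s2 ->; rewrite mulr0.
have z2 x : [set: R] x -> ~ [set~ 0] x -> w x * phi x = 0.
  by move=> _ /nK0/s0 ->; rewrite mulr0.
rewrite -(RI_supp (@subsetT _ _) z1) -(RI_supp (@subsetT _ _) z2).
rewrite (RI_halves (f := fun x => v x * derive1n 2 phi x) i1 i2).2.
rewrite (RI_halves (f := fun x => w x * phi x) j1 j2).2.
exact: (f_equal2 +%R E1 E2).
Qed.

End WeakDerivative.

(** * The resolvent set *)

Section HalfLineBound.
Context {R : realType}.
Implicit Types (f g v w : R -> R) (x : R).
Notation Dp := (`](0 : R), +oo[%classic).

Lemma ae_intR (D : set R) f g : measurable D -> measurable_fun D g ->
  {ae @lebesgue_measure R, forall x, D x -> f x = g x} -> intR D f ->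
  intR D g /\ RI D f = RI D g.
Proof.
move=> mD mg fg fi.
have mf := intR_meas fi.
have mg' : measurable_fun D (EFin \o g) by exact/measurable_EFinP.
have mf' : measurable_fun D (EFin \o f) by exact/measurable_EFinP.
have e : ae_eq (@lebesgue_measure R) D (EFin \o f) (EFin \o g).
  by apply: ae_impl fg => x h Dx /=; rewrite h.
have e' : ae_eq (@lebesgue_measure R) D (fun x => `|(EFin \o f) x|%E) (fun x => `|(EFin \o g) x|%E).
  by apply: ae_impl fg => x h Dx /=; rewrite h.
split.
  apply/integrableP; split => //; move/integrableP : fi => [_].
  have -> : (\int[@lebesgue_measure R]_(x in D) `|(EFin \o f) x| =
             \int[@lebesgue_measure R]_(x in D) `|(EFin \o g) x|)%E; last by [].
  by apply: ae_eq_integral e' => //; exact: measurableT_comp.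
by rewrite /Rintegral; congr fine; exact: ae_eq_integral.
Qed.

Lemma sqint_ae (D : set R) f g : measurable D -> measurable_fun D g ->
  {ae @lebesgue_measure R, forall x, D x -> f x = g x} -> sqint D f -> sqint D g.
Proof.
move=> mD mg fg [mf fi]; split => //.
apply: (ae_intR mD (measurable_funX 2 mg) _ fi).1.
by apply: ae_impl fg => x h Dx /=; rewrite h.
Qed.

Lemma eq_sqint (D : set R) f g : measurable D -> (forall x, D x -> f x = g x) ->
  sqint D f -> sqint D g.
Proof.
move=> mD fg [mf fi]; split.
  by apply: eq_measurable_fun mf => x /set_mem/fg.
by apply: eq_intR fi => // x Dx; rewrite fg.
Qed.

Definition coef x : R := (2 - aco x) / aco x.

Lemma coef_cont : {in `](0:R), +oo[, continuous coef}.
Proof.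
rewrite /coef; apply: contM; last exact: acoV_cont.
by apply: contD; [exact: cont_cst|apply: contN; exact: aco_cont].
Qed.

(** As 2 - aco >= 1, the domain condition on the potential term puts v / aco in L^2. *)
Lemma sqint_coef f : measurable_fun Dp f -> sqint Dp (fun x => coef x * f x) ->
  sqint Dp (fun x => f x / aco x).
Proof.
move=> mf [m i].
have m' : measurable_fun Dp (fun x => f x / aco x).
  by apply: measurable_funM => //; apply: cont_meas; exact: acoV_cont.
split => //; apply: le_intR i; [exact: mDp|exact: measurable_funX|].
move=> x; rewrite in_Dp => x0; have a0 := aco_gt0 x0; have a1 := aco_lt1 x0.
rewrite ger0_norm ?sqr_ge0// /coef [in leRHS]mulrAC mulrC.
rewrite (_ : (2 - aco x) * f x / aco x = (2 - aco x) * ((aco x)^-1 * f x)); last by ring.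
rewrite [leRHS]exprMn ler_peMl ?sqr_ge0// exprn_ege1//; lra.
Qed.

Lemma sqint_coef_of f : sqint Dp (fun x => f x / aco x) -> sqint Dp f ->
  sqint Dp (fun x => coef x * f x).
Proof.
move=> s1 s2; have := sqintD mDp (sqintZ 2 mDp s1) (sqintZ (-1) mDp s2).
apply: eq_sqint; first exact: mDp.
move=> x; rewrite in_Dp => x0; rewrite /coef; have a0 := aco_gt0 x0.
by field; rewrite gt_eqF.
Qed.

Variables (zr zi beta kappa : R).
Hypothesis kappaE : kappa = 1 - zr + beta * zi.
Hypothesis kappa_gt0 : 0 < kappa.

(** Replace v1, v2 by their absolutely continuous representatives; f1, f2 then agree almost
    everywhere with the right-hand sides required by [energy_estimate], and aco < 1 passes from v /
    aco to v. *)
Lemma halfline_bound v1 v2 w1 w2 f1 f2 :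
  locint v1 /\ locint w1 -> locint v2 /\ locint w2 -> weakD v1 w1 -> weakD v2 w2 ->
  sqint Dp v1 /\ sqint Dp v2 ->
  sqint Dp (fun x => coef x * v1 x) /\ sqint Dp (fun x => coef x * v2 x) ->
  sqint Dp f1 /\ sqint Dp f2 ->
  {ae @lebesgue_measure R, forall x, 0 < x ->
     f1 x = - (aco x * w1 x) + coef x * v1 x - (zr * v1 x - zi * v2 x) /\
     f2 x = - (aco x * w2 x) + coef x * v2 x - (zr * v2 x + zi * v1 x)} ->
  coer kappa ^+ 2 * RI Dp (fun x => v1 x ^+ 2 + v2 x ^+ 2) <=
  (1 + beta ^+ 2) * RI Dp (fun x => f1 x ^+ 2 + f2 x ^+ 2).
Proof.
move=> [lv1 lw1] [lv2 lw2] d1 d2 [sv1 sv2] [sc1 sc2] [sf1 sf2] fE.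
have [V1 [W1 [pV1 pW1 E1]]] := weak_prim_exists lv1 lw1 d1.
have [V2 [W2 [pV2 pW2 E2]]] := weak_prim_exists lv2 lw2 d2.
have mV1 : measurable_fun Dp V1 by apply: cont_meas; exact: prim_cont pV1.
have mV2 : measurable_fun Dp V2 by apply: cont_meas; exact: prim_cont pV2.
have mc : measurable_fun Dp coef by apply: cont_meas; exact: coef_cont.
have ma : measurable_fun Dp (@aco R) by apply: cont_meas; exact: aco_cont.
have mw1 := locint_meas lw1; have mw2 := locint_meas lw2.
have mul V v : {ae @lebesgue_measure R, forall x, 0 < x -> v x = V x} ->
    measurable_fun Dp V -> sqint Dp v -> sqint Dp (fun x => coef x * v x) ->
    sqint Dp V /\ sqint Dp (fun x => V x / aco x).
  move=> E mV sv sc; split.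
    by apply: (sqint_ae mDp mV _ sv); apply: ae_impl E => x h; rewrite in_Dp.
  apply: sqint_coef => //; apply: (sqint_ae mDp _ _ sc); first exact: measurable_funM.
  by apply: ae_impl E => x h; rewrite in_Dp => x0; rewrite h.
have [sV1 sVa1] := mul _ _ E1 mV1 sv1 sc1.
have [sV2 sVa2] := mul _ _ E2 mV2 sv2 sc2.
pose F1 x := - (aco x * w1 x) + (2 - aco x) / aco x * V1 x - (zr * V1 x - zi * V2 x).
pose F2 x := - (aco x * w2 x) + (2 - aco x) / aco x * V2 x - (zr * V2 x + zi * V1 x).
have mF1 : measurable_fun Dp F1.
  apply: measurable_funB; first apply: measurable_funD.
  - by apply: measurableT_comp => //; exact: measurable_funM.
  - exact: (measurable_funM mc mV1).
  - by apply: measurable_funB; exact: measurable_funM.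
have mF2 : measurable_fun Dp F2.
  apply: measurable_funB; first apply: measurable_funD.
  - by apply: measurableT_comp => //; exact: measurable_funM.
  - exact: (measurable_funM mc mV2).
  - by apply: measurable_funD; exact: measurable_funM.
have FE : {ae @lebesgue_measure R, forall x, 0 < x -> f1 x = F1 x /\ f2 x = F2 x}.
  apply: ae_impl (ae_and fE (ae_and E1 E2)) => x [h [h1 h2]] x0.
  by have [-> ->] := h x0; rewrite (h1 x0) (h2 x0).
have sF1 : sqint Dp F1.
  by apply: (sqint_ae mDp mF1 _ sf1); apply: ae_impl FE => x h; rewrite in_Dp => /h[].
have sF2 : sqint Dp F2.
  by apply: (sqint_ae mDp mF2 _ sf2); apply: ae_impl FE => x h; rewrite in_Dp => /h[].
have hc s : 0 <= s <= 1 -> coer kappa <= 2 - (1 + zr) * s + beta * zi * s.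
  move=> hs; have := coer_le kappaE (t := 1) (ltac:(by rewrite ler01 lexx)) hs.
  by rewrite !mul1r.
have := energy_estimate (coer_gt0 kappa_gt0) hc pV1 pW1 pV2 pW2
  (fun x _ => erefl : F1 x = _) (fun x _ => erefl : F2 x = _) sVa1 sVa2 sF1 sF2.
have iv : intR Dp (fun x => v1 x ^+ 2 + v2 x ^+ 2).
  by apply: (intRD mDp); [exact: sv1.2|exact: sv2.2].
have iff : intR Dp (fun x => f1 x ^+ 2 + f2 x ^+ 2).
  by apply: (intRD mDp); [exact: sf1.2|exact: sf2.2].
have EV : {ae @lebesgue_measure R, forall x, Dp x -> v1 x ^+ 2 + v2 x ^+ 2 = V1 x ^+ 2 + V2 x ^+ 2}.
  by apply: ae_impl (ae_and E1 E2) => x [h1 h2]; rewrite in_Dp => x0; rewrite h1// h2.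
have EF : {ae @lebesgue_measure R, forall x, Dp x -> f1 x ^+ 2 + f2 x ^+ 2 = F1 x ^+ 2 + F2 x ^+ 2}.
  by apply: ae_impl FE => x h; rewrite in_Dp => /h[-> ->].
have [iV ->] := @ae_intR Dp _ (fun x => V1 x ^+ 2 + V2 x ^+ 2) mDp
  (measurable_funD (measurable_funX 2 mV1) (measurable_funX 2 mV2)) EV iv.
have [_ ->] := @ae_intR Dp _ (fun x => F1 x ^+ 2 + F2 x ^+ 2) mDp
  (measurable_funD (measurable_funX 2 mF1) (measurable_funX 2 mF2)) EF iff.
apply: le_trans; apply: ler_wpM2l; first exact: sqr_ge0.
have iVa : intR Dp (fun x => (V1 x / aco x) ^+ 2 + (V2 x / aco x) ^+ 2).
  by apply: (intRD mDp); [exact: sVa1.2|exact: sVa2.2].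
rewrite (RID mDp sV1.2 sV2.2) (RID mDp sVa1.2 sVa2.2).
exact: (lerD (sqint_aco mV1 sVa1).2 (sqint_aco mV2 sVa2).2).
Qed.

End HalfLineBound.

(** * From the half-lines to the resolvent on the whole line *)

Section Resolvent.
Context {R : realType}.
Local Open Scope complex_scope.
Implicit Types (v w g : R -> R[i]) (x : R) (z : R[i]).
Notation Dp := (`](0 : R), +oo[%classic).

Lemma acoN x : aco (- x) = aco x :> R.
Proof. by rewrite /aco ucuspN. Qed.

Lemma coefN x : coef (- x) = coef x :> R.
Proof. by rewrite /coef acoN. Qed.

Lemma coefE x : (1 + ucusp x ^+ 2) / (1 - ucusp x ^+ 2) = coef x :> R.
Proof. by rewrite -/(aco x) ucusp_sqr /coef; congr (_ / _); ring. Qed.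

Definition cusp_lead w x := (aco x)%:C * w x.
Definition cusp_pot v x := (coef x)%:C * v x.

Lemma re_lead w x : re (cusp_lead w) x = aco x * re w x.
Proof. by rewrite /re /cusp_lead; case: (w x) => a b /=; rewrite mul0r subr0. Qed.

Lemma im_lead w x : im (cusp_lead w) x = aco x * im w x.
Proof. by rewrite /im /cusp_lead; case: (w x) => a b /=; rewrite mul0r addr0. Qed.

Lemma re_pot v x : re (cusp_pot v) x = coef x * re v x.
Proof. by rewrite /re /cusp_pot; case: (v x) => a b /=; rewrite mul0r subr0. Qed.

Lemma im_pot v x : im (cusp_pot v) x = coef x * im v x.
Proof. by rewrite /im /cusp_pot; case: (v x) => a b /=; rewrite mul0r addr0. Qed.

Lemma cuspLP v g : cuspL v g <-> L2 v /\ L2 g /\ exists w,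
  [/\ weak_derive2 [set~ 0] v w, L2 (cusp_lead w), L2 (cusp_pot v) &
      {ae @lebesgue_measure R, forall x,
        re g x = - (aco x * re w x) + coef x * re v x /\
        im g x = - (aco x * im w x) + coef x * im v x}].
Proof.
have pE : (fun x => ((1 + ucusp x ^+ 2) / (1 - ucusp x ^+ 2))%:C * v x) = cusp_pot v.
  by apply/funext => x; rewrite coefE.
have E w x : (g x = - ((1 - ucusp x ^+ 2)%:C * w x) +
    ((1 + ucusp x ^+ 2) / (1 - ucusp x ^+ 2))%:C * v x) <->
    (re g x = - (aco x * re w x) + coef x * re v x /\
     im g x = - (aco x * im w x) + coef x * im v x).
  rewrite coefE -/(aco x) -re_lead -im_lead -re_pot -im_pot /re /im.
  rewrite -/(cusp_lead w x) -/(cusp_pot v x).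
  case: (g x) (cusp_lead w x) (cusp_pot v x) => [a b] [c d] [e f] /=.
  by split=> [[-> ->]|[-> ->]].
split=> [[Lv [Lg [w [wd Ll Lp gE]]]]|[Lv [Lg [w [wd Ll Lp gE]]]]]; split => //; split => //; exists w.
  split => //; first by move: Lp; rewrite pE.
  by apply: ae_impl gE => x h; apply/E; exact: h.
move=> lead pot; split => //; first by rewrite /pot pE.
by apply: ae_impl gE => x h _; apply/E.
Qed.

Lemma re_sub g v z x : re (fun x => g x - z * v x) x =
  re g x - (complex.Re z * re v x - complex.Im z * im v x).
Proof. by rewrite /re /im; case: (g x) (v x) z => [a b] [c d] [e f]. Qed.

Lemma im_sub g v z x : im (fun x => g x - z * v x) x =
  im g x - (complex.Re z * im v x + complex.Im z * re v x).
Proof. by rewrite /re /im; case: (g x) (v x) z => [a b] [c d] [e f] /=; ring. Qed.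

Lemma sqint_re_sub z (g v : R -> R[i]) : L2 g -> L2 v -> L2 (fun x => g x - z * v x).
Proof.
move=> /L2P[g1 g2] /L2P[v1 v2]; apply/L2P; split.
  have := sqintD measurableT g1 (sqintD measurableT (sqintZ (- complex.Re z) measurableT v1)
    (sqintZ (complex.Im z) measurableT v2)).
  by apply: eq_sqint => // x _; rewrite re_sub; ring.
have := sqintD measurableT g2 (sqintD measurableT (sqintZ (- complex.Re z) measurableT v2)
    (sqintZ (- complex.Im z) measurableT v1)).
by apply: eq_sqint => // x _; rewrite im_sub; ring.
Qed.

Lemma sqnorm_halves v : L2 v -> sqnorm v =
  RI Dp (fun x => re v x ^+ 2 + im v x ^+ 2) +
  RI Dp (fun x => re v (- x) ^+ 2 + im v (- x) ^+ 2).
Proof.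
move=> /L2P[/sqint_half[s1 s2] /sqint_half[t1 t2]].
have i1 : intR Dp (fun x => re v x ^+ 2 + im v x ^+ 2).
  by apply: (intRD mDp); [exact: s1.2|exact: t1.2].
have i2 : intR Dp (fun x => re v (- x) ^+ 2 + im v (- x) ^+ 2).
  by apply: (intRD mDp); [exact: s2.2|exact: t2.2].
exact: (RI_halves (f := fun x => re v x ^+ 2 + im v x ^+ 2) i1 i2).2.
Qed.

Definition glue (f g : R -> R) x : R := if 0 < x then f x else g (- x).

Lemma glue_pos (f g : R -> R) x : 0 < x -> glue f g x = f x.
Proof. by rewrite /glue => ->. Qed.

Lemma glue_neg (f g : R -> R) x : 0 < x -> glue f g (- x) = g x.
Proof. by move=> x0; rewrite /glue oppr_gt0 ltNge (ltW x0)/= opprK. Qed.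

Lemma sqint_glue (f g h : R -> R) : (forall x, 0 < x -> h x = f x) -> (forall x, 0 < x -> h (- x) = g x) ->
  sqint Dp f -> sqint Dp g -> sqint setT h.
Proof.
move=> hf hg sf sg; apply: sqint_halves.
  by apply: eq_sqint sf; [exact: mDp|move=> x; rewrite in_Dp => /hf].
by apply: eq_sqint sg; [exact: mDp|move=> x; rewrite in_Dp => /hg].
Qed.

Lemma weak_derive2_real_glue (f g F G f'' g'' : R -> R) : prim f F -> prim F f'' -> prim g G -> prim G g'' ->
  weak_derive2_real [set~ 0] (glue f g) (glue f'' g'').
Proof.
move=> p1 p2 q1 q2; apply: (@weak_derive2_glue _ _ _ F G).
- by apply: eq_prim p1 => // x x0; rewrite glue_pos.
- by apply: eq_prim p2 => // x x0; rewrite glue_pos.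
- by apply: eq_prim q1 => // x x0; rewrite glue_neg.
- by apply: eq_prim q2 => // x x0; rewrite glue_neg.
Qed.

Lemma sqint_of_aco (f F : R -> R) : prim f F -> sqint Dp (fun x => f x / aco x) ->
  sqint Dp f /\ sqint Dp (fun x => coef x * f x).
Proof.
move=> fF sa; have mf : measurable_fun Dp f by apply: cont_meas; exact: prim_cont fF.
have sf := (sqint_aco mf sa).1.
by split => //; exact: sqint_coef_of.
Qed.

(** Serves twice: to glue the two half-line solutions of (L - z) v = f, and to extend wave packets
    by 0 to the negative half-line. The coefficients are even, so both halves obey the same
    equation. *)
Lemma cuspL_glue (z : R[i]) (v1 W1 w1 v2 W2 w2 v1' W1' w1' v2' W2' w2' : R -> R) :
  prim v1 W1 -> prim W1 w1 -> prim v2 W2 -> prim W2 w2 ->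
  prim v1' W1' -> prim W1' w1' -> prim v2' W2' -> prim W2' w2' ->
  sqint Dp v1 /\ sqint Dp (fun x => coef x * v1 x) ->
  sqint Dp v2 /\ sqint Dp (fun x => coef x * v2 x) ->
  sqint Dp v1' /\ sqint Dp (fun x => coef x * v1' x) ->
  sqint Dp v2' /\ sqint Dp (fun x => coef x * v2' x) ->
  sqint Dp (fun x => aco x * w1 x) /\ sqint Dp (fun x => aco x * w2 x) ->
  sqint Dp (fun x => aco x * w1' x) /\ sqint Dp (fun x => aco x * w2' x) ->
  let zr := complex.Re z in let zi := complex.Im z in
  exists v g, [/\ cuspL v g,
    forall x, 0 < x -> [/\ re v x = v1 x, im v x = v2 x,
                          re v (- x) = v1' x & im v (- x) = v2' x] &
    forall x, 0 < x -> let f := fun y => g y - z * v y in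
    [/\ re f x = - (aco x * w1 x) + coef x * v1 x - (zr * v1 x - zi * v2 x),
        im f x = - (aco x * w2 x) + coef x * v2 x - (zr * v2 x + zi * v1 x),
        re f (- x) = - (aco x * w1' x) + coef x * v1' x - (zr * v1' x - zi * v2' x) &
        im f (- x) = - (aco x * w2' x) + coef x * v2' x - (zr * v2' x + zi * v1' x)]].
Proof.
move=> p1 q1 p2 q2 p1' q1' p2' q2' [s1 c1] [s2 c2] [s1' c1'] [s2' c2'] [b1 b2] [b1' b2'] zr zi.
pose v x := glue v1 v1' x +i* glue v2 v2' x.
pose w x := glue w1 w1' x +i* glue w2 w2' x.
pose g x := - cusp_lead w x + cusp_pot v x.
have rg x : re g x = - (aco x * re w x) + coef x * re v x.
  by rewrite -re_lead -re_pot /re /g; case: (cusp_lead w x) (cusp_pot v x) => ? ? [].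
have ig x : im g x = - (aco x * im w x) + coef x * im v x.
  by rewrite -im_lead -im_pot /im /g; case: (cusp_lead w x) (cusp_pot v x) => ? ? [].
have Lv : L2 v.
  by apply/L2P; split; [apply: (sqint_glue _ _ s1 s1') | apply: (sqint_glue _ _ s2 s2')] => x x0;
    rewrite /re /im /= ?(glue_pos _ _ x0) ?(glue_neg _ _ x0).
have Ll : L2 (cusp_lead w).
  by apply/L2P; split; [apply: (sqint_glue _ _ b1 b1') | apply: (sqint_glue _ _ b2 b2')] => x x0;
    rewrite ?re_lead ?im_lead ?acoN /re /im /= ?(glue_pos _ _ x0) ?(glue_neg _ _ x0).
have Lp : L2 (cusp_pot v).
  by apply/L2P; split; [apply: (sqint_glue _ _ c1 c1') | apply: (sqint_glue _ _ c2 c2')] => x x0;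
    rewrite ?re_pot ?im_pot ?coefN /re /im /= ?(glue_pos _ _ x0) ?(glue_neg _ _ x0).
have Lg : L2 g.
  move/L2P : Ll => [l1 l2]; move/L2P : Lp => [p3 p4].
  apply/L2P; split.
    have := sqintD measurableT (sqintZ (-1) measurableT l1) p3.
    by apply: eq_sqint => // x _; rewrite rg re_lead re_pot mulN1r.
  have := sqintD measurableT (sqintZ (-1) measurableT l2) p4.
  by apply: eq_sqint => // x _; rewrite ig im_lead im_pot mulN1r.
exists v, g; split.
- apply/cuspLP; split => //; split => //; exists w; split => //.
    by split; [exact: weak_derive2_real_glue p1 q1 p1' q1'|exact: weak_derive2_real_glue p2 q2 p2' q2'].
  by apply: aeW => x; rewrite rg ig.
- by move=> x x0; rewrite /re /im /= ?(glue_pos _ _ x0) ?(glue_neg _ _ x0).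
move=> x x0 f; rewrite /f !re_sub !im_sub !rg !ig acoN coefN /re /im /=.
by rewrite ?(glue_pos _ _ x0) ?(glue_neg _ _ x0).
Qed.

Variables (zr zi beta kappa : R).
Hypothesis kappaE : kappa = 1 - zr + beta * zi.
Hypothesis kappa_gt0 : 0 < kappa.
Notation z := (zr +i* zi : R[i]).

Lemma cuspL_bound v g : cuspL v g ->
  coer kappa ^+ 2 * sqnorm v <= (1 + beta ^+ 2) * sqnorm (fun x => g x - z * v x).
Proof.
move=> /cuspLP[Lv [Lg [w [[wd1 wd2] /L2P[sl1 sl2] /L2P[sp1 sp2] gE]]]].
have Lf := sqint_re_sub z Lg Lv.
rewrite (sqnorm_halves Lv) (sqnorm_halves Lf) !mulrDr.
have [l1 l1' d1 d1'] := weak_derive2_restrict wd1.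
have [l2 l2' d2 d2'] := weak_derive2_restrict wd2.
move/L2P : Lv => [/sqint_half[sv1 sv1'] /sqint_half[sv2 sv2']].
move/L2P : Lf => [/sqint_half[sf1 sf1'] /sqint_half[sf2 sf2']].
have [sc1 sc1'] := sqint_half sp1; have [sc2 sc2'] := sqint_half sp2.
apply: lerD.
  apply: (halfline_bound kappaE kappa_gt0 l1 l2 d1 d2 (conj sv1 sv2) _ (conj sf1 sf2)).
    by split; [apply: eq_sqint sc1 => [|x _]|apply: eq_sqint sc2 => [|x _]];
      [exact: mDp|rewrite re_pot|exact: mDp|rewrite im_pot].
  by apply: ae_impl gE => x [h1 h2] x0; rewrite re_sub im_sub h1 h2.
apply: (halfline_bound kappaE kappa_gt0 l1' l2' d1' d2' (conj sv1' sv2') _ (conj sf1' sf2')).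
  by split; [apply: eq_sqint sc1' => [|x _]|apply: eq_sqint sc2' => [|x _]];
      [exact: mDp|rewrite re_pot coefN|exact: mDp|rewrite im_pot coefN].
by apply: ae_impl (ae_refl gE) => x [h1 h2] x0; rewrite re_sub im_sub h1 h2 acoN coefN.
Qed.

Lemma cuspL_surj (f0 : R -> R[i]) : L2 f0 -> exists v g,
  cuspL v g /\ (fun x => g x - z * v x) = f0 %[ae lebesgue_measure].
Proof.
move=> /L2P[/sqint_half[sf1 sf1'] /sqint_half[sf2 sf2']].
have [v1 [W1 [w1 [v2 [W2 [w2 [[p1 q1 p2 q2] [a1 a2 b1 b2] e]]]]]]] :=
  halfline_solve kappaE kappa_gt0 sf1 sf2.
have [v1' [W1' [w1' [v2' [W2' [w2' [[p1' q1' p2' q2'] [a1' a2' b1' b2'] e']]]]]]] :=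
  halfline_solve kappaE kappa_gt0 sf1' sf2'.
have [v [g [Lvg _ E]]] := cuspL_glue z p1 q1 p2 q2 p1' q1' p2' q2'
  (sqint_of_aco p1 a1) (sqint_of_aco p2 a2) (sqint_of_aco p1' a1') (sqint_of_aco p2' a2')
  (conj b1 b2) (conj b1' b2').
exists v, g; split => //.
have fin x : re (fun x => g x - z * v x) x = re f0 x -> im (fun x => g x - z * v x) x = im f0 x ->
    g x - z * v x = f0 x.
  by rewrite /re /im; case: (g x - _) (f0 x) => [? ?] [? ?] /= -> ->.
have H : {ae @lebesgue_measure R, forall x, g x - z * v x = f0 x}.
  apply: ae_halves.
    apply: ae_impl e => x h x0; have [h1 h2] := h (ltac:(by rewrite in_Dp)).
    by have [E1 E2 _ _] := E x x0; apply: fin; rewrite ?E1 ?E2.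
  apply: ae_impl e' => x h x0; have [h1 h2] := h (ltac:(by rewrite in_Dp)).
  by have [_ _ E1 E2] := E x x0; apply: fin; rewrite ?E1 ?E2.
by apply: ae_impl H => x h _.
Qed.

Lemma resolvent_z : resolvent_set (@cuspL R) z.
Proof.
have cc : 0 < coer kappa ^+ 2 by rewrite exprn_gt0// coer_gt0.
split.
- move=> v g Lvg gE.
  have [Lv [Lg _]] := (cuspLP v g).1 Lvg.
  have Lf := sqint_re_sub z Lg Lv.
  have := cuspL_bound Lvg.
  have -> : sqnorm (fun x => g x - z * v x) = 0.
    have [f1 f2] := (L2P _).1 Lf.
    have i : intR setT (fun x => re (fun x => g x - z * v x) x ^+ 2 + im (fun x => g x - z * v x) x ^+ 2).
      by apply: intRD => //; [exact: f1.2|exact: f2.2].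
    rewrite /sqnorm (@ae_intR _ _ _ (fun=> 0) measurableT _ _ i).2//.
      by rewrite Rintegral_cst// mul0r.
    apply: ae_impl gE => x h _; have h' : g x - z * v x = 0 by rewrite h// subrr.
    by rewrite /re /im h' /= expr0n/= addr0.
  rewrite mulr0 pmulr_rle0// => le0.
  have [v1 v2] := (L2P _).1 Lv.
  have iv : intR setT (fun x => re v x ^+ 2 + im v x ^+ 2).
    by apply: intRD => //; [exact: v1.2|exact: v2.2].
  have v0 : sqnorm v = 0 by apply/eqP; rewrite eq_le le0 sqnorm_ge0.
  have := RI_eq0_ae measurableT iv (fun x _ => addr_ge0 (sqr_ge0 _) (sqr_ge0 _)) v0.
  apply: ae_impl => x h _; have /eqP := h I.
  rewrite paddr_eq0 ?sqr_ge0// !sqrf_eq0 /re /im.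
  by case: (v x) => a b /= /andP[/eqP -> /eqP ->].
- by move=> f Lf; exact: cuspL_surj.
exists (Num.sqrt ((1 + beta ^+ 2) / coer kappa ^+ 2)) => v g Lvg.
have [Lv [Lg _]] := (cuspLP v g).1 Lvg.
have Lf := sqint_re_sub z Lg Lv.
rewrite (L2normE Lv) (L2normE Lf) -EFinM lee_fin -sqrtrM; last first.
  apply: divr_ge0; last exact: ltW.
  by apply: addr_ge0 => //; exact: sqr_ge0.
apply: ler_wsqrtr.
rewrite mulrAC ler_pdivlMr// mulrC; exact: cuspL_bound.
Qed.

End Resolvent.

(** * Approximate eigenfunctions *)

Section WavePackets.
Context {R : realType}.
Implicit Types (f g : R -> R) (x : R).
Notation Dp := (`](0 : R), +oo[%classic).

Lemma cs_bounded f : continuous f -> (forall x, ~ `[-1, 1]%classic x -> f x = 0) ->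
  exists2 M, 0 <= M & forall x, `|f x| <= M.
Proof.
move=> cf f0.
have cN : {within `[-1, 1], continuous (fun t => `|f t|)}.
  apply: continuous_subspaceT => z; apply: continuous_comp; first exact: cf.
  exact: norm_continuous.
have [c _ cM] := @EVT_max R (fun t => `|f t|) (-1) 1 (ltac:(by lra)) cN.
exists `|f c| => // x; have [h|h] := pselect (`[-1, 1]%classic x); first exact: cM.
by rewrite f0// normr0.
Qed.

Lemma sqint_cs f (a b : R) : {in `](0 : R), +oo[, continuous f} -> 0 < a -> a <= b ->
  (forall x, 0 < x -> ~ `[a, b]%classic x -> f x = 0) -> sqint Dp f.
Proof.
move=> cf a0 ab f0; split; first exact: cont_meas.
apply: (@intR_supp R _ `[a, b]%classic) => //; first exact: itv_pos_sub.
  by move=> x; rewrite in_Dp => x0 /(f0 x x0) ->; rewrite expr0n.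
by apply: cont_intR => // x x0; apply: cvgM; exact: cf.
Qed.

Lemma RI_cst (a b k : R) : a <= b -> RI `[a, b] (fun=> k) = k * (b - a).
Proof.
move=> ab; rewrite Rintegral_cst//= lebesgue_measure_itv/= lte_fin.
move: ab; rewrite le_eqVlt => /predU1P[->|->]; last by rewrite -EFinB.
by rewrite ltxx subrr.
Qed.

Lemma bump_derivatives : exists b1 b2 : R -> R, exists M,
  [/\ (forall x, is_derive x 1 (@bump R) (b1 x)) /\ (forall x, is_derive x 1 b1 (b2 x)),
      continuous b1 /\ continuous b2, 0 <= M,
      (forall x, ~ `[-1, 1]%classic x -> b1 x = 0 /\ b2 x = 0) &
      forall x, [/\ `|@bump R x| <= M, `|b1 x| <= M & `|b2 x| <= M]].
Proof.
have [b1 s1 d1] := smooth_derive (@bump_smooth R).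
have [b2 s2 d2] := smooth_derive s1.
have z0 (x : R) : ~ `[-1, 1]%classic x -> bump x = 0.
  move=> nx; apply: bump_out; rewrite leNgt ltr_norml; apply/negP => /andP[h1 h2].
  by apply: nx; rewrite /= in_itv/= !ltW.
have cI : closed `[(-1 : R), 1]%classic by exact: itv_closed.
have z1 := derive_closed_supp cI d1 z0; have z2 := derive_closed_supp cI d2 z1.
have [M0 M00 H0] := cs_bounded (@bump_cont R) z0.
have [M1 M10 H1] := cs_bounded (smooth_cont s1) z1.
have [M2 M20 H2] := cs_bounded (smooth_cont s2) z2.
exists b1, b2, (M0 + M1 + M2); split => //.
- by split; exact: smooth_cont.
- by rewrite !addr_ge0.
- by move=> x nx; rewrite z1// z2.
move=> x; have := H0 x; have := H1 x; have := H2 x => h2 h1 h0; split; lra.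
Qed.

Lemma bump_lower : exists2 m : R, 0 < m & forall x, `|x| <= 2^-1 -> m <= bump x.
Proof.
have [c cI cm] := @EVT_min R (@bump R) (- 2^-1) (2^-1) (ltac:(by lra))
  (ltac:(by apply: continuous_subspaceT; exact: bump_cont)).
exists (bump c).
  by apply: bump_gt0; move: cI; rewrite in_itv/= => /andP[h1 h2]; apply/andP; split; lra.
by move=> x; rewrite ler_norml => h; apply: cm; rewrite in_itv.
Qed.

Variable k : R.
Hypothesis k_ge0 : 0 <= k.

(** Here b0, b1, b2 are the envelope and its derivatives, t0 the oscillation and t1 = t0' / k.
    Derivatives of the envelope cost at most e (1 + 2 k) M, and the deviation of the coefficients
    from their limit 1, namely 1 - a <= e and (2 - a) / a - 1 <= 4 e, costs e (4 + k^2) M. *)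
Lemma wave_defect (a b0 b1 b2 t0 t1 M e : R) : 0 <= M -> 0 < e -> e <= 2^-1 ->
  1 - e <= a -> a <= 1 -> `|b0| <= M -> `|b1| <= M -> `|b2| <= M ->
  `|t0| <= 1 -> `|t1| <= 1 ->
  `| - (a * (e ^+ 2 * b2 * t0 + 2 * k * (e * b1) * t1 - k ^+ 2 * (b0 * t0)))
     + (2 - a) / a * (b0 * t0) - (1 + k ^+ 2) * (b0 * t0)| <=
  e * (M * (2 * k + k ^+ 2 + 5)).
Proof.
move=> M0 e0 e2 ae a1 B0 B1 B2 T0 T1.
have a0 : 0 < a by lra.
pose r := (2 - a) / a - 1.
have r0 : 0 <= r by rewrite subr_ge0 ler_pdivlMr//; lra.
have r4 : r <= 4 * e.
  by rewrite lerBlDr ler_pdivrMr//; nra.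
rewrite (_ : _ - _ = - (a * e ^+ 2 * (b2 * t0)) - a * (2 * k) * e * (b1 * t1)
   + (r - (1 - a) * k ^+ 2) * (b0 * t0)); last by rewrite /r; ring.
have H (b t : R) : `|b| <= M -> `|t| <= 1 -> `|b * t| <= M.
  by move=> hb ht; rewrite normrM -[leRHS]mulr1 ler_pM.
have h0 := H _ _ B0 T0; have h1 := H _ _ B1 T1; have h2 := H _ _ B2 T0.
have t2 : `|a * e ^+ 2 * (b2 * t0)| <= e * M.
  rewrite normrM (ger0_norm (mulr_ge0 (ltW a0) (sqr_ge0 e))).
  apply: ler_pM => //; first by rewrite mulr_ge0 ?sqr_ge0// ltW.
  have : a * e ^+ 2 <= 1 * e ^+ 2 by rewrite ler_wpM2r// sqr_ge0.
  by move/le_trans; apply; rewrite mul1r expr2 -[leRHS]mulr1 ler_wpM2l// ?ltW//; lra.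
have t1' : `|a * (2 * k) * e * (b1 * t1)| <= e * (2 * k) * M.
  have ke : 0 <= 2 * k * e by rewrite !mulr_ge0// ltW.
  have ake : 0 <= a * (2 * k) * e by rewrite -mulrA mulr_ge0// ltW.
  rewrite normrM (ger0_norm ake); apply: ler_pM => //.
  rewrite -mulrA -[leRHS]mul1r [e * _]mulrC; exact: ler_wpM2r.
have t0' : `|(r - (1 - a) * k ^+ 2) * (b0 * t0)| <= (4 * e + e * k ^+ 2) * M.
  rewrite normrM; apply: ler_pM => //.
  apply: (le_trans (ler_normB _ _)); apply: lerD; first by rewrite ger0_norm.
  have k2 : 0 <= k ^+ 2 by exact: sqr_ge0.
  have a1' : 0 <= 1 - a by lra.
  rewrite ger0_norm; last exact: mulr_ge0.
  apply: ler_wpM2r => //; lra.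
apply: (le_trans (ler_normD _ _)).
rewrite (_ : e * (M * _) = (e * M + e * (2 * k) * M) + (4 * e + e * k ^+ 2) * M); last by ring.
apply: lerD => //; apply: (le_trans (ler_normB _ _)); rewrite normrN; exact: lerD.
Qed.

(** On a support of length 2 L the defect is O(1 / L) pointwise, so its squared norm is O(1 / L),
    whereas the squared norm of the packet is of order L. *)
Lemma wave_packet : exists m K : R, [/\ 0 < m, 0 <= K & forall L, 2 <= L ->
  exists v1 W1 w1 v2 W2 w2 : R -> R,
  let F v w x := - (aco x * w x) + coef x * v x - (1 + k ^+ 2) * v x in
  [/\ [/\ prim v1 W1, prim W1 w1, prim v2 W2 & prim W2 w2],
      [/\ sqint Dp v1 /\ sqint Dp (fun x => coef x * v1 x),
          sqint Dp v2 /\ sqint Dp (fun x => coef x * v2 x) &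
          sqint Dp (fun x => aco x * w1 x) /\ sqint Dp (fun x => aco x * w2 x)],
      m * L <= RI Dp (fun x => v1 x ^+ 2 + v2 x ^+ 2) &
      RI Dp (fun x => F v1 w1 x ^+ 2 + F v2 w2 x ^+ 2) <= K / L]].
Proof.
have [b1 [b2 [M [[d0 d1] [c1 c2] M0 z hM]]]] := bump_derivatives.
have [m m0 hm] := bump_lower.
pose N := M * (2 * k + k ^+ 2 + 5).
have N0 : 0 <= N by rewrite mulr_ge0// !addr_ge0// ?sqr_ge0// mulr_ge0.
exists (m ^+ 2), (4 * N ^+ 2); split; [exact: exprn_gt0|by rewrite mulr_ge0// sqr_ge0|].
move=> L L2.
have L0 : 0 < L by lra.
pose e := L^-1.
have e0 : 0 < e by rewrite invr_gt0.
have e2 : e <= 2^-1 by rewrite lef_pV2// posrE.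
have eL : e * L = 1 by rewrite mulVf// gt_eqF.
have [A A0 hA] := ucusp_small e0.
(* The support [c - L, c + L] starts at A + 1, beyond the point A after which u < 1 / L. *)
pose c := A + L + 1.
have cA : A < c - L by rewrite /c; lra.
have cL0 : 0 < c - L by lra.
have cLL : c - L <= c + L by lra.
have ha x : c - L <= x -> 1 - e <= aco x <= 1.
  move=> cx; have x0 : 0 < x by lra.
  have u0 := ucusp_gt0 x0; have u1 := hA x (lt_le_trans cA cx).
  rewrite (ltW (aco_lt1 x0)) andbT /aco lerB// expr2.
  have : ucusp x <= 1 by exact: ltW (ucusp_lt1 x0).
  move: (ucusp x) u0 u1 => u; nra.
pose s x := e * x + - (e * c).
have sout x : ~ `[c - L, c + L]%classic x -> ~ `[-1, 1]%classic (s x).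
  move=> nx sx; apply: nx; move: sx; rewrite /s /= !in_itv/= -mulrBr => /andP[h1 h2].
  have := ler_wpM2r (ltW L0) h1; have := ler_wpM2r (ltW L0) h2.
  rewrite mulrAC eL !mul1r mulN1r => h3 h4; apply/andP; split; lra.
pose B0 x := bump (s x); pose B1 x := e * b1 (s x); pose B2 x := e * (e * b2 (s x)).
have dB0 x : is_derive x 1 B0 (B1 x) by apply: isd_affine; exact: d0.
have dB1 x : is_derive x 1 B1 (B2 x) by apply: isdZ; apply: isd_affine; exact: d1.
have cs : continuous s.
  by move=> x; apply: isd_cont (isdD (isdZ e (is_derive_id x 1)) (isd_cst x _)).
have cB2 : continuous B2.
  move=> x; apply: cvgM; first exact: cst_continuous.
  apply: cvgM; first exact: cst_continuous.
  by apply: continuous_comp; [exact: cs|exact: c2].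
have zB x : ~ `[c - L, c + L]%classic x -> [/\ B0 x = 0, B1 x = 0 & B2 x = 0].
  move=> /sout ns; have [h1 h2] := z _ ns; rewrite /B0 /B1 /B2 h1 h2 !mulr0; split => //.
  apply: bump_out; rewrite leNgt ltr_norml; apply/negP => /andP[h3 h4].
  by apply: ns; rewrite /= in_itv/= !ltW.
(* Applied to (cos, - sin) for the real part and to (sin, cos) for the imaginary part. *)
have main (T0 T1 : R -> R) : (forall x, is_derive x 1 T0 (k * T1 x)) ->
    (forall x, is_derive x 1 T1 (- (k * T0 x))) ->
    (forall x, `|T0 x| <= 1) -> (forall x, `|T1 x| <= 1) ->
    exists W w : R -> R, let v := fun x => B0 x * T0 x in
    [/\ prim v W /\ prim W w, sqint Dp v /\ sqint Dp (fun x => coef x * v x),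
        sqint Dp (fun x => aco x * w x) &
        let F := fun x => - (aco x * w x) + coef x * v x - (1 + k ^+ 2) * v x in
        [/\ sqint Dp F, (forall x, ~ `[c - L, c + L]%classic x -> F x = 0) &
        forall x, `[c - L, c + L]%classic x -> `|F x| <= e * N]].
  move=> dT0 dT1 hT0 hT1.
  pose v x := B0 x * T0 x.
  pose W x := B1 x * T0 x + k * (B0 x * T1 x).
  pose w x := B2 x * T0 x + 2 * k * (B1 x * T1 x) - k ^+ 2 * (B0 x * T0 x).
  have dv x : is_derive x 1 v (W x).
    by apply: isd_eq (isdM (dB0 x) (dT0 x)) _; rewrite /W; ring.
  have dW x : is_derive x 1 W (w x).
    apply: isd_eq (isdD (isdM (dB1 x) (dT0 x)) (isdZ k (isdM (dB0 x) (dT1 x)))) _.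
    by rewrite /w; ring.
  have cv : continuous v by move=> x; exact: isd_cont (dv x).
  have cW : continuous W by move=> x; exact: isd_cont (dW x).
  have cT0 : continuous T0 by move=> x; exact: isd_cont (dT0 x).
  have cT1 : continuous T1 by move=> x; exact: isd_cont (dT1 x).
  have cB0 : continuous B0 by move=> x; exact: isd_cont (dB0 x).
  have cB1 : continuous B1 by move=> x; exact: isd_cont (dB1 x).
  have cw : continuous w.
    move=> x; apply: cvgB; first apply: cvgD.
    - by apply: cvgM; [exact: cB2|exact: cT0].
    - apply: cvgM; first exact: cst_continuous.
      by apply: cvgM; [exact: cB1|exact: cT1].
    - apply: cvgM; first exact: cst_continuous.
      by apply: cvgM; [exact: cB0|exact: cT0].
  have zv x : ~ `[c - L, c + L]%classic x -> v x = 0 /\ w x = 0.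
    by move=> /zB[h0 h1 h2]; rewrite /v /w h0 h1 h2 !(mul0r, mulr0, addr0, subr0).
  have pv : prim v W by apply: prim_derive => x _; exact: cW.
  have pW : prim W w by apply: prim_derive => x _; exact: cw.
  have sq f g : {in `](0:R), +oo[, continuous g} -> continuous f ->
      (forall x, ~ `[c - L, c + L]%classic x -> f x = 0) -> sqint Dp (fun x => g x * f x).
    move=> cg cf f0; apply: (sqint_cs _ cL0 cLL).
      by apply: contM => // x _; exact: cf.
    by move=> x _ /f0 ->; rewrite mulr0.
  have sv : sqint Dp v by apply: (sqint_cs _ cL0 cLL) => x _; [exact: cv|move/zv => []].
  have scv : sqint Dp (fun x => coef x * v x).
    by apply: sq => //; [exact: coef_cont|move=> x /zv[]].
  have saw : sqint Dp (fun x => aco x * w x).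
    by apply: sq => //; [exact: aco_cont|move=> x /zv[]].
  exists W, w; split => //; split.
  - have := sqintD mDp (sqintD mDp (sqintZ (-1) mDp saw) scv) (sqintZ (- (1 + k ^+ 2)) mDp sv).
    by apply: eq_sqint; [exact: mDp|move=> x _; rewrite mulN1r mulNr].
  - by move=> x /zv[h0 h1]; rewrite -/(v x) h0 h1 !mulr0 oppr0 !addr0 ?oppr0 ?addr0.
  move=> x /=; rewrite in_itv/= => /andP[cx _].
  have /andP[ae a1] := ha x cx.
  have [hb0 hb1 hb2] := hM (s x).
  have := wave_defect M0 e0 e2 ae a1 hb0 hb1 hb2 (hT0 x) (hT1 x).
  rewrite /w /coef /B0 /B1 /B2 expr2 !mulrA; exact.
have dk x : is_derive x 1 (fun x => k * x + 0) k.
  by apply: isd_eq (isdD (isdZ k (is_derive_id x 1)) (isd_cst x 0)) _; rewrite mulr1 addr0.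
have dC x : is_derive x 1 (fun x => cos (k * x + 0)) (k * - sin (k * x + 0)).
  by apply: isd_affine; exact: is_derive_cos.
have dS x : is_derive x 1 (fun x => sin (k * x + 0)) (k * cos (k * x + 0)).
  by apply: isd_affine; exact: is_derive_sin.
have cos1 (x : R) : `|cos x| <= 1 by rewrite ler_norml cos_geN1 cos_le1.
have sin1 (x : R) : `|sin x| <= 1 by rewrite ler_norml sin_geN1 sin_le1.
have [W1 [w1 [[p1 q1] s1 t1 [sF1 zF1 bF1]]]] :=
  main (fun x => cos (k * x + 0)) (fun x => - sin (k * x + 0)) dC
  (ltac:(by move=> x; exact: isdN)) (fun x => cos1 _) (ltac:(by move=> x; rewrite normrN)).
have [W2 [w2 [[p2 q2] s2 t2 [sF2 zF2 bF2]]]] := main (fun x => sin (k * x + 0)) (fun x => cos (k * x + 0)) dS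
  (ltac:(by move=> x; apply: isd_eq (dC x) _; rewrite mulrN)) (fun x => sin1 _) (fun x => cos1 _).
exists (fun x => B0 x * cos (k * x + 0)), W1, w1, (fun x => B0 x * sin (k * x + 0)), W2, w2 => F.
split => //.
(* On the middle half of the support the envelope is at least m, and cos^2 + sin^2 = 1. *)
- have I0 : 0 < c - L / 2 by lra.
  have hL : c - L / 2 <= c + L / 2 by lra.
  have iv : intR Dp (fun x => (B0 x * cos (k * x + 0)) ^+ 2 + (B0 x * sin (k * x + 0)) ^+ 2).
    by apply: (intRD mDp); [exact: s1.1.2|exact: s2.1.2].
  have sub := itv_pos_sub (y := c + L / 2) I0.
  apply: le_trans (le_RI_subset mDp (measurable_itv `[c - L / 2, c + L / 2]) sub _ iv); last first.
    by move=> x _; rewrite addr_ge0// sqr_ge0.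
  have -> : m ^+ 2 * L = RI `[c - L / 2, c + L / 2] (fun=> m ^+ 2).
    by rewrite RI_cst//; field.
  apply: le_RI => //; [exact: intR_cst|exact: intRS sub iv|].
  move=> x; rewrite /= in_itv/= => /andP[h1 h2].
  have E (b t u : R) : t ^+ 2 + u ^+ 2 = 1 -> (b * t) ^+ 2 + (b * u) ^+ 2 = b ^+ 2.
    by move=> h; rewrite !exprMn -mulrDr h mulr1.
  rewrite (E _ _ _ (cos2Dsin2 _)) ler_sqr ?nnegrE; [|exact: ltW|exact: bump_ge0].
  apply: hm; rewrite /s -mulrBr normrM (gtr0_norm e0) mulrC ler_pdivrMr// ler_norml.
  apply/andP; split; lra.
have iF : intR Dp (fun x => F (fun x => B0 x * cos (k * x + 0)) w1 x ^+ 2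
    + F (fun x => B0 x * sin (k * x + 0)) w2 x ^+ 2).
  by apply: (intRD mDp); [exact: sF1.2|exact: sF2.2].
have sub := itv_pos_sub (y := c + L) cL0.
rewrite (RI_supp sub); last first.
  by move=> x _ nx; rewrite /F zF1// zF2// expr0n addr0.
apply: (@le_trans _ _ (RI `[c - L, c + L] (fun=> 2 * (e * N) ^+ 2))).
  apply: le_RI => //; [exact: intRS sub iF|exact: intR_cst|].
  have sq (y : R) : `|y| <= e * N -> y ^+ 2 <= (e * N) ^+ 2.
    move=> h; rewrite -real_normK ?num_real//; rewrite ler_sqr ?nnegrE//.
    by rewrite mulr_ge0// ltW.
  by move=> x hx; rewrite mulr_natl mulr2n; exact: (lerD (sq _ (bF1 x hx)) (sq _ (bF2 x hx))).
rewrite RI_cst// /e le_eqVlt; apply/orP; left; apply/eqP; field; rewrite gt_eqF//.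
Qed.

End WavePackets.

(** * Determination of the spectrum *)

Section Spectrum.
Context {R : realType}.
Local Open Scope complex_scope.
Implicit Types (x : R) (z : R[i]).
Notation Dp := (`](0 : R), +oo[%classic).

Lemma resolvent_set_compl (zr zi : R) : zi != 0 \/ zr < 1 ->
  resolvent_set (@cuspL R) (zr +i* zi).
Proof.
move=> H.
have [beta b0] : exists beta, 0 < 1 - zr + beta * zi.
  have [z0|zi0] := eqVneq zi 0.
    exists 0; rewrite mul0r addr0 subr_gt0; case: H => // /negP[].
    exact/eqP.
  (* This beta makes beta * zi = 1 + |1 - zr|, so the sum is at least 1. *)
  exists ((1 + `|1 - zr|) / zi); rewrite divfK//.
  have := ler_norm (- (1 - zr)); rewrite normrN => h; lra.
exact: (resolvent_z (beta := beta) erefl b0).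
Qed.

Lemma half_zero : [/\ prim (fun=> 0 : R) (fun=> 0),
  sqint Dp (fun=> 0) /\ sqint Dp (fun x => coef x * 0) & sqint Dp (fun x : R => aco x * 0)].
Proof.
have p0 : prim (fun=> 0 : R) (fun=> 0).
  by apply: prim_derive => x _; exact: cst_continuous.
have s0 : sqint Dp (fun=> 0 : R).
  by split; [exact: measurable_cst|apply: (eq_intR mDp _ (integrable0 _ _)) => x _; rewrite expr0n].
by split => //; [split => //|]; apply: eq_sqint s0; [exact: mDp|..] => //;
  try exact: mDp; move=> x _; rewrite mulr0.
Qed.

Lemma not_resolvent (r : R) : 1 <= r -> ~ resolvent_set (@cuspL R) r%:C.
Proof.
move=> r1 [_ _ [C hC]].
pose k := Num.sqrt (r - 1).
have k2 : 1 + k ^+ 2 = r by rewrite sqr_sqrtr ?subr_ge0// addrC subrK.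
have [m [K [m0 K0 H]]] := wave_packet (sqrtr_ge0 (r - 1) : 0 <= k).
(* For L = 2 T a bounded inverse would force m L^2 <= C^2 K; as T >= 1 this gives T <= C^2 K / m,
   against the choice of T. *)
pose T := C ^+ 2 * K / m + 1.
have T1 : 1 <= T by rewrite lerDr; apply: divr_ge0 (ltW m0); apply: mulr_ge0 K0; exact: sqr_ge0.
pose L := 2 * T.
have L2 : 2 <= L by rewrite /L; lra.
have [v1 [W1 [w1 [v2 [W2 [w2 [[p1 q1 p2 q2] [s1 s2 t] lb ub]]]]]]] := H L L2.
have [p0 s0 t0] := half_zero.
have [v [g [Lvg vE fE]]] := cuspL_glue r%:C p1 q1 p2 q2 p0 p0 p0 p0 s1 s2 s0 s0 t (conj t0 t0).
have [Lv [Lg _]] := (cuspLP v g).1 Lvg.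
have Lf := sqint_re_sub r%:C Lg Lv.
have := hC v g Lvg.
rewrite (L2normE Lv) (L2normE Lf) -EFinM lee_fin => le1.
have {le1} le2 : sqnorm v <= C ^+ 2 * sqnorm (fun x => g x - r%:C * v x).
  have := le1; rewrite -ler_sqr ?nnegrE ?sqrtr_ge0 ?(le_trans _ le1)//.
  by rewrite exprMn !sqr_sqrtr// sqnorm_ge0.
have nv : m * L <= sqnorm v.
  rewrite (sqnorm_halves Lv) -[leLHS]addr0; apply: lerD.
    apply: le_trans lb _; rewrite le_eqVlt; apply/orP; left; apply/eqP.
    by apply: eq_RI => x; rewrite in_Dp => /vE[-> -> _ _].
  by apply: Rintegral_ge0 => x _; apply: addr_ge0; exact: sqr_ge0.
have nf : sqnorm (fun x => g x - r%:C * v x) <= K / L.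
  rewrite (sqnorm_halves Lf) -[leRHS]addr0; apply: lerD.
    apply: le_trans ub; rewrite le_eqVlt; apply/orP; left; apply/eqP.
    apply: eq_RI => x; rewrite in_Dp => /fE[-> -> _ _] /=.
    by rewrite !mul0r subr0 addr0 k2.
  rewrite (@eq_RI _ _ _ (fun=> 0)) ?Rintegral_cst ?mul0r//.
  move=> x; rewrite in_Dp => /fE[_ _ -> ->] /=.
  by rewrite !(mulr0, mul0r, oppr0, addr0, subr0) expr0n addr0.
have L0 : 0 < L by lra.
have : m * L <= C ^+ 2 * (K / L).
  by apply: (le_trans nv); apply: (le_trans le2); apply: ler_wpM2l => //; exact: sqr_ge0.
rewrite mulrA ler_pdivlMr// => le3.
have le4 : m * T <= C ^+ 2 * K.
  apply: le_trans le3; rewrite -mulrA; apply: ler_wpM2l; first exact: ltW.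
  by rewrite /L; nra.
have : T <= C ^+ 2 * K / m by rewrite ler_pdivlMr// mulrC.
by rewrite /T; lra.
Qed.

End Spectrum.

Local Open Scope complex_scope.

Theorem proposition7 (R : realType) :
  spectrum (@cuspL R) = [set r%:C | r in `[(1 : R), +oo[].
Proof.
apply/seteqP; split => [[zr zi] nres|_ [r r1 <-]]; last first.
  by apply: not_resolvent; move: r1; rewrite /= in_itv/= andbT.
have [zi0|zi0] := eqVneq zi 0; last by case: nres; apply: resolvent_set_compl; left.
have [zr1|zr1] := ltP zr 1; first by case: nres; apply: resolvent_set_compl; right.
by exists zr; rewrite /= ?in_itv/= ?zr1// zi0.
Qed.
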